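(* Let $K$ be a number field, let $a,c\in K$ with $a\neq0$ and let $\phi=ax+a/x+c$. Let $\alpha\in K$, and suppose that there exists a prime $\mathfrak p$ of $K$ lying above $2$ such that one of the following holds: (1) $v_{\mathfrak p}(a)=0$ and $v_{\mathfrak p}(c)>0$; (2) $v_{\mathfrak p}(a)=0$, $h(a)>\log4$ and $c\equiv1\bmod\mathfrak p$. Then $[K^c_\infty(\phi,\alpha):K]<\infty$.
   Context: $v_{\mathfrak p}$ is the valuation associated to $\mathfrak p$, and $h$ is the absolute logarithmic Weil height. $\phi^{-\infty}(\alpha)=\{\gamma\in\overline K:\phi^n(\gamma)=\alpha\text{ for some }n\ge0\}$, and $K^c_\infty(\phi,\alpha)$ is the extension of $K$ generated by those $\gamma\in\phi^{-\infty}(\alpha)$ that lie in $K(\zeta_N)$ for some root of unity $\zeta_N$. *)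

(* Defs.v *)
(* everything happens inside algC, the algebraic closure of Q
   (= \bar{Q} = \bar{K} for every number field K viewed inside algC). *)
From HB Require Import structures.
From mathcomp Require Import all_boot all_order all_algebra all_field.
From Stdlib Require Import ClassicalEpsilon.
Set Implicit Arguments. Unset Strict Implicit. Unset Printing Implicit Defensive.
Import Order.TTheory GRing.Theory Num.Theory.
Local Open Scope ring_scope.

Definition is_subfield (F : algC -> Prop) : Prop :=
  [/\ F 0, F 1,
      (forall x y, F x -> F y -> F (x - y)),
      (forall x y, F x -> F y -> F (x * y)) &
      (forall x, F x -> F x^-1)].

(* L is spanned, as an F-vector space, by finitely many elements:
   i.e. the degree [L : F] is finite (L is assumed to contain F). *)
Definition fin_dim_over (F L : algC -> Prop) : Prop :=
  exists B : seq algC, forall x, L x ->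
    exists ks : seq algC, [/\ size ks = size B, (forall k, k \in ks -> F k) &
      x = \sum_(i < size B) ks`_i * B`_i].

Definition gen_field (F S : algC -> Prop) : algC -> Prop :=
  fun x => forall E : algC -> Prop, is_subfield E ->
    (forall y, F y -> E y) -> (forall y, S y -> E y) -> E x.

Definition number_field (K : algC -> Prop) : Prop :=
  is_subfield K /\ fin_dim_over (fun x => x \in Crat) K.

Definition ring_of_integers (K : algC -> Prop) : algC -> Prop :=
  fun x => K x /\ x \in Aint.

Definition prime_ideal_of (K P : algC -> Prop) : Prop :=
  (forall x, P x -> ring_of_integers K x) /\
  [/\ P 0,
      (forall x y, P x -> P y -> P (x + y)),
      (forall r x, ring_of_integers K r -> P x -> P (r * x)),
      ~ P 1 &
      (forall x y, ring_of_integers K x -> ring_of_integers K y ->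
          P (x * y) -> P x \/ P y)].

Definition prime_above_2 (K P : algC -> Prop) : Prop :=
  prime_ideal_of K P /\ P 2.

Fixpoint ideal_pow (K P : algC -> Prop) (n : nat) : algC -> Prop :=
  match n with
  | 0 => ring_of_integers K
  | n'.+1 => fun x => exists s : seq (algC * algC),
       (forall pq, pq \in s -> P pq.1 /\ ideal_pow K P n' pq.2) /\
       x = \sum_(pq <- s) pq.1 * pq.2
  end.

(* v_P(x) >= n  (for n : nat, x in K):  x lies in P^n O_{K,P},
   i.e. s * x in P^n for some s in O_K \ P. *)
Definition val_ge (K P : algC -> Prop) (x : algC) (n : nat) : Prop :=
  exists s, [/\ ring_of_integers K s, ~ P s & ideal_pow K P n (s * x)].

Definition val_eq0 (K P : algC -> Prop) (x : algC) : Prop :=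
  val_ge K P x 0 /\ ~ val_ge K P x 1.

Definition val_gt0 (K P : algC -> Prop) (x : algC) : Prop := val_ge K P x 1.

Definition congr_mod (K P : algC -> Prop) (x y : algC) : Prop :=
  val_gt0 K P (x - y).

(* leading coefficient of the primitive integer minimal polynomial of a:
   the least positive integer n such that n * minCpoly a has integer
   coefficients *)
Definition is_min_den (p : {poly algC}) (n : nat) : Prop :=
  [/\ (0 < n)%N, (n%:R *: p) \is a polyOver Num.int &
      forall m : nat, (0 < m)%N -> (m%:R *: p) \is a polyOver Num.int -> (n <= m)%N].

Definition min_den (a : algC) : nat :=
  epsilon (inhabits 0%N) (is_min_den (minCpoly a)).

Definition conjugates (a : algC) : seq algC :=
  epsilon (inhabits [::])
    (fun rs : seq algC => minCpoly a = \prod_(r <- rs) ('X - r%:P)).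

Definition mahler (a : algC) : algC :=
  (min_den a)%:R * \prod_(r <- conjugates a) Num.max 1 `|r|.

Definition exp_weil_height (a : algC) : algC :=
  (size (minCpoly a)).-1.-root (mahler a).

Definition phi (a c : algC) (x : algC) : algC := a * x + a / x + c.

(* gamma in phi^{-infty}(alpha): phi^n(gamma) = alpha for some n >= 0.
   Since phi(0) = phi(oo) = oo and alpha is finite, all intermediate iterates
   must be finite and nonzero. *)
Definition backward_orbit (a c alpha : algC) : algC -> Prop :=
  fun gamma => exists n : nat,
    (forall k, (k < n)%N -> iter k (phi a c) gamma != 0) /\
    iter n (phi a c) gamma = alpha.

Definition in_cyclotomic_ext (K : algC -> Prop) (gamma : algC) : Prop :=
  exists (N : nat) (z : algC), (0 < N)%N /\ z ^+ N = 1 /\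
    gen_field K (fun y => y = z) gamma.

Definition Kc_infty (K : algC -> Prop) (a c alpha : algC) : algC -> Prop :=
  gen_field K (fun g => backward_orbit a c alpha g /\ in_cyclotomic_ext K g).

(* Main.v *)
(* Write a backward orbit as a path alpha = g_0, ..., g_n = gamma with
   phi(g_(i+1)) = g_i.  An automorphism fixing g_i sends g_(i+1) to itself or to
   its inverse, so all the Galois groups that occur are 2-groups.
   Tame ramification at an odd prime q forces a quantity attached to the path,
   of height bounded independently of the path, to be divisible by q; hence only
   finitely many odd primes ramify, and gamma lies in some K(zeta) with zeta of
   order f * 2^k, f depending only on K, a, c and alpha.
   It remains to bound k.  Above 2, with residues taken in a valuation ring
   dominating P, an inertia element that moves g_(i+1) inverts it, so
   g_(i+1) = 1 mod P.  If v(c) > 0 this happens at most once along a path, and if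
   c = 1 mod P while alpha is not 1 mod P it never happens.  In the critical case
   alpha = c = 1 mod P, the points g_i eventually stay at distance at least some
   fixed positive radius from 1; then the different of F(gamma)/F, F a
   fixed layer of the cyclotomic Z_2-tower, is much smaller than Tate's bound on
   traces in that tower allows, unless the degree is bounded. *)

Require Import Defs.
From HB Require Import structures.
From mathcomp Require Import all_boot all_order all_algebra all_field.
From mathcomp Require Import zify ring lra.
From mathcomp Require Import boolp classical_sets.
Set Implicit Arguments. Unset Strict Implicit. Unset Printing Implicit Defensive.
Import Order.TTheory GRing.Theory Num.Theory.
Local Open Scope ring_scope.

(** No factorisation of ideals and no completion is used. At an odd prime q, nilpotency modulo q
    ([nilmod]) stands for membership in all primes above q; at 2 a single valuation ring of [algC]
    serves for all fields. Points of the orbit are not integral, so they are written u / w with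
    algebraic integers of bounded house; what q divides is the discriminant (y - c)^2 - 4 a^2 of the
    equation phi(x) = y, made integral by w. One constant C, a bound for v(D) with D a multiple of
    the discriminant of a generator of K, measures two defects at 2: Tate's bound loses C, and, as a
    consequence of that bound, the 2^C-th power of a generator of the tower is in the inertia group.
    In the critical case, for y = phi(x), phi(y) - y is phi(x) - x times a factor that is small when
    x and y are close to 1, so a long stay close to 1 makes phi(alpha) - alpha too small. This says
    nothing if alpha is a fixed point; then the other preimage 1 / alpha takes its place. Away from
    1 each quadratic step adds at most 1/2 to the valuation of the different, whereas Tate's bound
    asks for 1 per step up to a constant. *)

Local Notation pQtoC := (map_poly (ratr : rat -> algC)).
Local Notation pZtoC := (map_poly (intr : int -> algC)).

(** * Automorphisms of algC and simple extensions *)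

Notation aut := {rmorphism algC -> algC}.

(** The isomorphism Q(x) -> Q(y) sending x to y extends to the splitting field [Qr] of the common
    minimal polynomial, then to [algC]. *)
Lemma aut_conjugate (x y : algC) :
  root (minCpoly x) y -> exists nu : aut, nu x = y.
Proof.
have [p [Dp mon_p] dv_p] := minCpolyP x.
rewrite Dp => py0.
have [r Dr] := closed_field_poly_normal (pQtoC p : {poly algC}).
rewrite lead_coef_map (monicP mon_p) rmorph1 scale1r in Dr.
have rx : x \in r by rewrite -root_prod_XsubC -Dr dv_p.
have ry : y \in r by rewrite -root_prod_XsubC -Dr.
have [Qr [QrC [rr Drr genQr]]] := num_field_exists r.
have [x1 Dx] : exists x1, QrC x1 = x.
  by move: rx; rewrite -Drr => /mapP[x1 _ ->]; exists x1.
have [y1 Dy] : exists x1, QrC x1 = y.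
  by move: ry; rewrite -Drr => /mapP[y1 _ ->]; exists y1.
pose phi := kHomExtend 1 \1 x1 y1.
have hom1: kHom 1 1 (\1%VF : 'End(Qr)) by rewrite kHom1.
have Sinj_poly q : map_poly QrC (map_poly (in_alg Qr) q) = pQtoC q.
  rewrite -map_poly_comp; apply: eq_map_poly => a.
  by rewrite /= rmorphZ_num rmorph1 mulr1.
pose pr := map_poly (in_alg Qr) p.
have Qpr: pr \is a polyOver 1%VS.
  by apply/polyOverP=> i; rewrite coef_map memvZ ?memv_line.
have root_y1 : root (map_poly \1%VF (minPoly 1 x1)) y1.
  rewrite -(fmorph_root QrC) Dy -map_poly_comp.
  rewrite (@eq_map_poly _ _ _ QrC) => [|a]; last by rewrite /= id_lfunE.
  set p1 := map_poly _ _.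
  have [q1 Dp1]: exists q1, p1 = pQtoC q1.
    have aP i: (minPoly 1 x1)`_i \in 1%VS.
      by apply/polyOverP; apply: minPolyOver.
    have{aP} a_ i := sig_eqW (vlineP _ _ (aP i)).
    exists (\poly_(i < size (minPoly 1 x1)) sval (a_ i)).
    apply/polyP=> i; rewrite coef_poly coef_map coef_poly /=.
    case: ifP => _; rewrite ?rmorph0 //; case: (a_ i) => a /= ->.
    by rewrite alg_num_field fmorph_rat.
  have: root p1 x by rewrite -Dx fmorph_root root_minPoly.
  rewrite Dp1 dv_p => /dvdpP [r1 ->].
  by rewrite rmorphM rootM /= py0 orbT.
have hom_phi : kHom 1 <<1; x1>> phi by apply: kHomExtendP.
have splitQr: splittingFieldFor <<1; x1>> pr fullv.
  apply: splittingFieldForS (subv_adjoin _ _) (subvf _) _; exists rr => //.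
  congr (_ %= _): (eqpxx pr); apply/(map_poly_inj QrC).
  rewrite Sinj_poly Dr -Drr big_map rmorph_prod /=; apply: eq_bigr => zz _.
  by rewrite map_polyXsubC.
have [f1 aut_f1 Df1]:= kHom_extends (subv_adjoin _ _) hom_phi Qpr splitQr.
pose f1mM := GRing.isMonoidMorphism.Build _ _ f1 (kHom_monoid_morphism aut_f1).
pose mu : {lrmorphism _ -> _} := HB.pack (fun_of_lfun f1) f1mM.
have [nu Dnu] := extend_algC_subfield_aut QrC mu.
exists nu; rewrite -Dx -Dnu /= -Df1 ?memv_adjoin // -Dy; congr (QrC _).
rewrite -{1}[x1]hornerX (kHomExtend_poly hom1) ?polyOverX //.
rewrite map_polyE map_id_in => [|?]; last by rewrite id_lfunE.
by rewrite polyseqK hornerX.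
Qed.

(** The ring K[z], which is already the field K(z) when K is a field: [invr_poly] makes inverses
    polynomial because every element of [algC] is algebraic over Q. *)
Definition adj (K : {pred algC}) (z : algC) : {pred algC} :=
  fun x => `[< exists2 p, p \is a polyOver K & x = p.[z] >].

Lemma adjP (K : {pred algC}) (z x : algC) :
  reflect (exists2 p, p \is a polyOver K & x = p.[z]) (x \in adj K z).
Proof. exact: asboolP. Qed.

Lemma invr_poly (x : algC) :
  x != 0 -> exists q : {poly rat}, x^-1 = (pQtoC q).[x].
Proof.
move=> nzx; have [p [_ mon_p] dv_p] := minCpolyP x.
have [q [c Dp]] : exists q c, p = q * 'X + c%:P.
  by elim/poly_ind: p {mon_p dv_p} => [|q c _]; [exists 0, 0; rewrite mul0r add0r | exists q, c].
have px0 : root (pQtoC p) x by rewrite dv_p.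
have Ex : (pQtoC q).[x] * x + ratr c = 0.
  move/eqP: px0; rewrite Dp rmorphD rmorphM /= map_polyX map_polyC /=.
  by rewrite !hornerE.
have nzc : c != 0.
  apply/eqP=> c0; move: Ex; rewrite c0 rmorph0 addr0 => /eqP.
  rewrite mulf_eq0 (negPf nzx) orbF -/(root _ _) dv_p => /dvdp_leq le_pq.
  have nzq : q != 0.
    by apply: contraTneq mon_p => q0; rewrite Dp q0 c0 mul0r addr0 monicE lead_coef0 eq_sym oner_eq0.
  by move: (le_pq nzq); rewrite Dp c0 addr0 size_mulX // ltnn.
exists (- c^-1 *: q); rewrite map_polyZ hornerZ.
have nzc' : ratr c != 0 :> algC by rewrite fmorph_eq0.
have Eq : (pQtoC q).[x] = - ratr c / x.
  by apply: (mulIf nzx); rewrite divfK //; apply/eqP; rewrite -addr_eq0 Ex.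
by rewrite Eq rmorphN fmorphV /=; field; apply/andP.
Qed.

Lemma rat_polyOver (K : divringClosed algC) (q : {poly rat}) :
  pQtoC q \is a polyOver K.
Proof. by apply/polyOverP=> i; rewrite coef_map /= rpred_Crat ?Crat_rat. Qed.

Section Adjunction.
Variables (K : divringClosed algC) (z : algC).

Lemma adj_base x : x \in K -> x \in adj K z.
Proof. by move=> Kx; apply/adjP; exists x%:P; rewrite ?polyOverC ?hornerC. Qed.

Lemma adj_gen : z \in adj K z.
Proof. by apply/adjP; exists 'X; rewrite ?polyOverX ?hornerX. Qed.

Lemma adj_subring : subring_closed (adj K z).
Proof.
split=> [|x y /adjP[p Kp ->] /adjP[q Kq ->] | x y /adjP[p Kp ->] /adjP[q Kq ->]].
- by apply: adj_base; apply: rpred1.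
- by apply/adjP; exists (p - q); rewrite ?rpredB ?hornerD ?hornerN.
- by apply/adjP; exists (p * q); rewrite ?rpredM ?hornerM.
Qed.

Lemma adj_divring : divring_closed (adj K z).
Proof.
have [a1 aB aM] := adj_subring; split=> // x y Ax Ay; apply: aM => //.
have [->|nzy] := eqVneq y 0; first by rewrite invr0 -(subrr 1) aB.
have [q ->] := invr_poly nzy.
have /adjP[p Kp ->] := Ay; apply/adjP; exists (pQtoC q \Po p).
  by rewrite polyOver_comp ?rat_polyOver.
by rewrite horner_comp.
Qed.

HB.instance Definition _ := GRing.isDivringClosed.Build algC (adj K z) adj_divring.

End Adjunction.

Lemma sub_adj (K : divringClosed algC) (E : subringClosed algC) z :
  {subset K <= E} -> z \in E -> {subset adj K z <= E}.
Proof.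
move=> sKE Ez x /adjP[p Kp ->]; apply: (@rpred_horner _ E) => //.
by apply: polyOverS Kp.
Qed.

Lemma adj_expr (K : divringClosed algC) z n : {subset adj K (z ^+ n) <= adj K z}.
Proof. apply: sub_adj => [x Kx|]; first exact: adj_base.
by apply: rpredX; apply: adj_gen.
 Qed.

(** Horner's scheme: multiplication by z shifts the coefficients by one, and the overflowing term in
    z^m is absorbed into the constant coefficient, which may contain z^m. Independence of the powers
    of z is not claimed. *)
Lemma adj_expand (K : divringClosed algC) z m x : (0 < m)%N -> x \in adj K z ->
  exists2 k : nat -> algC, forall j, k j \in adj K (z ^+ m)
    & x = \sum_(j < m) k j * z ^+ j.
Proof.
case: m => // m _ /adjP[p Kp ->]; elim/poly_ind: p Kp => [|p c IHp] Kp.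
  exists (fun=> 0) => [j|]; first exact: rpred0.
  by rewrite horner0 big1 // => j _; rewrite mul0r.
have Kc : c \in K.
  by have /polyOverP/(_ 0%N) := Kp; rewrite coefD coefMX coefC add0r.
have {}Kp : p \is a polyOver K.
  apply/polyOverP=> i; have /polyOverP/(_ i.+1) := Kp.
  by rewrite coefD coefMX coefC /= addr0.
have [k Fk Dp] := IHp Kp; rewrite !hornerE Dp.
exists (fun j => if j is j'.+1 then k j' else c + k m * z ^+ m.+1) => [[|j]|] //.
  by apply: rpredD; [apply: adj_base | apply: rpredM; [apply: Fk | apply: adj_gen]].
rewrite [RHS]big_ord_recl [in LHS]big_ord_recr /= expr0 mulr1 mulrDl mulr_suml.
rewrite [X in _ = _ + X](eq_bigr (fun i : 'I_m => k i * z ^+ i * z)) => [|i _]; last first.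
  by rewrite -mulrA -exprSr /bump leq0n add1n.
by rewrite -mulrA -exprSr; ring.
Qed.

Lemma adj1 (K : divringClosed algC) : {subset adj K 1 <= K}.
Proof. by apply: sub_adj => //; apply: rpred1. Qed.

Lemma adj_expand1 (K : divringClosed algC) z m x : (0 < m)%N -> z ^+ m = 1 ->
    x \in adj K z ->
  exists2 k : nat -> algC, forall j, k j \in K & x = \sum_(j < m) k j * z ^+ j.
Proof.
move=> m_gt0 zm1 /(adj_expand m_gt0)[k Kk Dx]; exists k => // j.
by apply: adj1; rewrite -zm1.
Qed.

Lemma aut_adj (K : divringClosed algC) z (nu mu : aut) :
  {in K, nu =1 mu} -> nu z = mu z -> {in adj K z, nu =1 mu}.
Proof.
move=> eqK eqz _ /adjP[p Kp ->]; rewrite -!horner_map /= eqz; congr _.[_].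
by apply/polyP=> i; rewrite !coef_map /= eqK // (polyOverP Kp).
Qed.

Lemma aut_adj_id (K : divringClosed algC) z (nu : aut) :
  {in K, nu =1 id} -> nu z = z -> {in adj K z, nu =1 id}.
Proof. by move=> nuK nuz x /(@aut_adj K z nu idfun nuK nuz). Qed.

Lemma aut_adj_stable (K : divringClosed algC) z (nu : aut) :
  {in K, nu =1 id} -> nu z \in adj K z ->
  forall x, x \in adj K z -> nu x \in adj K z.
Proof.
move=> nuK Fz _ /adjP[p Kp ->]; rewrite -horner_map /=.
suff -> : map_poly nu p = p.
  apply: (@rpred_horner _ (adj K z)) => //.
  by apply: polyOverS Kp => x; apply: adj_base.
by apply/polyP=> i; rewrite coef_map /= nuK // (polyOverP Kp).
Qed.

(** All conjugates of x equal x, so its minimal polynomial is (X - x)^n, whose coefficient of degree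
    n - 1 is - n x. *)
Lemma aut_fixed_Crat (x : algC) : (forall nu : aut, nu x = x) -> x \in Crat.
Proof.
move=> fix_x; have [p [Dp mon_p] dv_p] := minCpolyP x.
have [r Dr] := closed_field_poly_normal (pQtoC p : {poly algC}).
rewrite lead_coef_map (monicP mon_p) rmorph1 scale1r in Dr.
have r_x y : y \in r -> y = x.
  rewrite -root_prod_XsubC -Dr -Dp => /aut_conjugate[nu <-]; exact: fix_x.
have /all_pred1P Er : all (pred1 x) r by apply/allP=> y /r_x/eqP.
set n := size r in Er.
have n_gt0 : (0 < n)%N.
  have : size (minCpoly x) = n.+1 by rewrite Dp Dr size_prod_XsubC.
  by have := size_minCpoly x => + E; rewrite E ltnS.
have Ep : pQtoC p = ('X - x%:P) ^+ n.
  by rewrite Dr Er big_nseq; elim: (n) => //= m ->; rewrite exprS.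
have := congr1 (fun q : {poly algC} => q`_n.-1) Ep.
rewrite coef_map /= -[in RHS](prednK n_gt0).
have -> : (('X - x%:P) ^+ n.-1.+1)`_n.-1 = - (x *+ n.-1.+1).
  rewrite exprSr mulrBr coefB coefMX coefMC.
  case: (n.-1) => [|m] /=; first by rewrite expr0 coef1 mul1r sub0r.
  have -> : (('X - x%:P) ^+ m.+1)`_m.+1 = 1.
    have := monicP (monic_exp m.+1 (monicXsubC x)).
    by rewrite /lead_coef size_exp_XsubC.
  elim: m => [|m IHm]; first by rewrite expr1 coefB coefX coefC /= sub0r mul1r mulr2n opprD.
  rewrite exprSr mulrBr coefB coefMX coefMC /=.
  have -> : (('X - x%:P) ^+ m.+1)`_m.+1 = 1.
    have := monicP (monic_exp m.+1 (monicXsubC x)).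
    by rewrite /lead_coef size_exp_XsubC.
  by move: IHm; rewrite !mul1r; move: (_`_m) => t E; rewrite [x *+ m.+3]mulrS opprD -E; ring.
move=> Ex; have -> : x = - ratr p`_n.-1 / n.-1.+1%:R.
  by rewrite Ex opprK -[x *+ _]mulr_natr mulfK // pnatr_eq0.
by rewrite rpred_div ?rpredN ?Crat_rat ?rpred_nat.
Qed.

(** The [E i] represent each embedding of Q(l) once. Being automorphisms of all of [algC] they can
    be composed with others, which permutes the embeddings in [trace_Crat]. *)
Lemma embeddings_exist (l : algC) :
  exists n (E : 'I_n -> aut),
    injective (fun i => E i l) /\ forall mu : aut, exists i, E i l = mu l.
Proof.
have [r Dr] := closed_field_poly_normal (minCpoly l).
rewrite (monicP (minCpoly_monic l)) scale1r in Dr.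
pose s := undup r.
have ex_nu (i : 'I_(size s)) : exists nu : aut, nu l = s`_i.
  by apply: aut_conjugate; rewrite Dr root_prod_XsubC -mem_undup mem_nth.
have [E DE] := fin_all_exists ex_nu.
exists (size s), E; split=> [i j|mu] /=; rewrite ?DE.
  by move/eqP; rewrite nth_uniq ?undup_uniq // => /eqP/val_inj.
have : mu l \in s.
  by rewrite mem_undup -root_prod_XsubC -Dr -(minCpoly_aut mu) root_minCpoly.
rewrite -index_mem => lt_s; exists (Ordinal lt_s).
by rewrite DE /= nth_index // -index_mem.
Qed.

Lemma trace_Crat (l : algC) n (E : 'I_n -> aut) :
    injective (fun i => E i l) -> (forall mu : aut, exists i, E i l = mu l) ->
  forall x, x \in adj Crat l -> \sum_i E i x \in Crat.
Proof.
move=> injE surE x Lx; apply: aut_fixed_Crat => nu.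
have ex_s i : exists j, E j l = nu (E i l) by apply: (surE (nu \o E i)).
have [s Ds] := fin_all_exists ex_s.
have inj_s : injective s.
  by move=> i j /(congr1 (fun k => E k l)); rewrite !Ds => /fmorph_inj/injE.
rewrite rmorph_sum /= [RHS](reindex_inj inj_s) /=; apply: eq_bigr => i _.
apply: (@aut_adj Crat l (nu \o E i) (E (s i))) => [y Qy||//] /=.
  by rewrite !aut_Crat.
by rewrite Ds.
Qed.

(** * Integrality, denominators and houses *)

Lemma Aint_integralOver (x : algC) :
  x \in Aint <-> integralOver (intr : int -> algC) x.
Proof.
split=> [Zx | [p mon_p px0]]; last first.
  apply: (@root_monic_Aint (pZtoC p)); rewrite ?monic_map //.
  by apply/polyOverP=> i; rewrite coef_map /= rpred_int.
have /floorpP[p Dp] : minCpoly x \is a polyOver Num.int by [].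
exists p; last by rewrite -Dp root_minCpoly.
have := minCpoly_monic x; rewrite Dp !monicE lead_coef_map_inj; last first.
- by rewrite rmorph0.
- exact: intr_inj.
by rewrite -(rmorph1 (intr : int -> algC)) (inj_eq intr_inj).
Qed.

Lemma Aint_root_monic (p : {poly algC}) (x : algC) :
  p \is monic -> p \is a polyOver Aint -> root p x -> x \in Aint.
Proof.
move=> mon_p Zp px0; apply/Aint_integralOver.
apply: integral_root_monic mon_p px0 _; apply/integral_poly => i.
by apply/Aint_integralOver/(polyOverP Zp).
Qed.

Lemma Aint_expr (x : algC) n : (0 < n)%N -> x ^+ n \in Aint -> x \in Aint.
Proof.
move=> n_gt0 Zx; apply: (@Aint_root_monic ('X^n - (x ^+ n)%:P)).
- exact: monicXnsubC.
- by rewrite rpredB ?polyOverXn ?polyOverC.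
- by rewrite rootE !hornerE subrr.
Qed.

Lemma int_primitive_poly (y : algC) :
  exists2 q : {poly int}, zcontents q = 1 & root (pZtoC q) y.
Proof.
have [p [_ mon_p] dv_p] := minCpolyP y.
have [q [a nz_a Dp]] := rat_poly_scale p.
have nzq : q != 0.
  by apply: contraTneq mon_p => q0; rewrite Dp q0 rmorph0 scaler0 monicE lead_coef0 eq_sym oner_eq0.
exists (zprimitive q); first by rewrite zcontents_primitive nzq.
have : root (pQtoC p) y by rewrite dv_p.
rewrite Dp map_polyZ /= rootZ ?fmorph_eq0 ?invr_eq0 ?intr_eq0 //.
rewrite -map_poly_comp (@eq_map_poly _ _ _ intr) => [|i]; last by rewrite /= rmorph_int.
rewrite {1}[q]zpolyEprim map_polyZ rootZ // intr_eq0 zcontents_eq0 //.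
Qed.

(** * Denominators of an algebraic number *)

Section Denominators.
Variables (q : {poly int}) (y : algC).
Hypothesis qy0 : root (pZtoC q) y.

(** These are the partial Horner values of an integral equation of y: [b k] and [b k.+1 * y] are
    algebraic integers although y need not be one, and by [bS] the coefficient q_k is their
    difference. *)
Let b k : algC := (pZtoC (drop_poly k q)).[y].

Let bS k : b k = b k.+1 * y + (q`_k)%:~R.
Proof.
rewrite /b (_ : drop_poly k q = drop_poly k.+1 q * 'X + (q`_k)%:P); last first.
  apply/polyP=> [[|i]]; rewrite coefD coefMX coefC !coef_drop_poly /= ?add0r //.
  by rewrite addr0 addnS.
by rewrite rmorphD rmorphM /= map_polyX map_polyC /= !hornerE.
Qed.

Let q_split k : b k * y ^+ k + \sum_(i < k) (q`_i)%:~R * y ^+ i = 0.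
Proof.
elim: k => [|k IHk].
  by rewrite big_ord0 addr0 mulr1 /b drop_poly0l; apply/eqP.
rewrite big_ord_recr /= -[RHS]IHk (bS k) exprS; ring.
Qed.

(** Multiplied by c^k, the relation [q_split] at k + 1 becomes a monic equation for c y. *)
Let by_Aint k : b k.+1 \in Aint -> b k.+1 * y \in Aint.
Proof.
move=> Zb; set c := b k.+1 in Zb *.
pose r := \sum_(i < k.+1) ((q`_i)%:~R * c ^+ (k - i)) *: 'X^i : {poly algC}.
have sz_r : (size r <= k.+1)%N.
  apply: (leq_trans (size_sum _ _ _)); apply/bigmax_leqP => i _.
  by apply: leq_trans (size_scale_leq _ _) _; rewrite size_polyXn.
apply: (@Aint_root_monic ('X^(k.+1) + r)).
- by rewrite monicE lead_coefDl ?lead_coefXn ?size_polyXn ?ltnS.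
- rewrite rpredD ?polyOverXn // rpred_sum // => i _.
  by rewrite polyOverZ ?polyOverXn // rpredM ?rpredX ?Aint_int.
rewrite rootE !hornerE horner_sum.
have -> : \sum_(i < k.+1) (((q`_i)%:~R * c ^+ (k - i)) *: 'X^i).[c * y]
    = c ^+ k * \sum_(i < k.+1) (q`_i)%:~R * y ^+ i.
  rewrite mulr_sumr; apply: eq_bigr => i _; rewrite hornerZ hornerXn exprMn.
  have -> : c ^+ k = c ^+ (k - i) * c ^+ i by rewrite -exprD subnK // -ltnS.
  move: (c ^+ (k - i)) (c ^+ i) => u v. ring.
rewrite exprMn [c ^+ k.+1]exprSr -!mulrA -mulrDr -/(b k.+1) q_split mulr0 //.
Qed.

Let b_Aint k : b k \in Aint.
Proof.
have b0 j : (size q <= j)%N -> b j \in Aint.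
  by move=> le_j; rewrite /b drop_poly_eq0 // rmorph0 horner0 Aint0.
have [/b0 //|/ltnW le_k] := leqP (size q) k.
rewrite -(subKn le_k); elim: (_ - k)%N => [|i IHi]; first by rewrite subn0 b0.
case lt_i : (i < size q)%N; last by rewrite (eqP (_ : size q - i.+1 == size q - i)%N) //; lia.
rewrite bS rpredD ?Aint_int // by_Aint //.
by rewrite (_ : (size q - i.+1).+1 = size q - i)%N //; lia.
Qed.

Let denom d := [/\ d \in adj Crat y, d \in Aint & d * y \in Aint].

Lemma denominator_int k :
  exists d0 d1, [/\ denom d0, denom d1 & (q`_k)%:~R = d0 + d1 * y].
Proof.
have Qb i : b i \in adj Crat y.
  apply/adjP; exists (pZtoC (drop_poly i q)) => //.
  by apply/polyOverP=> j; rewrite coef_map /= rpred_int.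
have Db i : denom (b i.+1) by split=> //; apply: by_Aint.
case: k => [|k].
  exists 0, (- b 1); split.
  - by split; rewrite ?mul0r ?rpred0 ?Aint0 //; apply: rpred0.
  - by case: (Db 0%N) => D1 D2 D3; split; rewrite ?mulNr ?rpredN //; apply: rpredN.
  have := q_split 0; rewrite big_ord0 mulr1 addr0 bS => /eqP.
  by rewrite addrC addr_eq0 => /eqP ->; rewrite add0r mulNr.
exists (b k.+1), (- b k.+2); split=> //.
  by case: (Db k.+1) => D1 D2 D3; split; rewrite ?mulNr ?rpredN //; apply: rpredN.
by rewrite [b k.+1]bS; ring.
Qed.
End Denominators.

(* The coefficients of a primitive integral equation of [y] all lie in the
   ideal of denominators of [y] plus [y] times itself, so this ideal sum is 1. *)
Lemma denominators_coprime (y : algC) :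
  exists d0 d1, [/\ d0 \in adj Crat y, d1 \in adj Crat y,
    [/\ d0 \in Aint, d0 * y \in Aint, d1 \in Aint & d1 * y \in Aint]
    & d0 + d1 * y = 1].
Proof.
have [q cont_q qy0] := int_primitive_poly y.
pose denom d := [/\ d \in adj Crat y, d \in Aint & d * y \in Aint].
pose D (n : algC) := exists d0 d1, [/\ denom d0, denom d1 & n = d0 + d1 * y].
have denomB d e m n : denom d -> denom e -> denom (m%:~R * d - n%:~R * e).
  move=> [d1 d2 d3] [e1 e2 e3]; split; last first.
  - by rewrite mulrBl -!mulrA; apply: rpredB; apply: rpredM; rewrite ?Aint_int.
  - by apply: rpredB; apply: rpredM; rewrite ?Aint_int.
  by apply: rpredB; apply: rpredM => //; apply: rpred_int.
have DB m n u v : D m -> D n -> D (u%:~R * m - v%:~R * n).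
  move=> [d0 [d1 [Dd0 Dd1 ->]]] [e0 [e1 [De0 De1 ->]]].
  exists (u%:~R * d0 - v%:~R * e0), (u%:~R * d1 - v%:~R * e1).
  by split; [apply: denomB | apply: denomB | ring].
have D0 : D 0.
  have d0 : denom 0 by split; rewrite ?mul0r ?Aint0 //; apply: rpred0.
  by exists 0, 0; split; rewrite ?mul0r ?addr0.
have Dgcd m n : D m%:R -> D n%:R -> D (gcdn m n)%:R.
  have [-> _|m_gt0 Dm Dn] := posnP m; first by rewrite gcd0n.
  case: (egcdnP n m_gt0) => km kn def_d _.
  have -> : (gcdn m n)%:R = (km%:Z)%:~R * m%:R - (kn%:Z)%:~R * n%:R :> algC.
    by rewrite -!pmulrn -!natrM def_d natrD addrC addKr.
  exact: DB.
have  : D 1%:R.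
  have -> : 1%N = \big[gcdn/0%N]_(i < size q) `|(q`_i)%R|%N.
    move/(congr1 absz): cont_q; rewrite /zcontents abszM absz_sg lead_coef_eq0 /=.
    by case: eqP => [->|_] //=; rewrite mul1n.
  apply: (big_ind (fun n => D n%:R)) => // i _.
  have Dq := denominator_int qy0 i.
  have -> : `|(q`_i)%R|%N%:R = (sgz q`_i)%:~R * (q`_i)%:~R - (0%:Z)%:~R * 0 :> algC.
    by rewrite mulr0 subr0 -rmorphM /= -abszEsg pmulrn.
  apply: DB => //.
case=> d0 [d1 [[a1 a2 a3] [b1 b2 b3] E]]; by exists d0, d1; split=> //; rewrite -E.
Qed.

Lemma Aint_multiple (x : algC) : exists2 n : nat, (0 < n)%N & n%:R * x \in Aint.
Proof.
have [p [_ mon_p] dv_p] := minCpolyP x.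
have [q [a nz_a Dp]] := rat_poly_scale p.
have nzq : q != 0.
  by apply: contraTneq mon_p => q0; rewrite Dp q0 rmorph0 scaler0 monicE lead_coef0 eq_sym oner_eq0.
have qx0 : root (pZtoC q) x.
  have : root (pQtoC p) x by rewrite dv_p.
  rewrite Dp map_polyZ /= rootZ ?fmorph_eq0 ?invr_eq0 ?intr_eq0 //.
  by rewrite -map_poly_comp (@eq_map_poly _ _ _ intr) => [|i] //; rewrite /= rmorph_int.
have [k Dk] : exists k, size q = k.+2.
  have := size_minCpoly x; case E: (size q) => [|[|k]]; last by exists k.
    by move/eqP: E; rewrite size_poly_eq0 (negPf nzq).
  move/eqP/size_poly1P: E qx0 => [c nzc ->].
  by rewrite map_polyC rootC /= intr_eq0 (negPf nzc).
set c := lead_coef q.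
have Zcx : c%:~R * x \in Aint.
  pose r := \sum_(i < k.+1) ((q`_i)%:~R * c%:~R ^+ (k - i)) *: 'X^i : {poly algC}.
  have sz_r : (size r <= k.+1)%N.
    apply: (leq_trans (size_sum _ _ _)); apply/bigmax_leqP => i _.
    by apply: leq_trans (size_scale_leq _ _) _; rewrite size_polyXn.
  apply: (@Aint_root_monic ('X^(k.+1) + r)).
  - by rewrite monicE lead_coefDl ?lead_coefXn ?size_polyXn ?ltnS.
  - rewrite rpredD ?polyOverXn // rpred_sum // => i _.
    by rewrite polyOverZ ?polyOverXn // rpredM ?rpredX ?Aint_int.
  rewrite rootE !hornerE horner_sum.
  have -> : \sum_(i < k.+1) (((q`_i)%:~R * c%:~R ^+ (k - i)) *: 'X^i).[c%:~R * x]
      = c%:~R ^+ k * \sum_(i < k.+1) (q`_i)%:~R * x ^+ i.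
    rewrite mulr_sumr; apply: eq_bigr => i _; rewrite hornerZ hornerXn exprMn.
    have -> : c%:~R ^+ k = c%:~R ^+ (k - i) * c%:~R ^+ i :> algC.
      by rewrite -exprD subnK // -ltnS.
    by move: (c%:~R ^+ (k - i)) (c%:~R ^+ i) => u v; ring.
  rewrite exprMn [_%:~R ^+ k.+1]exprSr -!mulrA -mulrDr.
  have /eqP := qx0; rewrite horner_coef size_map_poly_id0 ?intr_eq0 ?lead_coef_eq0 //.
  rewrite Dk big_ord_recr /= coef_map /= (_ : q`_k.+1 = c); last by rewrite /c lead_coefE Dk.
  under eq_bigr do rewrite coef_map /=.
  by rewrite addrC => ->; rewrite mulr0.
exists `|c|%N; first by rewrite absz_gt0 lead_coef_eq0.
have -> : `|c|%N%:R = (sgz c)%:~R * c%:~R :> algC.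
  by rewrite -rmorphM /= -abszEsg pmulrn.
by rewrite -mulrA rpredM ?Aint_int.
Qed.

Lemma house_bound (x : algC) : exists B : nat, forall nu : aut, `|nu x| <= B%:R.
Proof.
have [n [E [_ surE]]] := embeddings_exist x.
pose s : algC := \sum_i `|E i x|.
have s_ge0 : 0 <= s by apply: sumr_ge0 => i _; apply: normr_ge0.
exists (Num.bound s) => nu; have [i <-] := surE nu.
apply: le_trans (ltW (archi_boundP s_ge0)).
by rewrite /s (bigD1 i) //= lerDl sumr_ge0.
Qed.

(** The product of the conjugates is up to sign the constant coefficient of the minimal polynomial,
    a nonzero integer, so the conjugates cannot all lie in the open unit disc. *)
Lemma house_ge1 (z : algC) :
  z \in Aint -> z != 0 -> exists nu : aut, 1 <= `|nu z|.
Proof.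
move=> Zz nzz; apply: contrapT => no_nu.
have lt1 (nu : aut) : `|nu z| < 1.
  by rewrite real_ltNge ?normr_real ?real1 //; apply/negP => ge1; apply: no_nu; exists nu.
have [r Dr] := closed_field_poly_normal (minCpoly z).
rewrite (monicP (minCpoly_monic z)) scale1r in Dr.
have r_lt1 y : y \in r -> `|y| < 1.
  by rewrite -root_prod_XsubC -Dr => /aut_conjugate[nu <-].
have r_nz y : y \in r -> y != 0.
  rewrite -root_prod_XsubC -Dr => /aut_conjugate[nu <-].
  by rewrite fmorph_eq0.
have Zp : (minCpoly z)`_0 \is a Num.int.
  by have /polyOverP := Zz; apply.
have Dp : `|(minCpoly z)`_0| = \prod_(y <- r) `|y|.
  rewrite Dr -horner_coef0 horner_prod normr_prod; apply: eq_bigr => y _.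
  by rewrite !hornerE normrN.
have p_nz : (minCpoly z)`_0 != 0.
  by rewrite -normr_eq0 Dp prodf_seq_neq0; apply/allP=> y /r_nz; rewrite normr_eq0.
have p_ge1 : 1 <= `|(minCpoly z)`_0| by rewrite norm_intr_ge1.
have r_n0 : r != [::].
  apply/eqP=> r0; have := size_minCpoly z.
  by rewrite Dr r0 big_nil size_poly1.
suff : `|(minCpoly z)`_0| < 1 by move=> lt; have := lt_le_trans lt p_ge1; rewrite ltxx.
rewrite Dp; case: (r) r_n0 r_lt1 => // y s _ s_lt1.
rewrite big_cons; apply: le_lt_trans (_ : `|y| < 1); last by rewrite s_lt1 ?mem_head.
rewrite ler_piMr ?normr_ge0 //.
elim: s s_lt1 => [|x s IHs] s_lt1; first by rewrite big_nil.
rewrite big_cons mulr_ile1 ?normr_ge0 ?prodr_ge0 //.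
  by rewrite ltW // s_lt1 // !inE eqxx orbT.
by apply: IHs => t; rewrite inE => /orP[/eqP->|st]; apply: s_lt1; rewrite !inE ?eqxx ?st ?orbT.
Qed.

(** * Primitive elements and cyclotomic independence *)

Lemma polyOver_Crat (p : {poly algC}) :
  p \is a polyOver Crat -> exists r : {poly rat}, p = pQtoC r.
Proof.
move=> Qp; exists (map_poly getCrat p); apply/polyP=> i.
have r0 : getCrat 0 = 0 by rewrite -(rmorph0 (ratr : rat -> algC)) ratCK.
by rewrite coef_map /= coef_map_id0 // getCratK // (polyOverP Qp).
Qed.

(** The spanning family [B] need not lie in K, so [algC_PET] only places K inside a number field. An
    element of K of maximal degree generates K: together with any y in K it generates a simple
    extension, which cannot be larger. *)
Lemma number_field_generator (K : divringClosed algC) :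
    fin_dim_over (fun x => x \in Crat) (fun x => x \in K) ->
  exists t, [/\ t \in K, t \in Aint & {subset K <= adj Crat t}].
Proof.
case=> B spanB; have [be _ [ps Ds]] := algC_PET B.
have K_be x : x \in K -> x \in adj Crat be.
  move=> /spanB[ks [sz_ks Qks ->]].
  apply: rpred_sum => i _; apply: rpredM.
    by apply: adj_base; apply: Qks; rewrite mem_nth ?sz_ks.
  have /mapP[p _ ->] : B`_i \in [seq (pQtoC p).[be] | p <- ps] by rewrite -Ds mem_nth.
  by apply/adjP; exists (pQtoC p) => //; apply: rat_polyOver.
have [Qs [QsC [[|b []] //= [Db] genQs]]] := num_field_exists [:: be].
have Sinj_poly q : map_poly QsC (map_poly (in_alg Qs) q) = pQtoC q.
  rewrite -map_poly_comp; apply: eq_map_poly => a.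
  by rewrite /= rmorphZ_num rmorph1 mulr1.
have liftK x : x \in K -> exists x1, QsC x1 = x.
  move=> /K_be/adjP[p /polyOver_Crat[r ->] ->].
  by exists (map_poly (in_alg Qs) r).[b]; rewrite -horner_map Db Sinj_poly.
pose P d := `[< exists2 x1, QsC x1 \in K & \dim <<1; x1>>%VS = d >].
have exP : exists d, P d.
  by exists (\dim <<1; (1 : Qs)>>%VS); apply/asboolP; exists 1; rewrite // rmorph1 rpred1.
have leP d : P d -> (d <= \dim {: Qs})%N.
  by move=> /asboolP[x1 _ <-]; rewrite dimvS ?subvf.
case: (ex_maxnP exP leP) => d /asboolP[x1 Kx1 Dd] max_d.
have x_gen : {subset K <= adj Crat (QsC x1)}.
  move=> y Ky; have [z [a Dz] [[|px [|py []]] //= [Ex Ey]]] := algC_PET [:: QsC x1; y].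
  have Kz : z \in K.
    rewrite Dz; apply: rpred_sum => -[[|[|i]] lti] _ //=; apply: rpredMn => //.
  have [z1 Dz1] := liftK z Kz.
  have in_z (p : {poly rat}) : (map_poly (in_alg Qs) p).[z1] \in <<1; z1>>%VS.
    apply: mempx_Fadjoin; apply/polyOverP=> i.
    by rewrite coef_map memvZ ?memv_line.
  have Ex1 : x1 = (map_poly (in_alg Qs) px).[z1].
    by apply: (fmorph_inj QsC); rewrite -horner_map Dz1 Sinj_poly.
  have sub_xz : (<<1; x1>> <= <<1; z1>>)%VS.
    by apply/FadjoinP; split; [apply: sub1v | rewrite Ex1].
  have /eqP E : <<1; x1>>%VS == <<1; z1>>%VS.
    rewrite eqEdim sub_xz Dd; apply: max_d; apply/asboolP.
    by exists z1; rewrite ?Dz1.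
  have : (map_poly (in_alg Qs) py).[z1] \in <<1; x1>>%VS by rewrite E.
  case/Fadjoin_polyP=> p Qp /(congr1 QsC).
  rewrite -!horner_map /= Dz1 Sinj_poly -Ey => ->.
  apply/adjP; exists (map_poly QsC p) => //; apply/polyOverP=> i.
  have /vlineP[c Dc] : p`_i \in 1%VS by apply: polyOverP.
  by rewrite coef_map /= Dc rmorphZ_num rmorph1 mulr1 Crat_rat.
have [n n_gt0 Zn] := Aint_multiple (QsC x1).
exists (n%:R * QsC x1); split=> //; first by rewrite rpredM ?rpred_nat.
move=> y /x_gen; apply: sub_adj y => [y|]; first exact: adj_base.
rewrite -[X in X \in _](mulKf (_ : n%:R != 0)) ?pnatr_eq0 -?lt0n //.
apply: rpredM; last exact: adj_gen.
by apply: adj_base; rewrite rpredV rpred_nat.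
Qed.

Lemma adj_simple (K : divringClosed algC) t z :
    t \in K -> {subset K <= adj Crat t} ->
  exists2 l, l \in adj K z & {subset adj K z <= adj Crat l}.
Proof.
move=> Kt sKt; have [l [a Dl] [[|pt [|pz []]] //= [Et Ez]]] := algC_PET [:: t; z].
have Lq (p : {poly rat}) : (pQtoC p).[l] \in adj Crat l.
  by apply/adjP; exists (pQtoC p) => //; apply: rat_polyOver.
exists l.
  rewrite Dl; apply: rpred_sum => -[[|[|i]] lti] _ //=; apply: rpredMn.
    exact: adj_base.
  exact: adj_gen.
apply: sub_adj => [x /sKt|]; last by rewrite Ez.
by apply: sub_adj x => [y|]; [apply: adj_base | rewrite Et].
Qed.

Lemma prim_root1 : 1.-primitive_root (1 : algC).
Proof.
by apply/andP; split=> //; apply/forallP=> i; rewrite ord1 unity_rootE expr1 !eqxx.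
Qed.

(** [Sep] says that the mu_i lie in different cosets of the image of Gal(K) in Gal(Q(z0)/Q). The
    number of cosets is bounded by the number of embeddings of Q(t), so some order f maximises it.
    At a level N divisible by f, an automorphism trivial on the f-th roots of unity but outside the
    image would produce one more coset, that of mu_0 nu. *)
Lemma cyclotomic_independence (K : divringClosed algC) t :
    {subset K <= adj Crat t} ->
  exists2 f, (0 < f)%N & forall N z (nu : aut), N.-primitive_root z -> (f %| N)%N ->
    nu (z ^+ (N %/ f)) = z ^+ (N %/ f) ->
  exists2 tau : aut, {in K, tau =1 id} & tau z = nu z.
Proof.
move=> sKt; pose Sep s (z0 : algC) (mu : 'I_s -> aut) :=
  forall i j (tau : aut), i != j -> {in K, tau =1 id} -> mu i (tau z0) != mu j z0.
pose P s := `[< exists f z0 mu, f.-primitive_root z0 /\ Sep s z0 mu >].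
have [n [E [injE surE]]] := embeddings_exist t.
have leP s : P s -> (s <= n)%N.
  case/asboolP=> f [z0 [mu [_ sep]]].
  have ex_i (a : 'I_s) : exists i, E i t = mu a t by apply: surE.
  have [g Dg] := fin_all_exists ex_i.
  (* Two mu that agree at t differ by an automorphism trivial on K, hence are in the same coset. *)
  suff /leq_card : injective g by rewrite !card_ord.
  move=> a b /(congr1 (fun i => E i t)); rewrite !Dg => Eab.
  apply/eqP; apply: contraT => nab.
  pose tau : aut := (algC_invaut (mu a) : aut) \o mu b.
  have Ktau : {in K, tau =1 id}.
    apply: sub_in1 sKt _ _; apply: aut_adj_id => [x Qx /=|/=].
      by rewrite !aut_Crat.
    by rewrite -Eab algC_autK.
  by have := sep a b tau nab Ktau; rewrite /tau /= algC_invautK eqxx.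
have exP : exists s, P s.
  exists 1%N; apply/asboolP; exists 1%N, 1, (fun=> idfun); split.
    exact: prim_root1.
  by move=> i j tau; rewrite !ord1 eqxx.
case: (ex_maxnP exP leP) => s /asboolP[f [z0 [mu [prim_z0 sep]]]] max_s.
have {exP} s_gt0 : (0 < s)%N.
  apply: (max_s 1%N); apply/asboolP; exists 1%N, 1, (fun=> idfun); split.
    exact: prim_root1.
  by move=> i j tau; rewrite !ord1 eqxx.
case: s => // s in mu sep max_s s_gt0 *.
exists f => [|N z nu prim_z dv_f nuz]; first exact: prim_order_gt0 prim_z0.
apply: contrapT => no_tau.
have N_gt0 := prim_order_gt0 prim_z.
pose z1 := z ^+ (N %/ f).
have [i0 Dz0] : exists i, z0 = z1 ^+ i.
  have prim_z1 : f.-primitive_root z1.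
    exact: (dvdn_prim_root prim_z dv_f).
  by have /(prim_rootP prim_z1)[i ->] := prim_expr_order prim_z0; exists i.
have sep1 i j (tau : aut) : i != j -> {in K, tau =1 id} -> mu i (tau z1) != mu j z1.
  move=> nij /(sep i j tau nij); apply: contraNneq.
  by rewrite Dz0 !rmorphXn /= => ->.
have nu_tau (tau : aut) : nu (tau z1) = tau z1.
  have prim_z1 : f.-primitive_root z1.
    exact: (dvdn_prim_root prim_z dv_f).
  have /(prim_rootP prim_z1)[k ->] : (tau z1) ^+ f = 1.
    by rewrite -rmorphXn /= prim_expr_order // rmorph1.
  by rewrite rmorphXn /= nuz.
pose mu' (i : 'I_s.+2) : aut :=
  if unlift ord_max i is Some j then mu j else (mu ord0 \o nu).
suff : P s.+2 by move/max_s; rewrite ltnn.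
apply/asboolP; exists N, z, mu'; split=> // i j tau nij Ktau.
rewrite /mu'; case: unliftP nij => [i'|] ->; case: unliftP => [j'|] -> nij /=.
- have /sep1 nij' : i' != j' by apply: contraNneq nij => ->.
  apply: contraNneq (nij' tau Ktau) => Eij.
  by rewrite /z1 !rmorphXn /= Eij.
- have [E0|/sep1 ni0] := eqVneq i' ord0.
    rewrite E0; apply/eqP => /fmorph_inj Etau; apply: no_tau.
    by exists tau.
  apply: contraNneq (ni0 tau Ktau) => Eij.
  by rewrite {1}/z1 !rmorphXn /= Eij -!rmorphXn /= nuz.
- have [E0|ni0] := eqVneq j' ord0.
    rewrite E0; apply/eqP => /fmorph_inj Etau; apply: no_tau.
    exists (algC_invaut tau : aut) => [x Kx|] /=.
      by rewrite -{1}(Ktau x Kx) algC_autK.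
    apply: (fmorph_inj tau); rewrite algC_invautK.
    have /(prim_rootP prim_z)[k Dk] : (nu z) ^+ N = 1.
      by rewrite -rmorphXn /= prim_expr_order // rmorph1.
    have /(prim_rootP prim_z)[m Dm] : (tau z) ^+ N = 1.
      by rewrite -rmorphXn /= prim_expr_order // rmorph1.
    by move: Etau; rewrite Dm rmorphXn /= Dk => E'; rewrite rmorphXn /= Dm exprAC.
  have ni0' : ord0 != j' by rewrite eq_sym.
  apply: contraNneq (sep1 _ _ tau ni0' Ktau) => Eij.
  by rewrite -[in X in X == _]nu_tau /z1 !rmorphXn /= Eij.
- by rewrite eqxx in nij.
Qed.

(** * Traces and discriminants *)

(** For an algebraic integer x this is membership in the radical of q, that is, in every prime above
    q. *)
Definition nilmod (q : nat) (x : algC) :=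
  exists2 m, (0 < m)%N & x ^+ m / q%:R \in Aint.

Lemma nilmodM q x y : nilmod q x -> y \in Aint -> nilmod q (x * y).
Proof.
by case=> m m_gt0 Zx Zy; exists m => //; rewrite exprMn mulrAC rpredM ?rpredX.
Qed.

Lemma nilmod_aut q x (nu : aut) : nilmod q x -> nilmod q (nu x).
Proof.
case=> m m_gt0 Zx; exists m => //.
by rewrite -(rmorph_nat nu q) -rmorphXn -fmorph_div /= Aint_aut.
Qed.

Lemma nilmodD q x y :
  x \in Aint -> y \in Aint -> nilmod q x -> nilmod q y -> nilmod q (x + y).
Proof.
move=> Zx Zy [m m_gt0 Zxm] [n n_gt0 Zyn].
exists (m + n)%N; first by rewrite addn_gt0 m_gt0.
rewrite exprDn mulr_suml rpred_sum // => i _; rewrite mulrnAl rpredMn //.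
have [le_ni|lt_in] := leqP n i.
  rewrite -{2}(subnK le_ni) exprD -!mulrA; do 2!rewrite rpredM ?rpredX //.
have le_m : (m <= m + n - i)%N by lia.
rewrite -(subnK le_m) exprD (_ : _ / _ = (x ^+ (m + n - i - m) * y ^+ i) * (x ^+ m / q%:R)).
  by rewrite rpredM // rpredM ?rpredX.
by move: (x ^+ _) (x ^+ m) => u v; ring.
Qed.

Lemma nilmod_sum q (I : finType) (P : pred I) (F : I -> algC) :
    (0 < q)%N -> (forall i, P i -> F i \in Aint /\ nilmod q (F i)) ->
  nilmod q (\sum_(i | P i) F i).
Proof.
move=> q_gt0 NF; suff [] : \sum_(i | P i) F i \in Aint /\ nilmod q (\sum_(i | P i) F i) by [].
apply: (big_ind (fun x => x \in Aint /\ nilmod q x)) => //.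
  by split; [apply: Aint0 | exists 1%N => //; rewrite expr1 mul0r Aint0].
by move=> x y [Zx Nx] [Zy Ny]; split; [rewrite rpredD | apply: nilmodD].
Qed.

Lemma nilmod_int q x : prime q -> x \in Crat -> x \in Aint -> nilmod q x ->
  x / q%:R \in Aint.
Proof.
move=> q_pr Qx Zx [m m_gt0 Zxm].
have nzq : q%:R != 0 :> algC by rewrite pnatr_eq0 -lt0n prime_gt0.
have /intrP[a Da] := Cint_rat_Aint Qx Zx.
have Qxm : x ^+ m / q%:R \in Crat by rewrite rpred_div ?rpredX ?rpred_nat.
have /intrP[b Db] := Cint_rat_Aint Qxm Zxm.
have Eab : a ^+ m = b * q%:Z.
  apply: (intr_inj (R := algC)); rewrite rmorphXn rmorphM /= -Da -Db -pmulrn.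
  by rewrite divfK.
have : (q %| `|a| ^ m)%N.
  by rewrite -abszX Eab abszM absz_nat dvdn_mull.
rewrite Euclid_dvdX // m_gt0 andbT => dv_q.
have /dvdzP[c Dc] : (q %| a)%Z by rewrite /dvdz.
by rewrite Da Dc rmorphM /= -pmulrn mulfK // Aint_int.
Qed.

Lemma Aint_coprime_div q m x :
  coprime q m -> (0 < q)%N -> x \in Aint -> m%:R * x / q%:R \in Aint -> x / q%:R \in Aint.
Proof.
move=> co_qm q_gt0 Zx Zmx.
have nzq : q%:R != 0 :> algC by rewrite pnatr_eq0 -lt0n.
case: (egcdnP m q_gt0) => kq km Ekq _; rewrite (eqP co_qm) in Ekq.
have -> : x / q%:R = kq%:R * x - km%:R * (m%:R * x / q%:R).
  have : kq%:R * q%:R = km%:R * m%:R + 1 :> algC by rewrite -!natrM Ekq natrD.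
  move=> E; apply: (mulIf nzq); rewrite mulrBl divfK // -!mulrA mulVf // mulr1.
  rewrite [x * _]mulrC 2!mulrA E; ring.
by apply: rpredB; apply: rpredM => //; apply: rpred_nat.
Qed.

(** * Partial traces, discriminants and unramified primes *)

Section TraceOverRootOfUnity.
Variables (l : algC) (n : nat) (E : 'I_n -> aut).
Hypotheses (injE : injective (fun i => E i l))
           (surE : forall mu : aut, exists i, E i l = mu l).
Variables (om : algC) (m : nat).
Hypotheses (m_gt0 : (0 < m)%N) (om_m : om ^+ m = 1).

Lemma unity_neq0 : om != 0.
Proof. by apply: contra_eq_neq om_m => ->; rewrite expr0n gtn_eqF // eq_sym oner_eq0. Qed.

(** Orthogonality: the sum over j of (om / E om)^j is m if E fixes om and 0 otherwise. A trace to
    Q(om) is thereby expressed through full traces, which are rational. *)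
Lemma trace_fixing (x : algC) :
  m%:R * \sum_(i | E i om == om) E i x
    = \sum_(j < m) (\sum_i E i (x * om^-1 ^+ j)) * om ^+ j.
Proof.
have nz_om := unity_neq0.
rewrite [RHS](eq_bigr (fun j : 'I_m => \sum_i E i x * (om / E i om) ^+ j)); last first.
  move=> j _; rewrite mulr_suml; apply: eq_bigr => i _.
  by rewrite rmorphM rmorphXn fmorphV /= exprMn mulrAC mulrA.
rewrite exchange_big /= mulr_sumr [RHS](bigID (fun i => E i om == om)) /=.
rewrite [X in _ = _ + X]big1 ?addr0 => [|i nfix].
  apply: eq_bigr => i /eqP fix_om; rewrite fix_om divff //.
  under eq_bigr do rewrite expr1n mulr1.
  by rewrite sumr_const card_ord mulr_natl.
rewrite -mulr_sumr; set u := om / E i om.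
suff -> : \sum_(j < m) u ^+ j = 0 by rewrite mulr0.
have nzu : u - 1 != 0.
  rewrite subr_eq0; apply: contraNneq nfix => u1.
  by rewrite -[om in X in _ == X](divfK (_ : E i om != 0)) ?fmorph_eq0 // -/u u1 mul1r.
apply: (mulfI nzu); rewrite mulr0 -subrX1 /u expr_div_n om_m -rmorphXn /= om_m.
by rewrite rmorph1 divr1 subrr.
Qed.

End TraceOverRootOfUnity.

(** The polynomial vanishing at every t_i except t_(i0) isolates one term: summing its values at the
    t_i against the y_i combines the given power sums with integral coefficients. This replaces
    inverting a Vandermonde matrix. *)
Lemma cramer_power_sums (J : algC -> Prop) (I : finType) (P : pred I)
    (t y : I -> algC) :
    J 0 -> (forall a b, J a -> J b -> J (a + b)) ->
    (forall a b, a \in Aint -> J b -> J (a * b)) ->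
    (forall i, P i -> t i \in Aint) ->
    (forall k, J (\sum_(i | P i) t i ^+ k * y i)) ->
  forall i0, P i0 -> J ((\prod_(i | P i && (i != i0)) (t i0 - t i)) * y i0).
Proof.
move=> J0 JD JM Zt Jw i0 Pi0.
pose h : {poly algC} := \prod_(i | P i && (i != i0)) ('X - (t i)%:P).
have Zh : h \is a polyOver Aint.
  by rewrite rpred_prod // => i /andP[Pi _]; rewrite polyOverXsubC Zt.
have h_val x : h.[x] = \prod_(i | P i && (i != i0)) (x - t i).
  by rewrite horner_prod; apply: eq_bigr => i _; rewrite hornerXsubC.
have -> : (\prod_(i | P i && (i != i0)) (t i0 - t i)) * y i0
    = \sum_(k < size h) h`_k * \sum_(i | P i) t i ^+ k * y i.
  transitivity (\sum_(i | P i) h.[t i] * y i).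
    rewrite [RHS](bigD1 i0) //= h_val [X in _ = _ + X]big1 ?addr0 // => i Pi.
    by rewrite h_val (bigD1 i) //= subrr !mul0r.
  under [RHS]eq_bigr do rewrite mulr_sumr.
  rewrite exchange_big /=; apply: eq_bigr => i _; rewrite horner_coef mulr_suml.
  by apply: eq_bigr => k _; rewrite mulrA.
apply: big_ind => // k _; apply: JM; rewrite ?Jw //.
exact: (polyOverP Zh).
Qed.

(** The product is F'(s i0) for the polynomial F with the chosen conjugates of t as roots. Arbitrary
    sets of conjugates are allowed because only the embeddings that fix a given root of unity enter
    later. *)
Definition disc_multiple (t : algC) (D : nat) :=
  forall (I : finType) (P : pred I) (s : I -> algC) (i0 : I), P i0 ->
    {in P &, injective s} -> (forall i, P i -> exists nu : aut, s i = nu t) ->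
  exists2 Z, Z \in Aint & D%:R = Z * \prod_(i | P i && (i != i0)) (s i0 - s i).

Lemma disc_multiple0 : disc_multiple 0 1.
Proof.
move=> I P s i0 Pi0 inj_s conj_s; exists 1; first exact: Aint1.
rewrite big1 ?mulr1 // => i /andP[Pi]; case/eqP; apply: inj_s => //.
have [nu ->] := conj_s i Pi; have [mu ->] := conj_s i0 Pi0.
by rewrite !rmorph0.
Qed.

(** D is an integral multiple of the product of all differences of distinct conjugates; the cofactor
    collects the differences absent from the given product. *)
Lemma disc_multiple_exists (t : algC) : t \in Aint ->
  exists2 D : nat, (0 < D)%N & disc_multiple t D.
Proof.
move=> Zt; have [n [E [injE surE]]] := embeddings_exist t.
pose d (j i : 'I_n) := E j t - E i t.
pose D0 := \prod_j \prod_(i | i != j) d j i.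
have nzD : D0 != 0.
  apply/prodf_neq0 => j _; apply/prodf_neq0 => i nij.
  by rewrite subr_eq0; apply: contraNneq nij => /injE ->.
have Zd j i : d j i \in Aint by rewrite rpredB ?Aint_aut.
have [D D_gt0 ZD] := Aint_multiple D0^-1.
exists D => // I P s i0 Pi0 inj_s conj_s.
have [g Dg] : exists g : I -> 'I_n, forall i, P i -> E (g i) t = s i.
  have [j0 _] := surE idfun.
  apply: (fin_all_exists (P := fun i j => P i -> E j t = s i)) => i.
  case Pi : (P i); last by exists j0.
  by have [nu ->] := conj_s i Pi; have [j Dj] := surE nu; exists j.
have inj_g : {in P &, injective g}.
  by move=> i j Pi Pj Eij; apply: inj_s; rewrite // -!Dg // Eij.
pose Q j := [exists i, [&& P i, i != i0 & g i == j]].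
have Q_neq j : Q j -> j != g i0.
  case/existsP=> i /and3P[Pi ni /eqP <-]; apply: contraNneq ni => Eg.
  by apply/eqP; apply: inj_g.
have Eprod : \prod_(i | P i && (i != i0)) (s i0 - s i) = \prod_(j | Q j) d (g i0) j.
  pose h := g.
  rewrite [RHS](eq_bigl (fun j => j \in g @: [set i | P i && (i != i0)])); last first.
    move=> j; apply/existsP/imsetP => [[i /and3P[Pi ni /eqP Dj]]|[i]].
      by exists i; rewrite ?inE ?Pi.
    by rewrite inE => /andP[Pi ni] ->; exists i; rewrite Pi ni /=.
  rewrite big_imset /= => [|i j]; last first.
    by rewrite !inE => /andP[Pi _] /andP[Pj _]; apply: inj_g.
  by apply: eq_big => i; rewrite ?inE // => /andP[Pi _]; rewrite /d !Dg.
exists (D%:R / D0 * ((\prod_(j | j != g i0) \prod_(i | i != j) d j i)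
          * \prod_(j | (j != g i0) && ~~ Q j) d (g i0) j)).
  rewrite rpredM // rpredM ?rpred_prod // => j _; rewrite rpred_prod //.
rewrite Eprod -!mulrA.
have -> : (\prod_(j | (j != g i0) && ~~ Q j) d (g i0) j) * \prod_(j | Q j) d (g i0) j
   = \prod_(j | j != g i0) d (g i0) j.
  rewrite [RHS](bigID Q) /= mulrC; congr (_ * _); apply: eq_bigl => j.
  by case Qj : (Q j); rewrite ?andbF // Q_neq.
have -> : (\prod_(j | j != g i0) \prod_(i | i != j) d j i)
    * \prod_(j | j != g i0) d (g i0) j = D0.
  by rewrite /D0 [RHS](bigD1 (g i0)) //= mulrC.
by rewrite mulVf ?mulr1.
Qed.

(** The conclusion expresses that q is unramified in K(z). Full traces of t^k x z^(-j) are rational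
    integers nilpotent modulo q, hence divisible by q. Passing to traces over Q(z) costs a factor N,
    recovering x from them by [cramer_power_sums] costs D, and both are prime to q. *)
Lemma unramified_away (K : divringClosed algC) t D :
    t \in K -> t \in Aint -> {subset K <= adj Crat t} -> disc_multiple t D ->
  forall q N z x, prime q -> (0 < N)%N -> z ^+ N = 1 ->
    ~~ (q %| D * N)%N -> x \in adj K z -> x \in Aint -> nilmod q x ->
  x / q%:R \in Aint.
Proof.
move=> Kt Zt sKt discD q N z x q_pr N_gt0 zN1 nqDN Fx Zx Nx.
have q_gt0 := prime_gt0 q_pr.
have [l Fl sFl] := adj_simple z Kt sKt.
have [n [E [injE surE]]] := embeddings_exist l.
have agree i (mu : aut) : E i l = mu l -> {in adj K z, E i =1 mu}.
  move=> Eil y /sFl; apply: aut_adj => // w Qw.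
  by rewrite !aut_Crat.
have [i0 Di0] := surE idfun.
have E0 y : y \in adj K z -> E i0 y = y by apply: (agree i0 idfun Di0).
have Fz := adj_gen K z; have Ft := adj_base z Kt.
pose P := [pred i | E i z == z].
have Zz : z \in Aint by apply: (Aint_expr N_gt0); rewrite zN1 Aint1.
have ZVz : z^-1 \in Aint by apply: (Aint_expr N_gt0); rewrite exprVn zN1 invr1 Aint1.
pose J y := N%:R * y / q%:R \in Aint.
have Jw k : J (\sum_(i | P i) E i t ^+ k * E i x).
  rewrite /J; under eq_bigr do rewrite -rmorphXn -rmorphM /=.
  rewrite (trace_fixing _ N_gt0 zN1) mulr_suml rpred_sum // => j _.
  rewrite mulrAC rpredM ?rpredX //; set y := _ * _ * _.
  have Fy : y \in adj K z.
    by apply: rpredM; [apply: rpredM => //; apply: rpredX | apply: rpredX; rewrite rpredV].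
  have Zy : y \in Aint by rewrite !rpredM ?rpredX.
  have Ny : nilmod q y.
    by rewrite /y [t ^+ k * x]mulrC; apply: nilmodM; [apply: nilmodM|]; rewrite ?rpredX.
  apply: nilmod_int => //.
  - by apply: (trace_Crat injE surE); apply: sFl.
  - by rewrite rpred_sum // => i _; rewrite Aint_aut.
  - by apply: nilmod_sum => // i _; split; [rewrite Aint_aut | apply: nilmod_aut].
have Pi0 : P i0 by rewrite inE E0.
have := @cramer_power_sums J _ P (fun i => E i t) (fun i => E i x) _ _ _ _ Jw i0 Pi0.
have [||Z ZZ DE] := discD _ P (fun i => E i t) i0 Pi0.
- move=> i j; rewrite !inE => /eqP Ei /eqP Ej Eij; apply: injE => /=.
  apply: (@aut_adj K z) => //; last by rewrite Ei.
  move=> y /sKt; apply: aut_adj => // w Qw.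
  by rewrite !aut_Crat.
- by move=> i _; exists (E i).
rewrite (E0 x) // => Jx.
have : N%:R * (D%:R * x) / q%:R \in Aint.
  rewrite DE; set p := \prod_(i | _) _.
  have -> : N%:R * (Z * p * x) / q%:R = Z * (N%:R * (p * x) / q%:R) by ring.
  apply: rpredM => //; apply: Jx.
  - by rewrite /J mulr0 mul0r Aint0.
  - by move=> a b Ja Jb; rewrite /J mulrDr mulrDl rpredD.
  - move=> a b Za Jb; rewrite /J (_ : _ * (a * b) / _ = a * (N%:R * b / q%:R)); first by rewrite rpredM.
    by ring.
  - by move=> i _; rewrite Aint_aut.
rewrite mulrA -natrM mulnC; apply: Aint_coprime_div => //.
by rewrite prime_coprime.
Qed.

Lemma expand_below (F : divringClosed algC) z n (c : nat -> algC) x : (0 < n)%N ->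
    (forall j, c j \in F) -> z ^+ n = \sum_(j < n) c j * z ^+ j -> x \in adj F z ->
  exists p : {poly algC}, [/\ p \is a polyOver F, (size p <= n)%N & x = p.[z]].
Proof.
case: n => // n _ Fc zn /adjP[p Fp ->]; elim/poly_ind: p Fp => [|p b IHp] Fp.
  by exists 0; rewrite rpred0 size_poly0.
have Fb : b \in F.
  by have /polyOverP/(_ 0%N) := Fp; rewrite coefD coefMX coefC add0r.
have {}Fp : p \is a polyOver F.
  apply/polyOverP=> i; have /polyOverP/(_ i.+1) := Fp.
  by rewrite coefD coefMX coefC /= addr0.
have [r [Fr sz_r Dp]] := IHp Fp; rewrite hornerMXaddC Dp.
pose s : {poly algC} := \poly_(j < n.+1) ((if j is j'.+1 then r`_j' else b) + r`_n * c j).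
exists s; split; last 1 first.
- rewrite (horner_coef_wide _ sz_r) big_ord_recr /= mulrDl -mulrA -exprSr zn.
  rewrite (horner_coef_wide _ (size_poly _ _)) /s.
  under [RHS]eq_bigr => j _ do rewrite coef_poly ltn_ord mulrDl.
  rewrite big_split /= [X in _ = X + _]big_ord_recl /= expr0 mulr1.
  rewrite mulr_suml mulr_sumr.
  have -> : \sum_(i < n) r`_i * z ^+ i * z = \sum_(i < n) r`_i * z ^+ bump 0 i.
    by apply: eq_bigr => i _; rewrite -mulrA -exprSr.
  have -> : \sum_(i < n.+1) r`_n * (c i * z ^+ i) = \sum_(i < n.+1) r`_n * c i * z ^+ i.
    by apply: eq_bigr => i _; rewrite mulrA.
  by rewrite [LHS]addrC addrA.
- apply/polyOverP=> i; rewrite coef_poly; case: ifP => _; last exact: rpred0.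
  apply: rpredD; last by apply: rpredM => //; apply: (polyOverP Fr).
  by case: i => // i; apply: (polyOverP Fr).
exact: size_poly.
Qed.

(** * Expansions in a uniformiser over a field unramified at q *)

Section RamifiedExpansion.
Variables (q : nat) (F : divringClosed algC) (pi : algC) (n : nat).
Hypotheses (q_pr : prime q)
  (unramF : forall x, x \in F -> x \in Aint -> nilmod q x -> x / q%:R \in Aint)
  (Zpi : pi \in Aint) (nz_pi : pi != 0) (n_gt0 : (0 < n)%N)
  (pi_q : pi ^+ n / q%:R \in Aint) (q_pi : q%:R / pi ^+ n \in Aint).

Let nzq : q%:R != 0 :> algC.
Proof. by rewrite pnatr_eq0 -lt0n prime_gt0. Qed.

Lemma nilmod_pi x : x / pi \in Aint -> nilmod q x.
Proof.
move=> Zx; exists n => //.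
by rewrite -[x](divfK nz_pi) exprMn -mulrA rpredM ?rpredX.
Qed.

(** Eisenstein's argument, from the lowest coefficient up: once the coefficients below i are
    divisible by q, division by pi^i shows that pi divides Z_i, as i < n. So Z_i is nilpotent modulo
    q and, lying in F, divisible by q. *)
Lemma coef_dvd_of_horner (Z : {poly algC}) :
    Z \is a polyOver F -> Z \is a polyOver Aint -> (size Z <= n)%N ->
    Z.[pi] / q%:R \in Aint ->
  forall i, Z`_i / q%:R \in Aint.
Proof.
move=> FZ ZZ sz_Z ZZpi i; elim/ltn_ind: i => i IHi.
have [le_ni|lt_in] := leqP n i.
  by rewrite nth_default ?mul0r ?Aint0 // (leq_trans sz_Z).
set W := drop_poly i.+1 Z.
have ZW : W.[pi] \in Aint.
  apply: rpred_horner => //; apply/polyOverP=> j.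
  by rewrite coef_drop_poly; apply: (polyOverP ZZ).
have EZ : Z.[pi] = (\sum_(l < i) Z`_l * pi ^+ l) + pi ^+ i * (Z`_i + pi * W.[pi]).
  have -> : Z = take_poly i.+1 Z + W * 'X^(i.+1) by rewrite poly_take_drop.
  rewrite !hornerE (horner_coef_wide _ (size_take_poly _ _)) big_ord_recr /=.
  rewrite poly_take_drop !coef_take_poly ltnSn.
  under eq_bigr => l _ do rewrite coef_take_poly (ltn_trans (ltn_ord l)) //.
  by rewrite exprS; ring.
have Z1 : pi ^+ i * (Z`_i + pi * W.[pi]) / q%:R \in Aint.
  have -> : pi ^+ i * (Z`_i + pi * W.[pi]) = Z.[pi] - \sum_(l < i) Z`_l * pi ^+ l.
    by rewrite EZ addrAC subrr add0r.
  rewrite mulrBl rpredB // mulr_suml rpred_sum // => l _.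
  by rewrite mulrAC rpredM ?rpredX // IHi.
have Z2 : (Z`_i + pi * W.[pi]) / pi \in Aint.
  have -> : (Z`_i + pi * W.[pi]) / pi
     = pi ^+ (n - i.+1) * ((pi ^+ i * (Z`_i + pi * W.[pi]) / q%:R) * (q%:R / pi ^+ n)).
    have -> : pi ^+ n = pi ^+ (n - i.+1) * (pi ^+ i * pi).
      by rewrite -exprSr -exprD subnK.
    have := expf_neq0 i nz_pi; have := expf_neq0 (n - i.+1)%N nz_pi.
    move: (pi ^+ (n - _)) (pi ^+ i) => A B nzA nzB; field.
    by rewrite nz_pi nzq nzA nzB.
  by rewrite rpredM ?rpredX // rpredM.
apply: unramF; [exact: (polyOverP FZ) | exact: (polyOverP ZZ) | apply: nilmod_pi].
have -> : Z`_i / pi = (Z`_i + pi * W.[pi]) / pi - W.[pi].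
  by field.
by rewrite rpredB.
Qed.

(** The integers of F together with pi generate all integers of F(pi) locally at q: factors q are
    removed one at a time from a common denominator of the coefficients. *)
Lemma coef_integral_away (p : {poly algC}) :
    p \is a polyOver F -> (size p <= n)%N -> p.[pi] \in Aint ->
  exists2 S : nat, ~~ (q %| S)%N & forall i, S%:R * p`_i \in Aint.
Proof.
move=> Fp sz_p Zp.
have [S0 S0_gt0 ZS0] : exists2 S : nat, (0 < S)%N & forall i, S%:R * p`_i \in Aint.
  have H m : exists2 S : nat, (0 < S)%N & forall i, (i < m)%N -> S%:R * p`_i \in Aint.
    elim: m => [|m [S S_gt0 ZS]]; first by exists 1%N.
    have [T T_gt0 ZT] := Aint_multiple p`_m.
    exists (S * T)%N => [|i]; first by rewrite muln_gt0 S_gt0.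
    rewrite ltnS leq_eqVlt => /orP[/eqP->|/ZS ZSi]; rewrite natrM.
      by rewrite -mulrA rpredM ?rpred_nat.
    by rewrite mulrAC rpredM ?rpred_nat.
  have [S S_gt0 ZS] := H (size p); exists S => // i.
  by have [/ZS //|le_i] := ltnP i (size p); rewrite nth_default ?mulr0 ?Aint0.
have [S coS DS] := pfactor_coprime q_pr S0_gt0.
exists S; first by rewrite -prime_coprime.
rewrite {}DS in ZS0; elim: (logn q S0) ZS0 => [|r IHr] ZS0.
  by move=> i; have := ZS0 i; rewrite expn0 muln1.
apply: IHr => i; pose Z := (S * q ^ r.+1)%:R *: p.
have -> : (S * q ^ r)%:R * p`_i = Z`_i / q%:R.
  rewrite coefZ expnSr mulnA; move: (S * q ^ r)%N => T.
  by rewrite natrM; field; rewrite nzq.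
apply: coef_dvd_of_horner => //.
- by apply: polyOverZ => //; apply: rpred_nat.
- by apply/polyOverP=> j; rewrite coefZ.
- exact: leq_trans (size_scale_leq _ _) sz_p.
rewrite hornerZ expnSr mulnA; move: (S * q ^ r)%N => T.
rewrite (_ : _ / _ = T%:R * p.[pi]); first by rewrite rpredM // rpred_nat.
by rewrite natrM; field; rewrite nzq.
Qed.

End RamifiedExpansion.

Lemma unity_ratio_Aint (z : algC) j : z \in Aint -> (1 - z ^+ j) / (1 - z) \in Aint.
Proof.
move=> Zz; have [->|nz1] := eqVneq z 1; first by rewrite subrr invr0 mulr0 Aint0.
have -> : (1 - z ^+ j) / (1 - z) = \sum_(i < j) z ^+ i.
  have nz : 1 - z != 0 by rewrite subr_eq0 eq_sym.
  apply: (mulIf nz); rewrite divfK // -opprB subrX1 -mulNr opprB mulrC //.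
by rewrite rpred_sum // => i _; rewrite rpredX.
Qed.

Lemma unity_ratio_inv_Aint N (z : algC) j : N.-primitive_root z -> coprime j N ->
  (1 - z) / (1 - z ^+ j) \in Aint.
Proof.
move=> prim_z co_j; have prim_zj : N.-primitive_root (z ^+ j).
  by rewrite prim_root_exp_coprime.
have /(prim_rootP prim_zj)[i {1}->] := prim_expr_order prim_z.
by apply: unity_ratio_Aint; apply: Aint_prim_root prim_zj.
Qed.

Lemma prim_root_neq1 N (z : algC) : N.-primitive_root z -> (1 < N)%N -> z != 1.
Proof.
move=> prim_z N_gt1; have := prim_order_dvd prim_z 1; rewrite expr1 => <-.
by rewrite dvdn1 gtn_eqF.
Qed.

Lemma sum_prim_root q (z : algC) : (1 < q)%N -> q.-primitive_root z ->
  \sum_(i < q) z ^+ i = 0.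
Proof.
move=> q_gt1 prim_z; have nz : z - 1 != 0 by rewrite subr_eq0 (prim_root_neq1 prim_z).
by apply: (mulfI nz); rewrite mulr0 -subrX1 (prim_expr_order prim_z) subrr.
Qed.

Lemma prod_one_sub_prim_root q (z : algC) : q.-primitive_root z ->
  \prod_(1 <= j < q) (1 - z ^+ j) = q%:R.
Proof.
move=> prim_z; have q_gt0 := prim_order_gt0 prim_z.
have := factor_Xn_sub_1 prim_z; rewrite big_ltn // expr0 subrX1 => E.
have nzX : 'X - (1 : algC)%:P != 0 by rewrite polyXsubC_eq0.
have /(congr1 (fun p => p.[1])) := mulfI nzX E.
rewrite horner_prod horner_sum.
under eq_bigr do rewrite hornerXsubC.
by move=> ->; under eq_bigr do rewrite hornerXn expr1n; rewrite sumr_const card_ord.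
Qed.

(** The factors 1 - z^j with 0 < j < q are associate to 1 - z and their product is q. *)
Lemma prim_root_prime_ramified q (z : algC) : prime q -> q.-primitive_root z ->
  (1 - z) ^+ q.-1 / q%:R \in Aint /\ q%:R / (1 - z) ^+ q.-1 \in Aint.
Proof.
move=> q_pr prim_z; rewrite -(prod_one_sub_prim_root prim_z).
have -> : (1 - z) ^+ q.-1 = \prod_(1 <= j < q) (1 - z).
  by rewrite prodr_const_nat subn1.
have Zz := Aint_prim_root prim_z.
split; rewrite -prodf_div big_seq rpred_prod // => j; rewrite mem_index_iota => /andP[j_gt0 lt_j].
  apply: (unity_ratio_inv_Aint prim_z); rewrite coprime_sym prime_coprime //.
  by apply: contraL lt_j => /dvdn_leq; rewrite -leqNgt; apply.
exact: unity_ratio_Aint.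
Qed.

(** In 1 - z^2 = (1 - z) (1 + z) both factors are associate, because 1 + z is 1 minus an odd power
    of z. *)
Lemma prim_root_two_ramified m (z : algC) : (2 ^ m.+1).-primitive_root z ->
  (1 - z) ^+ (2 ^ m) / 2 \in Aint /\ 2 / (1 - z) ^+ (2 ^ m) \in Aint.
Proof.
elim: m z => [|m IHm] z prim_z.
  have -> : z = -1.
    have /eqP := prim_expr_order prim_z; rewrite expn1 sqrf_eq1.
    by rewrite (negPf (prim_root_neq1 prim_z _)) //= => /eqP.
  by rewrite expn0 expr1 opprK -[1 + 1]/2 divff ?pnatr_eq0 ?Aint1.
have [|A B] := IHm (z ^+ 2).
  have := dvdn_prim_root prim_z (_ : 2 ^ m.+1 %| 2 ^ m.+2)%N.
  by rewrite [X in (X %/ _)%N]expnS mulnK ?expn_gt0 //; apply; rewrite dvdn_exp2l.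
have Zz := Aint_prim_root prim_z.
have zm : z ^+ (2 ^ m.+1) = -1.
  have /eqP := prim_expr_order prim_z; rewrite expnSr exprM sqrf_eq1.
  by rewrite -(prim_order_dvd prim_z) dvdn_Pexp2l // ltnn => /eqP.
have nz1 : 1 - z != 0.
  by rewrite subr_eq0 eq_sym (prim_root_neq1 prim_z) // -{1}(expn0 2) ltn_exp2l.
have E1 : 1 + z = 1 - z ^+ (2 ^ m.+1).+1 by rewrite exprS zm mulrN1 opprK.
have co : coprime (2 ^ m.+1).+1 (2 ^ m.+2).
  by rewrite coprime_sym coprimeXl // coprime2n /= oddX.
have nz2 : 1 + z != 0.
  rewrite E1 subr_eq0 eq_sym; have prim2 : (2 ^ m.+2).-primitive_root (z ^+ (2 ^ m.+1).+1).
    by rewrite prim_root_exp_coprime.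
  by rewrite (prim_root_neq1 prim2) // -{1}(expn0 2) ltn_exp2l.
have r1 : (1 - z) / (1 + z) \in Aint by rewrite E1; apply: (unity_ratio_inv_Aint prim_z).
have r2 : (1 + z) / (1 - z) \in Aint by rewrite E1; apply: unity_ratio_Aint.
have E2 : 1 - z ^+ 2 = (1 - z) * (1 + z) by ring.
rewrite expnS exprM; split.
  have -> : ((1 - z) ^+ 2) ^+ (2 ^ m) / 2
      = ((1 - z) / (1 + z)) ^+ (2 ^ m) * ((1 - z ^+ 2) ^+ (2 ^ m) / 2).
    by rewrite mulrA -exprMn E2; congr (_ ^+ _ / _); field.
  by rewrite rpredM ?rpredX.
have -> : 2 / ((1 - z) ^+ 2) ^+ (2 ^ m)
    = ((1 + z) / (1 - z)) ^+ (2 ^ m) * (2 / (1 - z ^+ 2) ^+ (2 ^ m)).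
  rewrite E2 mulrCA -!exprVn -exprMn; congr (_ * _ ^+ _); field.
  by rewrite nz1 nz2.
by rewrite rpredM ?rpredX.
Qed.

(** * Backward orbits of bounded height *)

Definition bpath (a c : algC) (g : nat -> algC) (n : nat) :=
  forall i, (i < n)%N -> g i.+1 != 0 /\ phi a c (g i.+1) = g i.

Definition bounded_house (R : nat) (x : algC) := forall nu : aut, `|nu x| <= R%:R.

(** If |w| <= |u|, then |w|^2 <= |u w| and |u|^2 <= |u^2 + w^2| + |w|^2 <= 2 k R, which is at most
    R^2: the bound R reproduces itself along a path. *)
Lemma sq_sum_bound (R k : nat) (u w : algC) :
    (2 * k <= R)%N -> `|u * w| <= k%:R * R%:R -> `|u ^+ 2 + w ^+ 2| <= k%:R * R%:R ->
  `|u| <= R%:R.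
Proof.
move=> le_kR; wlog: u w / `|w| <= `|u| => [IH|le_wu].
  have [le_wu|lt_uw] := real_leP (normr_real w) (normr_real u); first exact: IH.
  rewrite mulrC addrC => H1 H2; apply: le_trans (ltW lt_uw) _.
  by apply: (IH w u) => //; apply: ltW.
rewrite normrM => le_p le_s.
have le_u2 : `|u| ^+ 2 <= R%:R ^+ 2.
  have -> : `|u| ^+ 2 = `|(u ^+ 2 + w ^+ 2) - w ^+ 2| by rewrite addrK normrX.
  apply: le_trans (ler_normB _ _) _; rewrite normrX.
  have le_w2 : `|w| ^+ 2 <= k%:R * R%:R.
    by apply: le_trans le_p; rewrite expr2 ler_wpM2r.
  apply: le_trans (lerD le_s le_w2) _; rewrite -mulr2n -[_ *+ 2]mulr_natl mulrA -natrM expr2.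
  by rewrite ler_wpM2r ?ler0n // ler_nat.
by rewrite -(@ler_pXn2r _ 2) // nnegrE ?normr_ge0 ?ler0n.
Qed.

Section HeightBound.
Variables (a c alpha : algC).
Hypothesis nza : a != 0.

Lemma common_denominator : exists2 B : nat, (0 < B)%N & B%:R * a \in Aint /\ B%:R * c \in Aint.
Proof.
have [m m_gt0 Zm] := Aint_multiple a; have [n n_gt0 Zn] := Aint_multiple c.
exists (m * n)%N; first by rewrite muln_gt0 m_gt0.
split; rewrite natrM; last by rewrite -mulrA rpredM ?rpred_nat.
by rewrite mulrAC rpredM ?rpred_nat.
Qed.

(* The backward orbit lifts to pairs of algebraic integers of bounded house:
   the pair [(u, w)] above [(u0, w0)] solves [u w = A B w0] and
   [u^2 + w^2 = B^2 u0 - B C w0], where [a = A / B] and [c = C / B]. *)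
Lemma bounded_lift : exists R : nat, forall n g, g 0%N = alpha -> bpath a c g n ->
  exists u w, [/\ u \in Aint, w \in Aint, w != 0, g n = u / w
                & bounded_house R u /\ bounded_house R w].
Proof.
have [B B_gt0 [ZA ZC]] := common_denominator.
have [A DA] : exists A, A = B%:R * a by exists (B%:R * a).
have [C DC] : exists C, C = B%:R * c by exists (B%:R * c).
rewrite -DA -DC in ZA ZC.
have nzB : B%:R != 0 :> algC by rewrite pnatr_eq0 -lt0n.
have nzA : A != 0 by rewrite DA mulf_neq0.
have ZB : B%:R \in Aint by rewrite rpred_nat.
have [k1 Hk1] := house_bound (A * B%:R).
have [k2 Hk2] := house_bound (B%:R ^+ 2).
have [k3 Hk3] := house_bound (B%:R * C).
have [m m_gt0 Zm] := Aint_multiple alpha.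
have [r0 Hr0] := house_bound (m%:R * alpha).
(* The terms r0 and m bound the initial pair (m alpha, m); the term 2 k is what [sq_sum_bound]
   needs. *)
pose k := (k1 + (k2 + k3))%N; pose R := (r0 + m + 2 * k)%N.
exists R => n g g0; elim: n => [|n IHn] path_g.
  exists (m%:R * alpha), m%:R; split=> //; first exact: rpred_nat.
  - by rewrite pnatr_eq0 -lt0n.
  - by rewrite g0 mulrC mulKf // pnatr_eq0 -lt0n.
  split=> nu; first by apply: le_trans (Hr0 nu) _; rewrite ler_nat /R -addnA leq_addr.
  by rewrite rmorph_nat ger0_norm ?ler0n // ler_nat /R addnAC leq_addl.
have [i lt_i|u0 [w0 [Zu0 Zw0 nzw0 Dg [Hu0 Hw0]]]] := IHn; first exact/path_g/leqW.
have [nzg Eg] := path_g n (ltnSn n).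
set x := g n.+1 in nzg Eg *.
(* This choice of w^2 is forced by u = x w and u w = A B w0; the equation phi(x) = u0 / w0 then
   determines u^2 + w^2. *)
pose w := sqrtC (A * B%:R * w0 / x); pose u := x * w.
have Ew2 : w ^+ 2 = A * B%:R * w0 / x by rewrite sqrtCK.
have Euw : u * w = A * B%:R * w0.
  by rewrite /u -mulrA -expr2 Ew2 mulrC divfK.
have Es : u ^+ 2 + w ^+ 2 = B%:R ^+ 2 * u0 - B%:R * C * w0.
  rewrite /u exprMn -{2}[w ^+ 2]mul1r -mulrDl Ew2.
  have -> : (x ^+ 2 + 1) * (A * B%:R * w0 / x) = B%:R ^+ 2 * w0 * (phi a c x - c).
    by rewrite /phi DA; field.
  by rewrite Eg Dg DC; field.
have nzw : w != 0.
  by rewrite -sqrf_eq0 Ew2 !mulf_neq0 ?invr_eq0.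
have Zuw : u * w \in Aint by rewrite Euw !rpredM.
have Zs : u ^+ 2 + w ^+ 2 \in Aint.
  by rewrite Es rpredB ?rpredM ?rpredX.
have Zroot y y' : y + y' \in Aint -> y * y' \in Aint -> y \in Aint.
  move=> Zs' Zp'; apply: (@Aint_root_monic ('X^2 + (- (y + y') *: 'X + (y * y')%:P))).
  - rewrite monicE lead_coefDl ?lead_coefXn // size_polyXn.
    apply: leq_ltn_trans (size_polyD _ _) _; rewrite gtn_max.
    rewrite (leq_ltn_trans (size_scale_leq _ _)) ?size_polyX //.
    by rewrite (leq_ltn_trans (size_polyC_leq1 _)).
  - by rewrite !rpredD ?polyOverXn ?polyOverZ ?polyOverX ?polyOverC // rpredN.
  by rewrite rootE !(hornerD, hornerZ, hornerXn, hornerX, hornerC); apply/eqP; ring.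
exists u, w; split=> //.
- apply: (@Aint_expr _ 2) => //; apply: (Zroot _ (w ^+ 2)) => //.
  by rewrite -exprMn rpredX.
- apply: (@Aint_expr _ 2) => //; apply: (Zroot _ (u ^+ 2)); first by rewrite addrC.
  by rewrite -exprMn mulrC rpredX.
- by rewrite /u mulfK.
have le_kR : (2 * k <= R)%N by rewrite leq_addl.
have le_p (nu : aut) : `|nu u * nu w| <= k%:R * R%:R.
  rewrite -rmorphM /= Euw rmorphM normrM /= ler_pM ?normr_ge0 //.
  by apply: le_trans (Hk1 nu) _; rewrite ler_nat leq_addr.
have le_s (nu : aut) : `|nu u ^+ 2 + nu w ^+ 2| <= k%:R * R%:R.
  have -> : nu u ^+ 2 + nu w ^+ 2 = nu (B%:R ^+ 2) * nu u0 - nu (B%:R * C) * nu w0.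
    by rewrite -!rmorphM -rmorphB -Es rmorphD !rmorphXn.
  apply: le_trans (ler_normB _ _) _; rewrite !normrM.
  apply: (@le_trans _ _ ((k2 + k3)%:R * R%:R)); last first.
    by apply: ler_wpM2r; rewrite ?ler0n // ler_nat leq_addl.
  by rewrite natrD mulrDl lerD //; apply: ler_pM; rewrite ?normr_ge0.
split=> nu.
  exact: (sq_sum_bound le_kR (le_p nu) (le_s nu)).
by apply: (@sq_sum_bound _ k _ (nu u)) => //; [rewrite mulrC | rewrite addrC].
Qed.

End HeightBound.

(** * Reduction to 2-power conductor *)

(** For f dividing N, every automorphism of the N-th roots of unity that is trivial on the f-th ones
    is induced by an automorphism over K. *)
Definition cyclo_indep (K : {pred algC}) (f : nat) :=
  forall N z (nu : aut), N.-primitive_root z -> (f %| N)%N ->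
    nu (z ^+ (N %/ f)) = z ^+ (N %/ f) ->
  exists2 tau : aut, {in K, tau =1 id} & tau z = nu z.

Lemma cyclo_indep_dvd (K : {pred algC}) f f' :
  (f %| f')%N -> (0 < f')%N -> cyclo_indep K f -> cyclo_indep K f'.
Proof.
move=> dv_ff f'_gt0 ind N z nu prim_z dv_N fix_z; apply: (ind N) => //.
  exact: dvdn_trans dv_ff dv_N.
have -> : (N %/ f = N %/ f' * (f' %/ f))%N.
  apply/eqP; rewrite -(eqn_pmul2r (dvdn_gt0 f'_gt0 dv_ff)) -mulnA !divnK //.
  exact: dvdn_trans dv_ff dv_N.
by rewrite exprM rmorphXn /= fix_z.
Qed.

Lemma cyclo_aut (K : {pred algC}) f N z j : cyclo_indep K f ->
    N.-primitive_root z -> (f %| N)%N -> coprime j N -> j = 1 %[mod f] ->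
  exists2 tau : aut, {in K, tau =1 id} & tau z = z ^+ j.
Proof.
move=> ind prim_z dv_f co_j j1; have [nu Dnu] := Qn_aut_exists co_j.
have Enu : nu z = z ^+ j by rewrite Dnu // prim_expr_order.
rewrite -Enu; apply: (ind N) => //.
rewrite rmorphXn /= Enu -exprM mulnC exprM; apply/eqP.
rewrite -[X in _ == X]expr1 (eq_prim_root_expr (dvdn_prim_root prim_z dv_f)).
exact/eqP.
Qed.

Fixpoint autX (tau : aut) (n : nat) : aut :=
  if n is n'.+1 then (tau \o autX tau n' : aut) else idfun.

Lemma autXS tau n x : autX tau n.+1 x = tau (autX tau n x). Proof. by []. Qed.

Lemma autXD tau m n x : autX tau (m + n) x = autX tau m (autX tau n x).
Proof. by elim: m => //= m ->. Qed.

Lemma autXM tau m n x : autX tau (m * n) x = autX (autX tau n) m x.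
Proof. by elim: m => // m IHm; rewrite mulSn autXD IHm. Qed.

Lemma autX_fix (tau : aut) n x : tau x = x -> autX tau n x = x.
Proof. by move=> fix_x; elim: n => //= n ->. Qed.

Lemma autX_expr (tau : aut) n (z : algC) j : tau z = z ^+ j -> autX tau n z = z ^+ (j ^ n).
Proof.
by move=> Dz; elim: n => //= n ->; rewrite rmorphXn /= Dz -exprM expnS.
Qed.

Lemma phi_fiber (a c x y : algC) : a != 0 -> x != 0 -> y != 0 ->
  phi a c x = phi a c y -> x = y \/ x = y^-1.
Proof.
move=> nza nzx nzy Exy.
have : a * (x - y) * (x - y^-1) = 0.
  have : (phi a c x - phi a c y) * x = 0 by rewrite Exy subrr mul0r.
  by move=> E; rewrite -[RHS]E /phi; field; rewrite ?nzx ?nzy.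
move/eqP; rewrite !mulf_eq0 (negPf nza) /= !subr_eq0.
by case/orP=> /eqP; [left | right].
Qed.

Section Paths.
Variables (K : divringClosed algC) (a c : algC).
Hypotheses (Ka : a \in K) (Kc : c \in K) (nza : a != 0).

Lemma phi_aut (nu : aut) x : {in K, nu =1 id} -> nu (phi a c x) = phi a c (nu x).
Proof. by move=> nuK; rewrite /phi !rmorphD rmorphM fmorph_div /= (nuK a) // (nuK c). Qed.

Lemma bpath_aut_step (nu : aut) g n i : {in K, nu =1 id} -> bpath a c g n ->
  (i < n)%N -> nu (g i) = g i -> nu (g i.+1) = g i.+1 \/ nu (g i.+1) = (g i.+1)^-1.
Proof.
move=> nuK path_g lt_i fix_i; have [nz Eg] := path_g i lt_i.
apply: (phi_fiber (c := c) nza) => //; first by rewrite fmorph_eq0.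
by rewrite -phi_aut // Eg fix_i.
Qed.

Lemma bpath_in (F : divringClosed algC) g n : {subset K <= F} -> bpath a c g n ->
  g n \in F -> forall i, (i <= n)%N -> g i \in F.
Proof.
clear nza; move=> sKF path_g Fn i le_i; rewrite -(subKn le_i).
elim: (n - i)%N => [|j IHj]; first by rewrite subn0.
have [le_nj|lt_jn] := leqP n j.
  by rewrite (_ : n - j.+1 = n - j)%N //; lia.
have [nz <-] := path_g (n - j.+1)%N ltac:(lia).
have Fg : g (n - j.+1).+1 \in F by rewrite (_ : (n - j.+1).+1 = n - j)%N //; lia.
have [Fa Fc] := (sKF a Ka, sKF c Kc).
by rewrite /phi; apply: rpredD => //; apply: rpredD; apply: rpredM; rewrite ?rpredV.
Qed.

(** At the first moved point tau would act by inversion, whose odd powers are nontrivial on that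
    point. *)
Lemma bpath_odd_aut (tau : aut) q g n : odd q -> {in K, tau =1 id} -> bpath a c g n ->
    g 0%N \in K -> (forall i, (i <= n)%N -> autX tau q (g i) = g i) ->
  forall i, (i <= n)%N -> tau (g i) = g i.
Proof.
move=> odd_q tauK path_g Kg0 fix_q; elim=> [|i IHi] lt_i; first exact: tauK.
have [//|Einv] := bpath_aut_step tauK path_g lt_i (IHi (ltnW lt_i)).
have Eiter m : autX tau m (g i.+1) = if odd m then (g i.+1)^-1 else g i.+1.
  elim: m => //= m ->; case: (odd m) => //=.
  by rewrite fmorphV /= Einv invrK.
by rewrite Einv -[RHS](fix_q _ lt_i) Eiter odd_q.
Qed.

(** As q divides N, the map z -> z^(N + 1) has order q and fixes z^q. Being of odd order it fixes
    the path, and averaging the expansion of the end point over its powers leaves only the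
    coefficient in K(z^q). *)
Lemma wild_odd_step f q N z g n : cyclo_indep K f -> prime q -> odd q ->
    (q * N).-primitive_root z -> (q %| N)%N -> (f %| N)%N -> (0 < N)%N ->
    bpath a c g n -> g 0%N \in K -> g n \in adj K z ->
  g n \in adj K (z ^+ q).
Proof.
move=> ind q_pr odd_q prim_z dv_q dv_f N_gt0 path_g Kg0 Fn.
have q_gt0 := prime_gt0 q_pr; have q_gt1 := prime_gt1 q_pr.
have zNN : z ^+ (N * N) = 1.
  by apply/eqP; rewrite -(prim_order_dvd prim_z) dvdn_mul.
have [||tau tauK tauz] := cyclo_aut (j := N.+1) ind prim_z (dvdn_mull _ dv_f).
- rewrite coprime_sym coprimeMl coprimenS andbT.
  by apply: coprime_dvdl dv_q _; apply: coprimenS.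
- by rewrite -addn1 -modnDml (eqP dv_f).
have tau_z m : autX tau m z = z ^+ (m * N).+1.
  elim: m => // m IHm; rewrite autXS IHm rmorphXn /= tauz -exprM.
  have -> : (N.+1 * (m * N).+1 = (m.+1 * N).+1 + N * N * m)%N by ring.
  by rewrite exprD exprM zNN expr1n mulr1.
have autK m : {in K, autX tau m =1 id} by move=> x Kx; apply: autX_fix; apply: tauK.
have tau_q : {in adj K z, autX tau q =1 id}.
  apply: aut_adj_id => //; rewrite tau_z exprS.
  by rewrite (prim_expr_order prim_z) mulr1.
have fix_g : forall i, (i <= n)%N -> tau (g i) = g i.
  apply: (@bpath_odd_aut tau q) => // i le_i; apply: tau_q.
  by apply: (bpath_in _ path_g Fn le_i) => x; apply: adj_base.
have [k Fk Dg] := adj_expand q_gt0 Fn.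
have tauF : {in adj K (z ^+ q), tau =1 id}.
  apply: aut_adj_id => //; rewrite rmorphXn /= tauz -exprM mulSn exprD.
  by rewrite [(N * q)%N]mulnC (prim_expr_order prim_z) mulr1.
pose om := z ^+ N.
have prim_om : q.-primitive_root om.
  have := dvdn_prim_root prim_z (dvdn_mulr N (dvdnn q)).
  by rewrite mulKn.
have sum_g m : g n = \sum_(j < q) k j * z ^+ j * (om ^+ j) ^+ m.
  rewrite -[LHS](autX_fix m (fix_g n (leqnn n))) {1}Dg rmorph_sum /=.
  apply: eq_bigr => j _; rewrite rmorphM rmorphXn /= tau_z.
  rewrite (autX_fix m (tauF _ (Fk j))) -mulrA; congr (_ * _).
  by rewrite /om -!exprM -exprD; congr (z ^+ _); ring.
have : \sum_(m < q) g n = q%:R * k 0%N.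
  under eq_bigr => m _ do rewrite (sum_g m).
  rewrite exchange_big /= (bigD1 (Ordinal q_gt0)) //= [X in _ + X]big1 ?addr0.
    under eq_bigr do rewrite !expr0 expr1n !mulr1.
    by rewrite sumr_const card_ord mulr_natl.
  move=> j nj; rewrite -mulr_sumr sum_prim_root ?mulr0 //.
  rewrite prim_root_exp_coprime // coprime_sym prime_coprime //.
  by apply: contraNN nj => /dvdn_leq H; rewrite -val_eqE /= -leqn0 leqNgt;
    apply/negP=> j_gt0; have := H j_gt0; rewrite leqNgt ltn_ord.
have nzq : q%:R != 0 :> algC by rewrite pnatr_eq0 -lt0n.
by rewrite sumr_const card_ord -[g n *+ q]mulr_natl => /(mulfI nzq) ->; apply: Fk.
Qed.

End Paths.

Lemma tame_automorphisms (K : divringClosed algC) f q N z : cyclo_indep K f -> prime q ->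
    (q * N).-primitive_root z -> ~~ (q %| N)%N -> (f %| N)%N -> (0 < N)%N ->
  forall r, (0 < r < q)%N -> exists2 tau : aut,
    {in adj K (z ^+ q), tau =1 id} & tau (z ^+ N) = (z ^+ N) ^+ r.
Proof.
move=> ind q_pr prim_z ndv_q dv_f N_gt0 r /andP[r_gt0 lt_r].
have co_Nq : coprime N q by rewrite coprime_sym prime_coprime.
have co_rq : coprime r q.
  rewrite coprime_sym prime_coprime //; apply/negP => /dvdn_leq.
  by rewrite r_gt0 leqNgt lt_r => /(_ isT).
pose j := chinese N q 1 r.
have j1 : j = 1 %[mod N] by apply: chinese_modl.
have jr : j = r %[mod q] by apply: chinese_modr.
have co_j : coprime j (q * N).
  rewrite coprimeMr -(coprime_modl j) jr coprime_modl co_rq /=.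
  by rewrite -(coprime_modl j) j1 coprime_modl coprime1n.
have prim_zN : q.-primitive_root (z ^+ N).
  have := dvdn_prim_root prim_z (dvdn_mulr N (dvdnn q)).
  by rewrite mulKn // prime_gt0.
have prim_zq : N.-primitive_root (z ^+ q).
  have := dvdn_prim_root prim_z (dvdn_mull q (dvdnn N)).
  by rewrite mulnK.
have [|tau tauK tauz] := cyclo_aut (j := j) ind prim_z (dvdn_mull _ dv_f) co_j.
  by rewrite -(modn_dvdm _ dv_f) j1 modn_dvdm.
exists tau.
  apply: aut_adj_id => //; rewrite rmorphXn /= tauz exprAC; apply/eqP.
  by rewrite -[X in _ == X]expr1 (eq_prim_root_expr prim_zq); apply/eqP.
rewrite rmorphXn /= tauz [LHS]exprAC; apply/eqP.
by rewrite (eq_prim_root_expr prim_zN); apply/eqP.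
Qed.

Lemma adj_coprime_split (K : divringClosed algC) q N z : coprime q N -> (0 < q)%N ->
  z != 0 -> {subset adj K z <= adj (adj K (z ^+ q)) (z ^+ N)}.
Proof.
move=> co_qN q_gt0 nzz; apply: sub_adj => [x Kx|]; first by do 2!apply: adj_base.
case: (egcdnP N q_gt0) => kq km Ekq _; rewrite (eqP co_qN) in Ekq.
have Ez : z = (z ^+ q) ^+ kq / (z ^+ N) ^+ km.
  by rewrite -!exprM mulnC Ekq [(N * km)%N]mulnC exprD expr1 mulrAC divff ?mul1r ?expf_neq0.
rewrite [X in X \in _]Ez.
apply: rpredM; first by apply: rpredX; apply: adj_base; apply: adj_gen.
by rewrite rpredV; apply: rpredX; apply: adj_gen.
Qed.

(** Summing T_r x = x over 0 < r < q gives (q - 1) x on one side; on the other each nontrivial power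
    sum of om is -1, so only coefficients from F remain. *)
Lemma fixed_by_tame (F : divringClosed algC) q om x (T : nat -> aut) : prime q ->
    q.-primitive_root om -> x \in adj F om ->
    (forall r, (0 < r < q)%N -> [/\ {in F, T r =1 id}, T r om = om ^+ r & T r x = x]) ->
  x \in F.
Proof.
move=> q_pr prim_om Fx fixT.
have q_gt0 := prime_gt0 q_pr; have q_gt1 := prime_gt1 q_pr.
have [k Fk Dx] := adj_expand1 q_gt0 (prim_expr_order prim_om) Fx.
pose o0 := Ordinal q_gt0.
have lt_r (r : 'I_q) : r != o0 -> (0 < r < q)%N.
  by rewrite -val_eqE /= -lt0n ltn_ord andbT.
have sum_om (j : 'I_q) : j != o0 -> \sum_(r < q | r != o0) om ^+ (j * r) = -1.
  move=> /lt_r/andP[j_gt0 lt_j].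
  have prim_j : q.-primitive_root (om ^+ j).
    rewrite prim_root_exp_coprime // coprime_sym prime_coprime //.
    by apply/negP=> /dvdn_leq; rewrite j_gt0 leqNgt lt_j => /(_ isT).
  have := sum_prim_root q_gt1 prim_j; rewrite (bigD1 o0) //= expr0 => /eqP.
  rewrite addrC addr_eq0 => /eqP <-; apply: eq_bigr => r _; exact: exprM.
have : \sum_(r < q | r != o0) x \in F.
  rewrite (eq_bigr (fun r : 'I_q => \sum_(j < q) k j * om ^+ (j * r))); last first.
    move=> r /lt_r/fixT[TF Tom Tx]; rewrite -{1}Tx {1}Dx rmorph_sum /=.
    apply: eq_bigr => j _; rewrite rmorphM rmorphXn /= TF // Tom -exprM mulnC //.
  rewrite exchange_big /=; apply: rpred_sum => j _; rewrite -mulr_sumr.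
  apply: rpredM => //; have [->|/sum_om ->] := eqVneq j o0; last by rewrite rpredN rpred1.
  by apply: rpred_sum => r _; rewrite mul0n expr0 rpred1.
have cardq : #|[pred r : 'I_q | r != o0]| = q.-1.
  have := cardC (pred1 o0); rewrite card1 card_ord => /(congr1 predn) /= <-.
  by apply: eq_card.
rewrite sumr_const cardq -mulr_natl.
have nzq : q.-1%:R != 0 :> algC by rewrite pnatr_eq0 -lt0n -ltnS prednK.
by move=> Fqx; rewrite -(mulKf nzq x); apply: rpredM => //; rewrite rpredV rpred_nat.
Qed.

(* At a prime [q] unramified in [F] the inertia group of [F(zeta_q)] acts
   trivially modulo the primes above [q]. *)
Lemma tame_inertia (F : divringClosed algC) q om e (tau : aut) r : prime q ->
    (forall x, x \in F -> x \in Aint -> nilmod q x -> x / q%:R \in Aint) ->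
    q.-primitive_root om -> {in F, tau =1 id} -> tau om = om ^+ r ->
    e \in adj F om -> e \in Aint ->
  exists2 S : nat, ~~ (q %| S)%N & S%:R * (tau e - e) / (1 - om) \in Aint.
Proof.
move=> q_pr unramF prim_om tauF tau_om Fe Ze.
have q_gt0 := prime_gt0 q_pr; have q_gt1 := prime_gt1 q_pr.
have q1_gt0 : (0 < q.-1)%N by rewrite -ltnS prednK.
have Zom := Aint_prim_root prim_om.
have nz1 : 1 - om != 0 by rewrite subr_eq0 eq_sym (prim_root_neq1 prim_om).
(* The coefficients -1 come from om^(q-1) = - (1 + om + ... + om^(q-2)). *)
have [||p [Fp sz_p De]] := @expand_below F om q.-1 (fun=> -1) e q1_gt0 _ _ Fe.
- by move=> _; rewrite rpredN rpred1.
- have := sum_prim_root q_gt1 prim_om; rewrite -(big_mkord xpredT (fun i => om ^+ i)).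
  rewrite -{1}(prednK q_gt0) big_nat_recr //= big_mkord => /eqP.
  rewrite addrC addr_eq0 => /eqP ->.
  by rewrite -sumrN; apply: eq_bigr => j _; rewrite mulN1r.
(* In powers of 1 - om, a uniformiser at q, the coefficients of e are integral at q; each (1 -
   om^r)^i - (1 - om)^i is divisible by 1 - om. *)
pose p1 := p \Po (1%:P - 'X).
have sz1 : size (1%:P - 'X : {poly algC}) = 2%N.
  by rewrite -opprB size_polyN size_XsubC.
have Fp1 : p1 \is a polyOver F.
  by apply: polyOver_comp => //; rewrite rpredB ?polyOverX ?polyOverC ?rpred1.
have sz_p1 : (size p1 <= q.-1)%N.
  rewrite (leq_trans (size_comp_poly_leq _ _)) // sz1 muln1.
  by case: (size p) sz_p.
have De1 : e = p1.[1 - om].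
  by rewrite horner_comp !hornerE De; congr _.[_]; ring.
have [qpi piq] := prim_root_prime_ramified q_pr prim_om.
have Z1om : 1 - om \in Aint by rewrite rpredB ?Aint1.
have [|S ndvS ZS] := @coef_integral_away q F (1 - om) q.-1 q_pr unramF Z1om nz1
  q1_gt0 qpi piq p1 Fp1 sz_p1.
  by rewrite -De1.
exists S => //.
have -> : S%:R * (tau e - e) / (1 - om)
  = \sum_(i < size p1) (S%:R * p1`_i) * (((1 - om ^+ r) ^+ i - (1 - om) ^+ i) / (1 - om)).
  rewrite De1 -horner_map /= rmorphB rmorph1 /= tau_om.
  have -> : map_poly tau p1 = p1.
    by apply/polyP=> i; rewrite coef_map /= tauF // (polyOverP Fp1).
  rewrite !horner_coef -sumrB mulr_sumr mulr_suml; apply: eq_bigr => i _.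
  by move: ((1 - om ^+ r) ^+ i) ((1 - om) ^+ i) => A B; ring.
rewrite rpred_sum // => i _; rewrite rpredM //.
case: (val i) => [|m]; first by rewrite !expr0 subrr mul0r Aint0.
have -> : ((1 - om ^+ r) ^+ m.+1 - (1 - om) ^+ m.+1) / (1 - om)
   = (1 - om ^+ r) ^+ m * ((1 - om ^+ r) / (1 - om)) - (1 - om) ^+ m.
  by rewrite !exprSr mulrBl mulfK // mulrA.
apply: rpredB; last exact: rpredX.
apply: rpredM; last exact: unity_ratio_Aint.
by apply: rpredX; apply: rpredB; [apply: Aint1 | apply: rpredX].
Qed.

(** If x were outside F = K(z^q), some tau over F would invert x and so negate [del], a square root
    of the discriminant (y - c)^2 - 4 a^2. By [tame_inertia], [del] times a denominator of y is then
    nilpotent modulo q, so its square, lying in the unramified field F, is divisible by q. The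
    bounded house of that square excludes large q. *)
Lemma tame_step (K : divringClosed algC) (a c : algC) f D R : a \in K -> c \in K -> a != 0 ->
    cyclo_indep K f ->
    (forall q N z x, prime q -> (0 < N)%N -> z ^+ N = 1 -> ~~ (q %| D * N)%N ->
       x \in adj K z -> x \in Aint -> nilmod q x -> x / q%:R \in Aint) ->
  exists Q : nat, forall q N z x y u w, prime q -> odd q -> (Q < q)%N ->
    ~~ (q %| D * N)%N -> (f %| N)%N -> (0 < N)%N -> (q * N).-primitive_root z ->
    y \in adj K (z ^+ q) -> x \in adj K z -> x != 0 -> phi a c x = y ->
    u \in Aint -> w \in Aint -> w != 0 -> y = u / w ->
    bounded_house R u -> bounded_house R w ->
  x \in adj K (z ^+ q).
Proof.
move=> Ka Kc nza ind unram.
have [B B_gt0 [ZA ZC]] := common_denominator a c.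
have [A DA] : exists A, A = B%:R * a by exists (B%:R * a).
have [C DC] : exists C, C = B%:R * c by exists (B%:R * c).
rewrite -DA -DC in ZA ZC.
have nzB : B%:R != 0 :> algC by rewrite pnatr_eq0 -lt0n.
have ZB : B%:R \in Aint by rewrite rpred_nat.
have [k1 Hk1] := house_bound C; have [k2 Hk2] := house_bound A.
(* An upper bound for all conjugates of (B u - C w)^2 - 4 (A w)^2, which is the discriminant
   multiplied by (B w)^2. *)
pose Q := ((B * R + k1 * R) ^ 2 + 4 * (k2 * R) ^ 2)%N.
exists Q => q N z x y u w q_pr odd_q lt_Q ndv dv_f N_gt0 prim_z Fy Fx nzx Exy Zu Zw nzw Dy Hu Hw.
have q_gt0 := prime_gt0 q_pr; have q_gt1 := prime_gt1 q_pr.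
have ndv_N : ~~ (q %| N)%N by apply: contra ndv => dv; rewrite dvdn_mull.
have nzq : q%:R != 0 :> algC by rewrite pnatr_eq0 -lt0n.
pose F := adj K (z ^+ q); pose om := z ^+ N.
have nzz : z != 0.
  by apply: unity_neq0 (prim_expr_order prim_z); apply: prim_order_gt0 prim_z.
have prim_om : q.-primitive_root om.
  have := dvdn_prim_root prim_z (dvdn_mulr N (dvdnn q)).
  by rewrite mulKn.
have zqN : (z ^+ q) ^+ N = 1 by rewrite -exprM (prim_expr_order prim_z).
have unramF t : t \in F -> t \in Aint -> nilmod q t -> t / q%:R \in Aint.
  exact: unram q_pr N_gt0 zqN ndv.
have co_qN : coprime q N by rewrite prime_coprime.
have sub_om : {subset adj K z <= adj F om} by apply: adj_coprime_split.
have Fom_x := sub_om x Fx.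
have sKF : {subset K <= F} by move=> t; apply: adj_base.
apply: contrapT => /negP nFx.
have [tau [r [tauF tau_om ntau]]] : exists tau : aut, exists r,
    [/\ {in F, tau =1 id}, tau om = om ^+ r & tau x != x].
  apply: contrapT => no_tau; move/negP: nFx; apply.
  have /choice[T HT] r : exists tau : aut, (0 < r < q)%N ->
      [/\ {in F, tau =1 id}, tau om = om ^+ r & tau x = x].
    case lt_r : (0 < r < q)%N; last by exists idfun.
    have [tau tF tom] := tame_automorphisms ind q_pr prim_z ndv_N dv_f N_gt0 lt_r.
    exists tau => _; split=> //; apply: contrapT => /eqP ntau.
    by apply: no_tau; exists tau, r.
  exact: fixed_by_tame q_pr prim_om Fom_x HT.
have tauK : {in K, tau =1 id} by move=> t /sKF/tauF.
have tau_x : tau x = x^-1.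
  have nz_tx : tau x != 0 by rewrite fmorph_eq0.
  have [|/eqP|//] := phi_fiber (c := c) nza nz_tx nzx; last by rewrite (negPf ntau).
  by rewrite -(phi_aut Ka Kc) // Exy tauF.
pose del := a * (x - x^-1).
have tau_del : tau del = - del.
  by rewrite /del rmorphM rmorphB fmorphV /= tau_x invrK tauK //; ring.
have nz_del : del != 0.
  by rewrite mulf_neq0 // subr_eq0 -tau_x eq_sym.
have Edel : del ^+ 2 = (y - c) ^+ 2 - 4 * a ^+ 2.
  by rewrite /del -Exy /phi; field.
have F_del2 : del ^+ 2 \in F.
  have [Fa Fc] := (sKF a Ka, sKF c Kc).
  by rewrite Edel; apply: rpredB;
    [apply: rpredX; apply: rpredB | apply: rpredM; [apply: rpred_nat | apply: rpredX]].
have Fom_del : del \in adj F om.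
  have Fa := adj_base om (sKF a Ka).
  by apply: rpredM => //; apply: rpredB => //; rewrite rpredV.
have sq := sqrtCK (q%:R : algC); set s := sqrtC q%:R in sq.
have nzs : s != 0 by rewrite sqrtC_eq0.
have denom_del d : d \in adj Crat y -> d \in Aint -> d * y \in Aint ->
    B%:R * d * del / s \in Aint.
  move=> Qd Zd Zdy; pose e := B%:R * d * del.
  have Fd : d \in F by apply: sub_adj Qd => // t; apply: rpred_Crat.
  have Ee2 : e ^+ 2 = (B%:R * (d * y) - C * d) ^+ 2 - 4 * (A * d) ^+ 2.
    by rewrite /e DA DC exprMn Edel; ring.
  have Ze2 : e ^+ 2 \in Aint.
    rewrite Ee2; apply: rpredB; first by apply: rpredX; apply: rpredB; apply: rpredM.
    by apply: rpredM; [apply: rpred_nat | apply: rpredX; apply: rpredM].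
  have Ze : e \in Aint by apply: (@Aint_expr _ 2).
  have Fe : e \in adj F om.
    by apply: rpredM => //; apply: adj_base; apply: rpredM => //; apply: rpred_nat.
  have Fe2 : e ^+ 2 \in F.
    by rewrite exprMn; apply: rpredM => //; apply: rpredX; apply: rpredM => //; apply: rpred_nat.
  have tau_e : tau e = - e.
    rewrite /e rmorphM /= tau_del mulrN; congr (- (_ * _)); apply: tauF.
    by apply: rpredM => //; apply: rpred_nat.
  have [S ndvS ZS] := tame_inertia q_pr unramF prim_om tauF tau_om Fe Ze.
  have nil_e : nilmod q ((2 * S)%:R * e).
    have nz1 : 1 - om != 0 by rewrite subr_eq0 eq_sym (prim_root_neq1 prim_om).
    have [qpi piq] := prim_root_prime_ramified q_pr prim_om.
    apply: (@nilmod_pi _ (1 - om) q.-1) => //; first by rewrite -ltnS prednK.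
    rewrite -rpredN (_ : - _ = S%:R * (tau e - e) / (1 - om)) // tau_e natrM.
    by field.
  have nil_e2 : nilmod q ((2 * S * (2 * S))%:R * e ^+ 2).
    have -> : (2 * S * (2 * S))%:R * e ^+ 2 = (2 * S)%:R * e * ((2 * S)%:R * e).
      by rewrite natrM; ring.
    by apply: nilmodM => //; rewrite rpredM ?rpred_nat.
  have Ze2q : e ^+ 2 / q%:R \in Aint.
    apply: (@Aint_coprime_div _ (2 * S * (2 * S))) => //.
      have co2 : coprime q 2 by rewrite coprimen2.
      by rewrite !coprimeMr co2 !(prime_coprime _ q_pr) ndvS.
    apply: unramF => //; first by apply: rpredM => //; apply: rpred_nat.
    by rewrite rpredM ?rpred_nat.
  by apply: (@Aint_expr _ 2) => //; rewrite expr_div_n sq.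
(* The factor w itself need not be in K(y), so divisibility is proved for the denominators d0 and d1
   of y and transferred by w = d0 w + d1 u. *)
have [d0 [d1 [Qd0 Qd1 [Zd0 Zd0y Zd1 Zd1y] d01]]] := denominators_coprime y.
pose h := B%:R * w * del / s.
have Zh : h \in Aint.
  have -> : h = (B%:R * d0 * del / s) * w + (B%:R * d1 * del / s) * u.
    have Du : u = y * w by rewrite Dy divfK.
    have -> : h = B%:R * ((d0 + d1 * y) * w) * del / s by rewrite d01 mul1r.
    by rewrite Du; ring.
  by apply: rpredD; apply: rpredM => //; apply: denom_del.
have nzh : h != 0 by rewrite /h mulf_neq0 ?invr_eq0 // mulf_neq0 // mulf_neq0.
have [nu ge1] := house_ge1 Zh nzh.
have Eh : q%:R * h ^+ 2 = (B%:R * u - C * w) ^+ 2 - 4 * (A * w) ^+ 2.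
  have -> : q%:R * h ^+ 2 = (B%:R * w) ^+ 2 * del ^+ 2.
    by rewrite /h -sq; field.
  by rewrite Edel Dy DA DC; field.
have le1 : `|nu ((B%:R * u - C * w) ^+ 2 - 4 * (A * w) ^+ 2)| <= Q%:R.
  rewrite rmorphB rmorphXn rmorphB (rmorphM nu 4) rmorphXn !rmorphM /= !rmorph_nat.
  apply: le_trans (ler_normB _ _) _; rewrite /Q natrD; apply: lerD.
    rewrite normrX natrX; apply: lerXn2r; rewrite ?nnegrE ?normr_ge0 ?ler0n //.
    apply: le_trans (ler_normB _ _) _; rewrite natrD !natrM !normrM; apply: lerD.
      by apply: ler_pM; rewrite ?normr_ge0 // normr_nat.
    by apply: ler_pM; rewrite ?normr_ge0.
  rewrite normrM normrX natrM natrX normr_nat ler_wpM2l ?ler0n //.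
  apply: lerXn2r; rewrite ?nnegrE ?normr_ge0 ?ler0n // normrM natrM.
  by apply: ler_pM; rewrite ?normr_ge0.
have : (q%:R : algC) <= Q%:R.
  apply: le_trans le1; rewrite -Eh rmorphM rmorphXn rmorph_nat normrM normrX normr_nat.
  by rewrite ler_peMr ?ler0n // exprn_ege1.
by rewrite ler_nat leqNgt lt_Q.
Qed.

Lemma odd_reduction (K : divringClosed algC) t (a c alpha : algC) :
    t \in K -> t \in Aint -> {subset K <= adj Crat t} ->
    a \in K -> c \in K -> a != 0 -> alpha \in K ->
  exists2 f, [/\ (0 < f)%N, (4 %| f)%N & cyclo_indep K f] &
  forall n g N z, g 0%N = alpha -> bpath a c g n -> (0 < N)%N -> z ^+ N = 1 ->
    g n \in adj K z ->
  exists k (z' : algC), (f * 2 ^ k).-primitive_root z' /\ g n \in adj K z'.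
Proof.
move=> Kt Zt sKt Ka Kc nza Kal.
have [f0 f0_gt0 ind] := cyclotomic_independence sKt.
have [D D_gt0 discD] := disc_multiple_exists Zt.
have unram := unramified_away Kt Zt sKt discD.
have [R lift] := bounded_lift c alpha nza.
have [Q tame] := @tame_step K a c f0 D R Ka Kc nza ind unram.
(* The factor 4 makes the 2-tower behave regularly, f0 gives independence from K, and D and Q!
   contain all odd primes that [tame_step] does not treat. *)
pose f := (4 * f0 * D * Q`!)%N.
have f_gt0 : (0 < f)%N by rewrite !muln_gt0 f0_gt0 D_gt0 fact_gt0.
have dv_f0 : (f0 %| f)%N by rewrite /f -!mulnA dvdn_mull // dvdn_mulr.
exists f; first by split=> //; [rewrite /f -!mulnA dvdn_mulr | apply: cyclo_indep_dvd ind].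
move=> n g N z g0 path_g N_gt0 zN Fz.
have Kg0 : g 0%N \in K by rewrite g0.
(* An odd prime q dividing m is removed from the order f m: by [wild_odd_step] if q still divides
   the remaining order, otherwise by [tame_step] applied point by point along the path. *)
have main m : forall z', (f * m).-primitive_root z' -> g n \in adj K z' ->
  exists k (z'' : algC), (f * 2 ^ k).-primitive_root z'' /\ g n \in adj K z''.
  elim/ltn_ind: m => m IHm z' prim_z Fn.
  have m_gt0 : (0 < m)%N.
    by have := prim_order_gt0 prim_z; rewrite muln_gt0 => /andP[].
  have [pow2|] := boolP (2%N.-nat m).
    by have [k Dm] := p_natP pow2; exists k, z'; rewrite -Dm.
  rewrite /pnat m_gt0 /= => /allPn[q]; rewrite mem_primes m_gt0 /= => /andP[q_pr dv_qm] q_n2.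
  have odd_q : odd q by have [q2|//] := even_prime q_pr; rewrite q2 in q_n2.
  have /dvdnP[m' Dm] := dv_qm.
  have m'_gt0 : (0 < m')%N by move: m_gt0; rewrite Dm muln_gt0 => /andP[].
  have lt_m' : (m' < m)%N by rewrite Dm ltn_Pmulr // prime_gt1.
  have prim_z1 : (q * (f * m')).-primitive_root z'.
    by rewrite (_ : q * (f * m') = f * m)%N // Dm mulnC mulnA.
  have prim_zq : (f * m').-primitive_root (z' ^+ q).
    have := dvdn_prim_root prim_z1 (dvdn_mull q (dvdnn (f * m'))).
    by rewrite mulnK // muln_gt0 f_gt0.
  apply: (IHm m') prim_zq _ => //.
  have N'_gt0 : (0 < f * m')%N by rewrite muln_gt0 f_gt0.
  have dv_N' : (f0 %| f * m')%N by apply: dvdn_mulr.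
  have [dv_q|ndv_q] := boolP (q %| f * m')%N.
    exact: (wild_odd_step Ka Kc nza ind q_pr odd_q prim_z1 dv_q dv_N' N'_gt0 path_g Kg0 Fn).
  have ndv_f : ~~ (q %| f)%N by apply: contra ndv_q => dv; apply: dvdn_mulr.
  have ndv_D : ~~ (q %| D)%N.
    by apply: contra ndv_f => dv; rewrite /f mulnAC dvdn_mull.
  have lt_Q : (Q < q)%N.
    rewrite ltnNge; apply: contra ndv_f => le_qQ; rewrite /f dvdn_mull //.
    by rewrite dvdn_fact // le_qQ andbT prime_gt0.
  have Fg i : (i <= n)%N -> g i \in adj K z'.
    move=> le_i; apply: (@bpath_in K a c Ka Kc (adj K z') g n _ path_g Fn i le_i) => x.
    exact: adj_base.
  suff Fq i : (i <= n)%N -> g i \in adj K (z' ^+ q) by apply: Fq.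
  elim: i => [|i IHi] lt_i; first exact: adj_base.
  have [nz Eg] := path_g i lt_i.
  have [|u [w [Zu Zw nzw Dg [Hu Hw]]]] := lift i g g0.
    by move=> j lt_j; apply: path_g; apply: ltn_trans lt_i.
  apply: (tame q (f * m')%N z' (g i.+1) (g i) u w) => //.
  - by rewrite Euclid_dvdM // negb_or ndv_D.
  - exact/IHi/ltnW.
  - exact: Fg.
have fN_gt0 : (0 < f * N)%N by rewrite muln_gt0 f_gt0.
have [Z prim_Z] := C_prim_root_exists fN_gt0.
have /(prim_rootP prim_Z)[j Dz] : z ^+ (f * N) = 1 by rewrite mulnC exprM zN expr1n.
by apply: (main N Z prim_Z); apply: (adj_expr (n := j)); rewrite -Dz.
Qed.

(** * Valuations above 2 *)

(** Subrings are sets here so that Zorn's lemma applies; the maximal one is repackaged as a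
    [subringClosed] structure. *)
Definition subring (A : set algC) :=
  [/\ A 1, (forall x y, A x -> A y -> A (x - y)) & (forall x y, A x -> A y -> A (x * y))].

Section SubringFacts.
Variable A : set algC.
Hypothesis ringA : subring A.

Lemma subring0 : A 0. Proof. by case: ringA => A1 AB _; rewrite -(subrr 1); apply: (AB). Qed.

Lemma subringD x y : A x -> A y -> A (x + y).
Proof.
case: ringA => A1 AB _ Ax Ay; have -> : x + y = x - (0 - y) by rewrite sub0r opprK.
by apply: (AB) => //; apply: (AB) => //; apply: subring0.
Qed.

Lemma subringX x n : A x -> A (x ^+ n).
Proof. by case: ringA => A1 _ AM Ax; elim: n => // n IHn; rewrite exprS; apply: (AM). Qed.

Lemma subring_sum (I : finType) (F : I -> algC) : (forall i, A (F i)) -> A (\sum_i F i).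
Proof. by move=> AF; apply: big_ind => //; [apply: subring0 | apply: subringD]. Qed.

Definition adjoin_set (x : algC) : set algC :=
  [set y | exists2 p : {poly algC}, forall i, A p`_i & y = p.[x]].

Lemma adjoin_set_subring x : subring (adjoin_set x).
Proof.
case: (ringA) => A1 AB AM; split.
- exists 1%:P; rewrite ?hornerC // => i; rewrite coefC; case: eqP => // _.
  exact: subring0.
- move=> _ _ [p Ap ->] [q Aq ->]; exists (p - q); last by rewrite hornerD hornerN.
  by move=> i; rewrite coefB; apply: (AB).
- move=> _ _ [p Ap ->] [q Aq ->]; exists (p * q); last by rewrite hornerM.
  by move=> i; rewrite coefM; apply: subring_sum => j; apply: (AM).
Qed.

Lemma sub_adjoin_set x y : A y -> adjoin_set x y.
Proof.
move=> Ay; exists y%:P; rewrite ?hornerC // => i; rewrite coefC; case: eqP => // _.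
exact: subring0.
Qed.

Lemma mem_adjoin_set x : adjoin_set x x.
Proof.
case: (ringA) => A1 _ _; exists 'X; rewrite ?hornerX // => i; rewrite coefX.
by case: eqP => // _; apply: subring0.
Qed.

Definition span_pow n (x y : algC) :=
  exists2 b : nat -> algC, forall i, A (b i) & y = \sum_(i < n) b i * x ^+ i.

Lemma span_powD n x y z : span_pow n x y -> span_pow n x z -> span_pow n x (y + z).
Proof.
move=> [b Ab ->] [d Ad ->]; exists (fun i => b i + d i) => [i|]; first exact: subringD.
by rewrite -big_split; apply: eq_bigr => i _; rewrite mulrDl.
Qed.

Lemma span_powZ n x a y : A a -> span_pow n x y -> span_pow n x (a * y).
Proof.
case: ringA => _ _ AM Aa [b Ab ->]; exists (fun i => a * b i) => [i|]; first exact: AM.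
by rewrite mulr_sumr; apply: eq_bigr => i _; rewrite mulrA.
Qed.

Lemma span_pow_gen n x i : (i < n)%N -> span_pow n x (x ^+ i).
Proof.
case: ringA => A1 _ _ lt_i; exists (fun j => (j == i)%:R) => [j|].
  by case: eqP => _ //; apply: subring0.
rewrite (bigD1 (Ordinal lt_i)) //= eqxx mul1r big1 ?addr0 // => j.
by rewrite -val_eqE /= => /negPf ->; rewrite mul0r.
Qed.

Lemma span_pow_sum n x (I : finType) (F : I -> algC) :
  (forall i, span_pow n x (F i)) -> span_pow n x (\sum_i F i).
Proof.
move=> SF; apply: big_ind => //; last exact: span_powD.
exists (fun=> 0) => [_|]; first exact: subring0.
by rewrite big1 // => i _; rewrite mul0r.
Qed.
End SubringFacts.

(* Chevalley's argument. *)
Lemma maximal_subring_valuation (A : set algC) : subring A -> ~ A 2^-1 ->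
    (forall B, subring B -> (forall x, A x -> B x) -> ~ B 2^-1 -> forall x, B x -> A x) ->
  forall x, A x \/ A x^-1.
Proof.
move=> ringA nA2 maxA; case: (ringA) => A1 AB AM.
have half x : ~ A x -> adjoin_set A x 2^-1.
  move=> nAx; apply: contrapT => nB; apply: nAx.
  apply: (maxA (adjoin_set A x)) => //; first exact: adjoin_set_subring.
    exact: sub_adjoin_set.
  exact: mem_adjoin_set.
have A2 : A 2 by rewrite -[2]/(1 + 1); apply: subringD.
have nz2 : (2 : algC) != 0 by rewrite pnatr_eq0.
(* If 1 / u with u = 1 - 2 b were missing, 1/2 would be in A[1/u]; clearing the powers of u, which
   have the form 1 - 2 d, would put 1/2 in A. *)
have unitA b : A b -> A (1 - 2 * b)^-1.
  move=> Ab; apply: contrapT => /half[p Ap E2]; apply: (nA2).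
  set u := 1 - 2 * b in E2.
  have Au : A u by apply: (AB) => //; apply: (AM).
  have nzu : u != 0.
    apply/eqP => u0; have : 2^-1 = b.
      by apply: (mulfI nz2); rewrite divff //; apply/eqP; rewrite -subr_eq0 -/u u0.
    by move=> Eb; apply: (nA2); rewrite Eb.
  have [n Dn] : exists n, n = size p by exists (size p).
  have A1' : A (u ^+ n / 2).
    rewrite E2 horner_coef -Dn mulr_sumr; apply: subring_sum => // i.
    rewrite mulrCA; apply: (AM) => //.
    have -> : u ^+ n * u^-1 ^+ i = u ^+ (n - i).
      by rewrite exprVn -expfB // ltn_ord.
    exact: subringX.
  have [d Ad Ed] : exists2 d, A d & u ^+ n = 1 - 2 * d.
    elim: (n) => [|k [d Ad Ed]]; first by exists 0; [apply: subring0 | rewrite mulr0 subr0].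
    exists (b + d - 2 * (b * d)); last by rewrite exprS Ed /u; ring.
    by apply: (AB); [apply: subringD | do 2!apply: (AM) => //].
  have -> : 2^-1 = u ^+ n / 2 + d by rewrite Ed; field.
  exact: subringD.
have {}half x : ~ A x -> exists n, span_pow A n x 2^-1.
  move=> /half[p Ap ->]; exists (size p), (fun i => p`_i) => //.
  by rewrite horner_coef.
(* Descent on n + m: as 1 - 2 b_0 is a unit, the shorter relation expresses the top power of the
   longer one by lower powers, which shortens the longer one. *)
have key N : forall n m x, (n + m <= N)%N -> x != 0 ->
    span_pow A n x 2^-1 -> span_pow A m x^-1 2^-1 -> False.
  elim: N => [|N IHN] n m x.
    rewrite leqn0 addn_eq0 => /andP[/eqP -> _] _ [b _ E].
    by move: E; rewrite big_ord0 => /eqP; rewrite invr_eq0 (negPf nz2).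
  move=> le_nm nzx; wlog le_mn : n m x nzx le_nm / (m <= n)%N => [IH|].
    have [le_mn|/ltnW le_nm'] := leqP m n; first exact: IH.
    move=> Sn Sm; apply: (IH m n x^-1) => //; rewrite ?invr_eq0 ?invrK //.
    by rewrite addnC.
  case: n => [|n] in le_nm le_mn *.
    move=> [b _ E] _; move: E; rewrite big_ord0 => /eqP.
    by rewrite invr_eq0 (negPf nz2).
  move=> Sn Sm; apply: (IHN n m x) => //.
  have Sxn : span_pow A n x (x ^+ n).
    case: Sm => b Ab; case: m => [|m] in le_nm le_mn *.
      by rewrite big_ord0 => /eqP; rewrite invr_eq0 (negPf nz2).
    rewrite big_ord_recl expr0 mulr1 /= => E2.
    set v := (1 - 2 * b 0%N)^-1.
    have nzu : 1 - 2 * b 0%N != 0.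
      apply/eqP => u0; apply: (nA2); have -> : 2^-1 = b 0%N; last exact: Ab.
      by apply: (mulfI nz2); rewrite divff //; apply/eqP; rewrite -subr_eq0 u0.
    have -> : x ^+ n = \sum_(i < m) (v * 2 * b i.+1) * x ^+ (n - i.+1).
      have Ev : v * 2 * \sum_(i < m) b i.+1 * x^-1 ^+ i.+1 = 1.
        have -> : \sum_(i < m) b i.+1 * x^-1 ^+ i.+1 = 2^-1 - b 0%N.
          by rewrite E2 addrAC subrr add0r.
        by rewrite /v; field.
      rewrite -[LHS]mulr1 -[in LHS]Ev mulrCA !mulr_sumr; apply: eq_bigr => i _.
      have -> : x ^+ (n - i.+1) = x ^+ n * x^-1 ^+ i.+1.
        by rewrite exprVn -expfB_cond // (negPf nzx) add0n (leq_trans (ltn_ord i)).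
      by move: (x ^+ n) (x^-1 ^+ i.+1) => X Y; ring.
    apply: span_pow_sum => // i; apply: span_powZ => //.
      by apply: (AM) => //; apply: (AM) => //; apply: (unitA).
    apply: span_pow_gen => //; rewrite ltn_subrL /=.
    by apply: leq_trans (_ : m <= n)%N; [apply: leq_ltn_trans (ltn_ord i) | rewrite -ltnS].
  case: Sn => b Ab ->; rewrite big_ord_recr /=; apply: span_powD => //.
    by exists b.
  exact: span_powZ.
move=> x; apply: contrapT => /not_orP[nAx nAx'].
have nzx : x != 0 by apply/eqP => x0; apply: nAx; rewrite x0; apply: subring0.
have [n Sn] := half x nAx; have [m Sm] := half _ nAx'.
exact: (key (n + m)%N n m x).
Qed.

Lemma valuation_ring_above (A0 : set algC) : subring A0 -> ~ A0 2^-1 ->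
  exists2 R : subringClosed algC, (forall x, A0 x -> x \in R) &
    2^-1 \notin R /\ forall x, (x \in R) || (x^-1 \in R).
Proof.
move=> ring0 n02.
pose good (A : set algC) := [/\ subring A, (forall x, A0 x -> A x) & ~ A 2^-1].
pose P (A : set algC) := A = set0 \/ good A.
have [F sFP totF|A [PA maxA]] := @Zorn_bigcup algC P.
  have [[A FA goodA]|noA] := pselect (exists2 A, F A & good A); last first.
    left; apply/seteqP; split=> // x [A FA Ax].
    have [A0'|goodA] := sFP A FA; first by move: Ax; rewrite A0'.
    by case: noA; exists A.
  have pick2 x y : (\bigcup_(X in F) X)%classic x -> (\bigcup_(X in F) X)%classic y ->
      exists2 B, F B /\ good B & B x /\ B y.
    move=> [B FB Bx] [C FC Cy].
    have good_of D u : F D -> D u -> good D.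
      by move=> FD Du; have [D0|//] := sFP D FD; move: Du; rewrite D0.
    have [sBC|sCB] := totF B C FB FC.
      by exists C; [split=> //; apply: good_of Cy | split=> //; apply: sBC].
    by exists B; [split=> //; apply: good_of Bx | split=> //; apply: sCB].
  right; case: (goodA) => ringA sA0 nA2; split.
  - split.
    + by exists A => //; case: ringA.
    + move=> x y Ux Uy; have [B [FB [[_ BB _] _ _]] [Bx By]] := pick2 x y Ux Uy.
      by exists B => //; apply: BB.
    + move=> x y Ux Uy; have [B [FB [[_ _ BM] _ _]] [Bx By]] := pick2 x y Ux Uy.
      by exists B => //; apply: BM.
  - by move=> x /sA0 Ax; exists A.
  - move=> [B FB B2]; have [B0|[_ _]] := sFP B FB; first by move: B2; rewrite B0.
    by apply.
have gA0 : good A0 by split.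
have gA : good A.
  case: PA => // A_0; exfalso; apply: (maxA A0); last by right.
  rewrite A_0; split; first exact: sub0set.
  by case: ring0 => A01 _ _ /(_ 1 A01).
case: (gA) => ringA sA0 nA2.
have totA := @maximal_subring_valuation A ringA nA2.
have {}totA x : A x \/ A x^-1.
  apply: totA => B ringB sAB nB2 y By; apply: contrapT => nAy.
  apply: (maxA B); last by right; split=> // z /sA0/sAB.
  by split; [exact: sAB | move=> /(_ y By)].
pose R : {pred algC} := fun x => `[< A x >].
have ringR : subring_closed R.
  case: ringA => A1 AB AM; split; first exact/asboolP.
    by move=> x y /asboolP Ax /asboolP Ay; apply/asboolP/AB.
  by move=> x y /asboolP Ax /asboolP Ay; apply/asboolP/AM.
pose RC := GRing.isSubringClosed.Build _ R ringR.
pose R' : subringClosed algC := HB.pack R RC.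
exists R'; first by move=> x /sA0 Ax; apply/asboolP.
split; first by apply/negP => /asboolP.
by move=> x; apply/orP; case: (totA x) => Ax; [left | right]; apply/asboolP.
Qed.

Section TwoAdicValuation.
Variable R : subringClosed algC.
Hypotheses (R2 : 2^-1 \notin R) (Rtot : forall x, (x \in R) || (x^-1 \in R)).

Let nz2 : (2 : algC) != 0. Proof. by rewrite pnatr_eq0. Qed.
Let nz2X n : (2 : algC) ^+ n != 0. Proof. exact: expf_neq0. Qed.
#[local] Hint Resolve nz2 nz2X : core.

Definition unitR (x : algC) := [&& x != 0, x \in R & x^-1 \in R].

Lemma unitRM x y : unitR x -> unitR y -> unitR (x * y).
Proof.
case/and3P=> nzx Rx Rx' /and3P[nzy Ry Ry']; apply/and3P; split.
- exact: mulf_neq0.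
- exact: rpredM.
- by rewrite invfM rpredM.
Qed.

Lemma unitRV x : unitR x -> unitR x^-1.
Proof. by case/and3P=> nzx Rx Rx'; rewrite /unitR invr_eq0 nzx invrK Rx' Rx. Qed.

Lemma unitRX x n : unitR x -> unitR (x ^+ n).
Proof.
move=> Ux; elim: n => [|n IHn]; last by rewrite exprS unitRM.
by rewrite /unitR expr0 invr1 oner_eq0 rpred1.
Qed.

Lemma R_expr n x : (0 < n)%N -> x ^+ n \in R -> x \in R.
Proof.
case: n => // n _ Rxn; have /orP[//|Rx'] := Rtot x.
have [->|nzx] := eqVneq x 0; first exact: rpred0.
have -> : x = x ^+ n.+1 * x^-1 ^+ n by rewrite exprS exprVn mulfK // expf_neq0.
by apply: rpredM => //; apply: rpredX.
Qed.

Lemma R_Aint : {subset Aint <= R}.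
Proof.
move=> x /Aint_integralOver[p mon_p px0]; have /orP[//|Rx'] := Rtot x.
have [->|nzx] := eqVneq x 0; first exact: rpred0.
have sz_p := polySpred (monic_neq0 mon_p); set n := (size p).-1 in sz_p.
have px : \sum_(i < n) (p`_i)%:~R * x ^+ i + x ^+ n = 0.
  have /eqP := px0; rewrite horner_coef size_map_poly_id0 ?(monicP mon_p) ?oner_eq0 //.
  rewrite sz_p big_ord_recr /= coef_map /= (_ : p`_n = 1) ?mul1r; last first.
    by have := monicP mon_p; rewrite lead_coefE sz_p.
  by under eq_bigr do rewrite coef_map /=.
case: n => [|n] in sz_p px *.
  by move/eqP: px; rewrite big_ord0 add0r oner_eq0.
have -> : x = - \sum_(i < n.+1) (p`_i)%:~R * x^-1 ^+ (n - i).
  have nzn := expf_neq0 n nzx; apply: (mulfI nzn); rewrite -exprSr.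
  apply/eqP; rewrite mulrN -addr_eq0 addrC -[X in _ == X]px; apply/eqP; congr (_ + _).
  rewrite mulr_sumr; apply: eq_bigr => i _; rewrite mulrCA; congr (_ * _).
  rewrite exprVn -expfB_cond ?(negPf nzx) ?leq_subr //.
  by rewrite subKn // -ltnS.
rewrite rpredN rpred_sum // => i _.
by rewrite rpredM ?rpredX // rpred_int.
Qed.

Lemma odd_unit n : odd n -> unitR n%:R.
Proof.
move=> odd_n; have n_gt0 : (0 < n)%N by case: n odd_n.
have nzn : n%:R != 0 :> algC by rewrite pnatr_eq0 -lt0n.
have En : n%:R = 2 * (n./2)%:R + 1 :> algC.
  by rewrite -{1}(odd_double_half n) odd_n natrD -mul2n natrM addrC.
rewrite /unitR nzn rpred_nat /=.
have /orP[R2n|] := Rtot (2 / n%:R).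
  have -> : n%:R^-1 = 1 - (n./2)%:R * (2 / n%:R) :> algC.
    apply: (mulIf nzn); rewrite mulVf // mulrBl -mulrA divfK // mul1r {1}En; ring.
  by rewrite rpredB ?rpred1 // rpredM ?rpred_nat.
rewrite invfM invrK mulrC => Rn2; case/negP: R2.
have -> : 2^-1 = n%:R / 2 - (n./2)%:R :> algC by rewrite En; field.
by rewrite rpredB ?rpred_nat.
Qed.

Lemma int_unit (c : int) : c != 0 -> exists e, unitR (c%:~R / 2 ^+ e).
Proof.
move=> nzc; have c_gt0 : (0 < `|c|)%N by rewrite absz_gt0.
have [o co_o Do] := pfactor_coprime (isT : prime 2) c_gt0.
exists (logn 2 `|c|).
have -> : c%:~R / 2 ^+ logn 2 `|c| = (-1) ^+ (c < 0)%R * o%:R :> algC.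
  rewrite {1}[c]intEsign {1}Do rmorphM rmorph_sign /= -pmulrn natrM natrX mulrA mulfK //.
apply: unitRM; last by apply: odd_unit; rewrite -coprime2n.
apply: unitRX; rewrite /unitR oppr_eq0 oner_eq0 invrN invr1 rpredN rpred1 //.
Qed.

Lemma two_power_unit m n : unitR (2 ^+ m / 2 ^+ n) -> m = n.
Proof.
have bad k : (2 ^+ k.+1)^-1 \notin R.
  apply: contra R2 => R2k; rewrite (_ : 2^-1 = 2 ^+ k * (2 ^+ k.+1)^-1).
    by rewrite rpredM // rpredX // rpred_nat.
  by rewrite exprS; field.
case/and3P=> _ Ru Ru'; have [lt|lt|//] := ltngtP m n.
  have En : n = (m + (n - m.+1).+1)%N by rewrite addnS -addSn subnKC.
  by case/negP: (bad (n - m.+1)%N); move: Ru; rewrite {1}En exprD invfM mulrA divff // mul1r.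
have Em : m = (n + (m - n.+1).+1)%N by rewrite addnS -addSn subnKC.
by case/negP: (bad (m - n.+1)%N); move: Ru'; rewrite {1}Em exprD mulrAC divff // mul1r.
Qed.

Lemma maximal_idealD x y : x \in R -> y \in R -> ~~ unitR x -> ~~ unitR y -> ~~ unitR (x + y).
Proof.
move=> Rx Ry nUx nUy.
have [->|nzx] := eqVneq x 0; first by rewrite add0r.
have [->|nzy] := eqVneq y 0; first by rewrite addr0.
apply/negP => /and3P[nz _ Rxy].
have /orP[Ryx|] := Rtot (y / x).
  case/negP: nUx; apply/and3P; split=> //.
  have -> : x^-1 = (1 + y / x) * (x + y)^-1 by field; rewrite nz nzx.
  by rewrite rpredM ?rpredD ?rpred1.
rewrite invfM invrK => Rxy'; case/negP: nUy; apply/and3P; split=> //.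
have -> : y^-1 = (1 + y^-1 * x) * (x + y)^-1 by field; rewrite nz nzy.
by rewrite rpredM ?rpredD ?rpred1.
Qed.

Lemma valuation_min (s : seq algC) : s != [::] -> all (predC1 0) s ->
  exists2 y, y \in s & forall z, z \in s -> z / y \in R.
Proof.
elim: s => // x s IHs _ /= /andP[nzx nzs].
have [s0|ns0] := eqVneq s [::].
  by exists x; rewrite ?mem_head // => z; rewrite s0 inE => /eqP->; rewrite divff ?rpred1.
have [y sy miny] := IHs ns0 nzs; have nzy : y != 0 := allP nzs y sy.
have /orP[Rxy|Ryx] := Rtot (x / y).
  exists y; first by rewrite inE sy orbT.
  by move=> z; rewrite inE => /orP[/eqP->|/miny].
exists x; first exact: mem_head.
move=> z; rewrite inE => /orP[/eqP->|sz]; first by rewrite divff ?rpred1.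
have -> : z / x = z / y * (x / y)^-1 by field; rewrite nzx nzy.
by rewrite rpredM // miny.
Qed.

(** The valuation of R normalised by v(2) = 1: x^k and 2^(m - n) differ by a unit. Rational values
    suffice because [algC] is algebraic over Q. *)
Definition vrel (x : algC) (r : rat) := exists k n m,
  [/\ (0 < k)%N, unitR (x ^+ k * 2 ^+ n / 2 ^+ m) & r = (m%:R - n%:R) / k%:R].

(** The principle of the Newton polygon: in an integral equation of x two terms of different degree
    share the least valuation, and integers are powers of 2 up to units of R. *)
Lemma vrel_exists (x : algC) : x != 0 -> exists r, vrel x r.
Proof.
move=> nzx; have [q cont_q qx0] := int_primitive_poly x.
pose T (i : nat) : algC := (q`_i)%:~R * x ^+ i.
pose s := [seq T i | i <- iota 0 (size q) & q`_i != 0].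
have nzq : q != 0 by apply: contra_eq_neq cont_q => ->; rewrite zcontents0.
have sz_q : (0 < size q)%N by rewrite size_poly_gt0.
have s_n0 : s != [::].
  have : T (size q).-1 \in s.
    by apply: map_f; rewrite mem_filter mem_iota add0n prednK // leqnn -lead_coefE lead_coef_eq0 nzq.
  by case: (s).
have nzs : all (predC1 0) s.
  apply/allP=> y /mapP[i]; rewrite mem_filter => /andP[nzi _] -> /=.
  by rewrite mulf_neq0 ?intr_eq0 ?expf_neq0.
have [y /mapP[i0]] := valuation_min s_n0 nzs.
rewrite mem_filter mem_iota add0n => /and3P[nzi0 _ lt_i0] {y}-> min0.
have nzT0 : T i0 != 0 by rewrite mulf_neq0 ?intr_eq0 ?expf_neq0.
have RT i : T i / T i0 \in R.
  have [q0|nzi] := eqVneq q`_i 0; first by rewrite /T q0 !mul0r rpred0.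
  apply: min0; apply: map_f; rewrite mem_filter nzi mem_iota add0n /=.
  by rewrite ltnNge; apply: contra nzi => le_i; rewrite nth_default.
(* Otherwise all other terms, divided by the minimal one, would lie in the maximal ideal, while
   their sum is -1. *)
have [j nj Uj] : exists2 j, j != i0 & unitR (T j / T i0).
  apply: contrapT => noj.
  pose P z := z \in R /\ ~~ unitR z.
  have : P (\sum_(i < size q | i != Ordinal lt_i0) T i / T i0).
    apply: (big_ind P); rewrite /P.
    - by rewrite rpred0 /unitR eqxx.
    - by move=> u w [Ru Uu] [Rw Uw]; rewrite rpredD // maximal_idealD.
    - move=> i ni; split=> //; apply/negP => Ui; by apply: noj; exists (val i).
  have -> : \sum_(i < size q | i != Ordinal lt_i0) T i / T i0 = -1.
    apply/eqP; rewrite -addr_eq0 -(divff nzT0) addrC.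
    have : \sum_(i < size q) T i / T i0 = 0.
      rewrite -mulr_suml; have /eqP := qx0.
      rewrite horner_coef size_map_inj_poly ?rmorph0 //; last exact: intr_inj.
      by under eq_bigr do rewrite coef_map /=; move=> ->; rewrite mul0r.
    by rewrite (bigD1 (Ordinal lt_i0)) //= => ->.
  by case=> _; rewrite /unitR oppr_eq0 oner_eq0 invrN invr1 rpredN rpred1.
have nzj : q`_j != 0.
  apply/eqP => q0; case/and3P: Uj; by rewrite /T q0 !mul0r eqxx.
have [ei Ui] := int_unit nzi0; have [ej Uj'] := int_unit nzj.
have Ux : unitR (x ^+ j * 2 ^+ ej / (x ^+ i0 * 2 ^+ ei)).
  have -> : x ^+ j * 2 ^+ ej / (x ^+ i0 * 2 ^+ ei) =
      (T j / T i0) * (((q`_i0)%:~R / 2 ^+ ei) / ((q`_j)%:~R / 2 ^+ ej)).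
    rewrite /T; have := expf_neq0 i0 nzx; have := expf_neq0 j nzx.
    have := nz2X ei; have := nz2X ej.
    have : (q`_i0)%:~R != 0 :> algC by rewrite intr_eq0.
    have : (q`_j)%:~R != 0 :> algC by rewrite intr_eq0.
    move: (q`_j)%:~R (q`_i0)%:~R (x ^+ j) (x ^+ i0) (2 ^+ ei) (2 ^+ ej) => A B C D E F a b c d e f.
    by field; rewrite ?a ?b ?c ?d ?e ?f //.
  by apply: unitRM => //; apply: unitRM => //; apply: unitRV.
have [lt_ji|lt_ij|E] := ltngtP j i0; last by rewrite E eqxx in nj.
  exists ((ej%:R - ei%:R) / (i0 - j)%:R), (i0 - j)%N, ei, ej; split=> //; first by rewrite subn_gt0.
  rewrite (_ : _ / _ = (x ^+ j * 2 ^+ ej / (x ^+ i0 * 2 ^+ ei))^-1); first exact: unitRV.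
  have -> : x ^+ i0 = x ^+ (i0 - j) * x ^+ j by rewrite -exprD subnK // ltnW.
  have := expf_neq0 j nzx; have := expf_neq0 (i0 - j) nzx; have := nz2X ei; have := nz2X ej.
  move: (x ^+ j) (x ^+ (i0 - j)) (2 ^+ ei) (2 ^+ ej) => A B C D a b c d.
  by field; rewrite ?a ?b ?c ?d //.
exists ((ei%:R - ej%:R) / (j - i0)%:R), (j - i0)%N, ej, ei; split=> //; first by rewrite subn_gt0.
rewrite (_ : _ / _ = x ^+ j * 2 ^+ ej / (x ^+ i0 * 2 ^+ ei)) //.
have -> : x ^+ j = x ^+ (j - i0) * x ^+ i0 by rewrite -exprD subnK // ltnW.
have := expf_neq0 i0 nzx; have := expf_neq0 (j - i0) nzx; have := nz2X ei; have := nz2X ej.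
move: (x ^+ i0) (x ^+ (j - i0)) (2 ^+ ei) (2 ^+ ej) => A B C D a b c d.
by field; rewrite ?a ?b ?c ?d //.
Qed.

Lemma vrel_unique (x : algC) r r' : x != 0 -> vrel x r -> vrel x r' -> r = r'.
Proof.
move=> nzx [k [n [m [k_gt0 U ->]]]] [k' [n' [m' [k'_gt0 U' ->]]]].
have nzk : k%:R != 0 :> rat by rewrite pnatr_eq0 -lt0n.
have nzk' : k'%:R != 0 :> rat by rewrite pnatr_eq0 -lt0n.
have := unitRM (unitRX k' U) (unitRV (unitRX k U')).
rewrite (_ : _ * _ = 2 ^+ (n * k' + m' * k) / 2 ^+ (m * k' + n' * k)).
  move/two_power_unit => E.
  have {}E : n%:R * k'%:R + m'%:R * k%:R = m%:R * k'%:R + n'%:R * k%:R :> rat.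
    by rewrite -!natrM -!natrD E.
  apply: (mulIf nzk); apply: (mulIf nzk'); rewrite divfK // mulrAC divfK //.
  by move: E; move: (n%:R) (m%:R) (n'%:R) (m'%:R) (k%:R) (k'%:R) => A B C D k1 k2 E; lra.
have E1 : (x ^+ k * 2 ^+ n / 2 ^+ m) ^+ k' = x ^+ (k * k') * 2 ^+ (n * k') / 2 ^+ (m * k').
  by rewrite expr_div_n exprMn -!exprM.
have E2 : (x ^+ k' * 2 ^+ n' / 2 ^+ m') ^+ k = x ^+ (k * k') * 2 ^+ (n' * k) / 2 ^+ (m' * k).
  by rewrite expr_div_n exprMn -!exprM [(k' * k)%N]mulnC.
rewrite E1 E2 !exprD.
have := expf_neq0 (k * k')%N nzx; have := nz2X (n * k')%N; have := nz2X (m * k')%N.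
have := nz2X (n' * k)%N; have := nz2X (m' * k)%N.
move: (x ^+ _) (2 ^+ (n * k')) (2 ^+ (m * k')) (2 ^+ (n' * k)) (2 ^+ (m' * k)).
by move=> A B C D E a b c d e; field; rewrite ?a ?b ?c ?d ?e //.
Qed.

Definition v2 (x : algC) : rat := xget 0 [set r | vrel x r].

Lemma v2P (x : algC) : x != 0 -> vrel x (v2 x).
Proof. by move=> /vrel_exists ex; exact: (@xgetPex _ 0 [set r | vrel x r] ex). Qed.

Lemma v2E (x : algC) r : x != 0 -> vrel x r -> v2 x = r.
Proof. by move=> nzx; apply: vrel_unique (v2P nzx). Qed.

Lemma v2M (x y : algC) : x != 0 -> y != 0 -> v2 (x * y) = v2 x + v2 y.
Proof.
move=> nzx nzy; apply: v2E; first exact: mulf_neq0.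
have [k [n [m [k_gt0 U ->]]]] := v2P nzx; have [k' [n' [m' [k'_gt0 U' ->]]]] := v2P nzy.
exists (k * k')%N, (n * k' + n' * k)%N, (m * k' + m' * k)%N; split.
- by rewrite muln_gt0 k_gt0.
- rewrite (_ : _ / _ = (x ^+ k * 2 ^+ n / 2 ^+ m) ^+ k' * (y ^+ k' * 2 ^+ n' / 2 ^+ m') ^+ k).
    by apply: unitRM; apply: unitRX.
  rewrite !expr_div_n !exprMn -!exprM !exprD [(k' * k)%N]mulnC.
  have := nz2X (m * k')%N; have := nz2X (m' * k)%N.
  move: (x ^+ _) (y ^+ _) (2 ^+ (n * k')) (2 ^+ (m * k')) (2 ^+ (n' * k)) (2 ^+ (m' * k)).
  by move=> A B C D E F a b; field; rewrite ?a ?b //.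
have nzk : k%:R != 0 :> rat by rewrite pnatr_eq0 -lt0n.
have nzk' : k'%:R != 0 :> rat by rewrite pnatr_eq0 -lt0n.
by rewrite !natrD !natrM; field; rewrite nzk nzk'.
Qed.

Lemma v2_unit x : unitR x -> v2 x = 0.
Proof.
move=> Ux; apply: v2E; first by case/and3P: Ux.
by exists 1%N, 0%N, 0%N; rewrite expr1 !expr0 mulr1 divr1 subrr mul0r.
Qed.

Lemma v2_1 : v2 1 = 0.
Proof. by apply: v2_unit; rewrite /unitR oner_eq0 invr1 rpred1. Qed.

Lemma v2N x : v2 (- x) = v2 x.
Proof.
have [->|nzx] := eqVneq x 0; first by rewrite oppr0.
rewrite -mulN1r v2M ?oppr_eq0 ?oner_eq0 // v2_unit ?add0r //.
by rewrite /unitR oppr_eq0 oner_eq0 invrN invr1 rpredN rpred1.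
Qed.

Lemma v2V x : x != 0 -> v2 x^-1 = - v2 x.
Proof.
move=> nzx; have := v2M nzx (_ : x^-1 != 0); rewrite invr_eq0 divff // v2_1 => /(_ nzx).
by move=> /esym/eqP; rewrite addrC addr_eq0 => /eqP.
Qed.

Lemma v2X x n : x != 0 -> v2 (x ^+ n) = n%:R * v2 x.
Proof.
move=> nzx; elim: n => [|n IHn]; first by rewrite expr0 v2_1 mul0r.
by rewrite exprS v2M ?expf_neq0 // IHn mulrS mulrDl mul1r.
Qed.

Lemma v2_2 : v2 2 = 1.
Proof.
apply: v2E => //; exists 1%N, 0%N, 1%N; split; rewrite ?subr0 ?divr1 //.
by rewrite expr0 mulr1 expr1 divff // /unitR oner_eq0 invr1 rpred1.
Qed.

Lemma v2_prod (I : finType) (P : pred I) (F : I -> algC) : (forall i, P i -> F i != 0) ->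
  v2 (\prod_(i | P i) F i) = \sum_(i | P i) v2 (F i).
Proof.
move=> nzF; suff [] : \prod_(i | P i) F i != 0 /\
    v2 (\prod_(i | P i) F i) = \sum_(i | P i) v2 (F i) by [].
apply: (big_rec2 (fun x r => x != 0 /\ v2 x = r)); first by rewrite oner_eq0 v2_1.
by move=> i r x Pi [nzx <-]; rewrite mulf_neq0 ?nzF // v2M ?nzF.
Qed.

Lemma v2_ge0 x : x != 0 -> (0 <= v2 x) = (x \in R).
Proof.
move=> nzx; have [k [n [m [k_gt0 U ->]]]] := v2P nzx.
have k_gt0' : 0 < k%:R :> rat by rewrite ltr0n.
rewrite pmulr_lge0 ?invr_gt0 // subr_ge0 ler_nat; case/and3P: U => _ RU RU'.
apply/idP/idP => [le_nm|Rx].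
  apply: (R_expr k_gt0).
  have -> : x ^+ k = (x ^+ k * 2 ^+ n / 2 ^+ m) * 2 ^+ (m - n).
    have -> : 2 ^+ m = 2 ^+ (m - n) * 2 ^+ n :> algC by rewrite -exprD subnK.
    have := nz2X (m - n)%N; have := nz2X n; move: (2 ^+ (m - n)) (2 ^+ n) (x ^+ k).
    by move=> A B C a b; field; rewrite ?a ?b //.
  by rewrite rpredM // rpredX // rpred_nat.
rewrite leqNgt; apply/negP => lt_mn; case/negP: R2.
have -> : 2^-1 = (x ^+ k * 2 ^+ n / 2 ^+ m)^-1 * (x ^+ k * 2 ^+ (n - m.+1)).
  have -> : 2 ^+ n = 2 ^+ (n - m.+1) * (2 * 2 ^+ m) :> algC.
    by rewrite -exprS -exprD subnK.
  have := nz2X (n - m.+1)%N; have := nz2X m; have := expf_neq0 k nzx.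
  move: (2 ^+ (n - m.+1)) (2 ^+ m) (x ^+ k).
  by move=> A B C a b c; field; rewrite ?a ?b ?c //.
by rewrite rpredM // rpredM ?rpredX ?rpred_nat.
Qed.

(** The default [v2 0 = 0] is meaningless, so 0 is given infinite valuation by the first
    disjunct. *)
Definition vge (x : algC) (r : rat) := (x == 0) || (r <= v2 x).
Definition vgt (x : algC) (r : rat) := (x == 0) || (r < v2 x).

Lemma vgeR x : vge x 0 = (x \in R).
Proof.
by rewrite /vge; have [->|/v2_ge0 ->] := eqVneq x 0; rewrite ?rpred0.
Qed.

Lemma vge_le x r s : s <= r -> vge x r -> vge x s.
Proof. by move=> le_sr /orP[x0|le_r]; rewrite /vge ?x0 // (le_trans le_sr le_r) orbT. Qed.

Lemma vgt_ge x r s : s < r -> vge x r -> vgt x s.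
Proof. by move=> le_sr /orP[x0|le_r]; rewrite /vgt ?x0 // (lt_le_trans le_sr le_r) orbT. Qed.

Lemma vgtW x r : vgt x r -> vge x r.
Proof. by case/orP=> [x0|lt]; rewrite /vge ?x0 // ltW ?orbT. Qed.

Lemma vgeM x y r s : vge x r -> vge y s -> vge (x * y) (r + s).
Proof.
rewrite /vge mulf_eq0; have [//|nzx] := eqVneq x 0.
have [|nzy] := eqVneq y 0; first by rewrite orbT.
by rewrite /= v2M // => ? ?; rewrite lerD.
Qed.

Lemma vgtM x y r s : vgt x r -> vge y s -> vgt (x * y) (r + s).
Proof.
rewrite /vgt /vge mulf_eq0; have [//|nzx] := eqVneq x 0.
have [|nzy] := eqVneq y 0; first by rewrite orbT.
by rewrite /= v2M // => ? ?; rewrite ltr_leD.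
Qed.

Lemma v2_ratio x y : x != 0 -> y != 0 -> (y / x \in R) = (v2 x <= v2 y).
Proof.
move=> nzx nzy; rewrite -v2_ge0 ?mulf_neq0 ?invr_eq0 // v2M ?invr_eq0 // v2V //.
by rewrite subr_ge0.
Qed.

Lemma v2_add_ge x y : x != 0 -> vge y (v2 x) -> vge (x + y) (v2 x).
Proof.
move=> nzx; case/orP=> [/eqP->|le_xy]; first by rewrite addr0 /vge lexx orbT.
rewrite /vge; have [//|nz] := eqVneq (x + y) 0.
have [y0|nzy] := eqVneq y 0; first by rewrite y0 addr0 lexx orbT.
by rewrite /= -v2_ratio // mulrDl divff // rpredD ?rpred1 // v2_ratio.
Qed.

Lemma vgeD x y r : vge x r -> vge y r -> vge (x + y) r.
Proof.
have [->|nzx] := eqVneq x 0; first by rewrite add0r.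
have [->|nzy] := eqVneq y 0; first by rewrite addr0.
rewrite /vge (negPf nzx) (negPf nzy) /= => rx ry.
have [le|/ltW le] := leP (v2 x) (v2 y).
  by apply: (vge_le rx); apply: v2_add_ge => //; rewrite /vge le orbT.
by rewrite addrC; apply: (vge_le ry); apply: v2_add_ge => //; rewrite /vge le orbT.
Qed.

Lemma vgtN x r : vgt (- x) r = vgt x r.
Proof. by rewrite /vgt oppr_eq0 v2N. Qed.

Lemma vgtD x y r : vgt x r -> vgt y r -> vgt (x + y) r.
Proof.
have [->|nzx] := eqVneq x 0; first by rewrite add0r.
have [->|nzy] := eqVneq y 0; first by rewrite addr0.
rewrite /vgt (negPf nzx) (negPf nzy) /= => rx ry.
have [le|/ltW le] := leP (v2 x) (v2 y).
  by apply: (vgt_ge rx); apply: v2_add_ge => //; rewrite /vge le orbT.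
by rewrite addrC; apply: (vgt_ge ry); apply: v2_add_ge => //; rewrite /vge le orbT.
Qed.

Lemma vge_sum (I : finType) (P : pred I) (F : I -> algC) r :
  (forall i, P i -> vge (F i) r) -> vge (\sum_(i | P i) F i) r.
Proof.
by move=> gF; apply: (big_ind (fun x => vge x r)) => //; [rewrite /vge eqxx | move=> x y; apply: vgeD].
Qed.

Lemma v2_add_lt x y : x != 0 -> vgt y (v2 x) -> x + y != 0 /\ v2 (x + y) = v2 x.
Proof.
move=> nzx gt_y.
have nz : x + y != 0.
  apply: contraTneq gt_y => /eqP; rewrite addrC addr_eq0 => /eqP ->.
  by rewrite vgtN /vgt (negPf nzx) ltxx.
split=> //; apply/eqP; rewrite eq_le andbC.
have := v2_add_ge nzx (vgtW gt_y); rewrite /vge (negPf nz) /= => -> /=.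
rewrite leNgt; apply/negP => lt.
have : vgt (x + y - y) (v2 x).
  by apply: vgtD; [rewrite /vgt lt orbT | rewrite vgtN].
by rewrite addrK /vgt (negPf nzx) ltxx.
Qed.

Lemma vgt_mod (x y : algC) : vgt (x - y) 0 -> y \in R -> x \in R.
Proof. by move=> /vgtW; rewrite vgeR => Rxy Ry; rewrite -(subrK y x) rpredD. Qed.

Lemma v2_aut (F : divringClosed algC) (h : aut) x :
    (forall y, y \in F -> y \in R -> h y \in R) -> x \in F -> x != 0 ->
  v2 (h x) = v2 x.
Proof.
move=> hR Fx nzx; apply: v2E; first by rewrite fmorph_eq0.
have [k [n [m [k_gt0 U ->]]]] := v2P nzx; exists k, n, m; split=> //.
pose y := x ^+ k * 2 ^+ n / 2 ^+ m.
have Fy : y \in F.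
  by rewrite /y; apply: rpred_div; [apply: rpredM|]; apply: rpredX => //; apply: rpred_nat.
have -> : h x ^+ k * 2 ^+ n / 2 ^+ m = h y.
  by rewrite /y fmorph_div rmorphM !rmorphXn /= rmorph_nat.
case/and3P: U; rewrite -/y => nzy Ry Ry'; apply/and3P; split.
- by rewrite fmorph_eq0.
- exact: hR.
- by rewrite -fmorphV; apply: hR => //; rewrite rpredV.
Qed.

End TwoAdicValuation.

(** * Traces and inertia in the cyclotomic Z_2-tower *)

Lemma sum_autX_shift (h : aut) n x m : autX h n x = x ->
  \sum_(l < n) autX h l (autX h m x) = \sum_(l < n) autX h l x.
Proof.
move=> hn; elim: m => // m IHm; rewrite -{}IHm; set y := autX h m x.
have hy : autX h n y = y by rewrite /y -autXD addnC autXD hn.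
have -> : autX h m.+1 x = autX h 1 y by [].
under eq_bigr do rewrite -autXD addn1.
case: n hn hy => [|n] hn hy; first by rewrite !big_ord0.
by rewrite big_ord_recr [RHS]big_ord_recl hy /= addrC.
Qed.

(** * The automorphism z -> z^(f + 1) and its traces *)

Section CyclicTower.
Variables (f k : nat) (z : algC) (g : aut).
Hypotheses (dv4 : (4 %| f)%N) (prim_z : (f * 2 ^ k).-primitive_root z)
           (gz : g z = z ^+ f.+1).

(** Squaring 1 + f 2^r u replaces u by u + (f / 2) 2^r u^2, which stays odd because 4 divides f.
    Hence for r <= k the ratio of g^(2^r) z to z has exact order 2^(k - r). *)
Lemma succ_pow_two r : exists2 u, odd u & (f.+1 ^ (2 ^ r) = 1 + f * 2 ^ r * u)%N.
Proof.
have /dvdnP[d Df] := dv4.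
elim: r => [|r [u odd_u E]]; first by exists 1%N => //; rewrite expn0 expn1 !muln1.
exists (u + 2 * (d * 2 ^ r * u ^ 2))%N; first by rewrite oddD oddM addbF.
rewrite expnSr expnM E expnSr Df; move: (2 ^ r)%N => T; ring.
Qed.

Lemma tower_aut_pow r : exists2 u, odd u & forall j,
  autX g (2 ^ r) (z ^+ j) = z ^+ j * z ^+ (f * 2 ^ r * u * j).
Proof.
have [u odd_u E] := succ_pow_two r; exists u => // j.
rewrite rmorphXn /= (autX_expr _ gz) E -exprM -exprD; congr (z ^+ _); ring.
Qed.

Lemma tower_aut_fix r j : (2 ^ (k - r) %| j)%N -> autX g (2 ^ r) (z ^+ j) = z ^+ j.
Proof.
move=> dv_j; have [u _ ->] := tower_aut_pow r.
suff /eqP-> : z ^+ (f * 2 ^ r * u * j) == 1 by rewrite mulr1.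
rewrite -(prim_order_dvd prim_z) -!mulnA dvdn_pmul2l; last first.
  by have := prim_order_gt0 prim_z; rewrite muln_gt0 => /andP[].
have /dvdnP[i ->] := dv_j; rewrite mulnCA dvdn_mull // mulnCA dvdn_mull // -expnD.
by rewrite dvdn_exp2l // -leq_subLR.
Qed.

Lemma tower_aut_opp r i j : (r + i.+1 = k)%N -> odd j ->
  autX g (2 ^ r) (z ^+ (2 ^ i * j)) = - z ^+ (2 ^ i * j).
Proof.
move=> Dk odd_j; have [u odd_u ->] := tower_aut_pow r.
suff -> : z ^+ (f * 2 ^ r * u * (2 ^ i * j)) = -1 by rewrite mulrN1.
have f_gt0 : (0 < f)%N by have := prim_order_gt0 prim_z; rewrite muln_gt0 => /andP[].
have -> : (f * 2 ^ r * u * (2 ^ i * j) = f * 2 ^ (r + i) * (u * j))%N.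
  by rewrite expnD; ring.
have prim2 : 2.-primitive_root (z ^+ (f * 2 ^ (r + i))).
  have := dvdn_prim_root prim_z (_ : 2 %| f * 2 ^ k)%N.
  rewrite -Dk addnS expnSr mulnA mulnK //; apply; exact: dvdn_mull.
have -> : z ^+ (f * 2 ^ (r + i) * (u * j)) = z ^+ (f * 2 ^ (r + i)).
  rewrite exprM; apply/eqP; rewrite -[X in _ == X]expr1 (eq_prim_root_expr prim2).
  by rewrite modn2 oddM odd_u odd_j.
have /eqP := prim_expr_order prim2; rewrite sqrf_eq1.
by rewrite (negPf (prim_root_neq1 prim2 _)) //= => /eqP.
Qed.

Lemma tower_aut_order s y : (s <= k)%N -> autX (autX g (2 ^ (k - s))) (2 ^ s) y = autX g (2 ^ k) y.
Proof. by move=> le_sk; rewrite -autXM -expnD addnC subnK. Qed.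

(** If 2^s does not divide j, some power of the automorphism sends z^j to its opposite, so the sum
    equals its own opposite. *)
Lemma sum_tower_aut s j : (s <= k)%N ->
  \sum_(l < 2 ^ s) autX (autX g (2 ^ (k - s))) l (z ^+ j)
    = if (2 ^ s %| j)%N then (2 ^ s)%:R * z ^+ j else 0.
Proof.
move=> le_sk; set h := autX g _; case: ifPn => [dv_j|ndv_j].
  have hj : h (z ^+ j) = z ^+ j by apply: tower_aut_fix; rewrite subKn.
  under eq_bigr do rewrite autX_fix //.
  by rewrite sumr_const card_ord mulr_natl.
have j_gt0 : (0 < j)%N by case: j ndv_j => //; rewrite dvdn0.
have [j' co_j' Dj] := pfactor_coprime (isT : prime 2) j_gt0.
set i := logn 2 j in Dj.
have lt_is : (i < s)%N.
  by rewrite ltnNge; apply: contra ndv_j => le_si; rewrite Dj dvdn_mull // dvdn_exp2l.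
have hs : autX h (2 ^ s) (z ^+ j) = z ^+ j.
  rewrite tower_aut_order //; apply: tower_aut_fix; by rewrite subnn dvd1n.
have Ek : (k - s + (s - i.+1) + i.+1 = k)%N by rewrite -addnA subnK // subnK.
have hopp : autX h (2 ^ (s - i.+1)) (z ^+ j) = - z ^+ j.
  rewrite -autXM -expnD addnC Dj mulnC; apply: tower_aut_opp => //.
  by rewrite -coprime2n.
have := sum_autX_shift (2 ^ (s - i.+1)) hs; rewrite hopp.
under eq_bigr do rewrite rmorphN; rewrite sumrN => /eqP.
by rewrite eq_sym -addr_eq0 -mulr2n mulrn_eq0 /= => /eqP.
Qed.

Lemma sum_tower_expand (c : nat -> algC) n s : (s <= k)%N -> (forall j, g (c j) = c j) ->
  \sum_(l < 2 ^ s) autX (autX g (2 ^ (k - s))) l (\sum_(j < n) c j * z ^+ j)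
    = (2 ^ s)%:R * \sum_(j < n | (2 ^ s %| j)%N) c j * z ^+ j.
Proof.
move=> le_sk gc; under eq_bigr do rewrite rmorph_sum /=.
rewrite exchange_big /= mulr_sumr [RHS]big_mkcond /=; apply: eq_bigr => j _.
under eq_bigr => l _ do rewrite rmorphM /= (autX_fix l (autX_fix _ (gc j))).
rewrite -mulr_sumr sum_tower_aut //; case: ifP => _; last by rewrite mulr0.
by rewrite mulrCA.
Qed.

End CyclicTower.

(** Split z into [om] of odd order and [lam] of 2-power order. Over Q(om), unramified at 2, the
    powers of 1 - lam and hence those of lam are a basis integral at 2, and the trace of a power of
    lam is 0 or 2^k times that power. *)
Lemma rational_trace_integral f k z (g : aut) Y : (4 %| f)%N ->
    (f * 2 ^ k).-primitive_root z -> g z = z ^+ f.+1 -> Y \in adj Crat z -> Y \in Aint ->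
  exists2 S : nat, odd S & S%:R * (\sum_(l < 2 ^ k) autX g l Y) / (2 ^ k)%:R \in Aint.
Proof.
move=> dv4 prim_z gz QY ZY.
have f_gt0 : (0 < f)%N by have := prim_order_gt0 prim_z; rewrite muln_gt0 => /andP[].
have [f' co_f' Df] := pfactor_coprime (isT : prime 2) f_gt0.
set e := logn 2 f in Df.
have f'_gt0 : (0 < f')%N by move: f_gt0; rewrite Df muln_gt0 => /andP[].
have e_gt0 : (0 < e)%N.
  by rewrite -pfactor_dvdn // expn1 (dvdn_trans _ dv4).
pose M := (2 ^ (e + k))%N.
have DN : (f * 2 ^ k = f' * M)%N by rewrite /M expnD mulnA -Df.
rewrite {}DN in prim_z *; have zN := prim_expr_order prim_z.
have nzz : z != 0 by apply: unity_neq0 zN; apply: prim_order_gt0 prim_z.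
have M_gt0 : (0 < M)%N by rewrite expn_gt0.
pose om := z ^+ M; pose lam := z ^+ f'.
have om_f' : om ^+ f' = 1 by rewrite -exprM mulnC.
have prim_lam : M.-primitive_root lam.
  have := dvdn_prim_root prim_z (dvdn_mull f' (dvdnn M)).
  by rewrite mulnK.
have co_Mf' : coprime M f' by rewrite coprimeXl.
have Dek : (e + k = (e + k).-1.+1)%N by rewrite prednK // addn_gt0 e_gt0.
have FY : Y \in adj (adj Crat om) lam by apply: (adj_coprime_split co_Mf').
pose n := (2 ^ (e + k).-1)%N.
have n_gt0 : (0 < n)%N by rewrite expn_gt0.
have DM : (M = n * 2)%N by rewrite /M {1}Dek expnSr.
have lam_n : lam ^+ n = -1.
  have /eqP := prim_expr_order prim_lam; rewrite DM exprM sqrf_eq1.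
  by rewrite -(prim_order_dvd prim_lam) DM -{2}[n]muln1 dvdn_pmul2l //= => /eqP.
pose c (j : nat) : algC := - (j == 0%N)%:R.
have Fc j : c j \in adj Crat om by rewrite rpredN rpred_nat.
have [|p [Fp sz_p DY]] := @expand_below (adj Crat om) lam n c Y n_gt0 Fc _ FY.
  rewrite lam_n (bigD1 (Ordinal n_gt0)) //= expr0 mulr1 big1 ?addr0 // => j.
  by rewrite -val_eqE /= /c => /negPf ->; rewrite oppr0 mul0r.
have prim_lam' : (2 ^ (e + k).-1.+1).-primitive_root lam by rewrite -Dek.
have [lam2 twolam] := prim_root_two_ramified prim_lam'.
have Zlam := Aint_prim_root prim_lam.
have nz1 : 1 - lam != 0.
  rewrite subr_eq0 eq_sym (prim_root_neq1 prim_lam) // DM.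
  by apply: leq_trans (leq_pmull 2 n_gt0).
pose rX : {poly algC} := 1%:P - 'X.
have sz1 : size rX = 2%N by rewrite /rX -opprB size_polyN size_XsubC.
have rXK : rX \Po rX = 'X.
  by rewrite /rX comp_polyB comp_polyX comp_polyC opprB addrCA subrr addr0.
pose p1 := p \Po rX.
have Fp1 : p1 \is a polyOver (adj Crat om).
  by apply: polyOver_comp => //; rewrite rpredB ?polyOverX ?polyOverC ?rpred1.
have sz_p1 : (size p1 <= n)%N.
  rewrite (leq_trans (size_comp_poly_leq _ _)) // sz1 muln1.
  by case: (size p) sz_p.
have DY1 : Y = p1.[1 - lam].
  by rewrite horner_comp /rX !hornerE DY; congr _.[_]; ring.
(* The base field Q is generated by t = 0, with D = 1. *)
have unram x : x \in adj Crat om -> x \in Aint -> nilmod 2 x -> x / 2%:R \in Aint.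
  apply: (@unramified_away Crat 0 1 _ _ _ disc_multiple0 2 f') => //.
  - by move=> y; apply: adj_base.
  - by rewrite mul1n -prime_coprime.
have [||S odd_S ZS] := @coef_integral_away 2 (adj Crat om) (1 - lam) n isT
  unram _ nz1 n_gt0 lam2 twolam p1 Fp1 sz_p1.
- by rewrite rpredB ?Aint1.
- by rewrite -DY1.
exists S; first by rewrite -coprime2n prime_coprime.
(* The substitution X -> 1 - X is an involution over the integers, so integrality passes back from
   powers of 1 - lam to powers of lam. *)
have ZSp i : S%:R * p`_i \in Aint.
  have : S%:R *: p \is a polyOver Aint.
    have -> : S%:R *: p = (S%:R *: p1) \Po rX.
      by rewrite comp_polyZ /p1 -comp_polyA rXK comp_polyXr.
    apply: polyOver_comp; first by apply/polyOverP=> j; rewrite coefZ.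
    by rewrite rpredB ?polyOverX ?polyOverC ?rpred1.
  by move/polyOverP/(_ i); rewrite coefZ.
have nz2k : (2 ^ k)%:R != 0 :> algC by rewrite pnatr_eq0 -lt0n expn_gt0.
have g_om : {in adj Crat om, g =1 id}.
  apply: aut_adj_id => [y /aut_Crat//|].
  rewrite /om rmorphXn /= gz -exprM mulSn exprD Df.
  have -> : (f' * 2 ^ e * M = f' * M * 2 ^ e)%N by rewrite mulnAC.
  by rewrite exprM zN expr1n mulr1.
rewrite DY horner_coef.
have -> : \sum_(l < 2 ^ k) autX g l (\sum_(i < size p) p`_i * lam ^+ i)
    = \sum_(i < size p) p`_i * (if (2 ^ k %| f' * i)%N then (2 ^ k)%:R * lam ^+ i else 0).
  under eq_bigr do rewrite rmorph_sum /=.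
  rewrite exchange_big /=; apply: eq_bigr => i _.
  under eq_bigr => l _ do rewrite rmorphM /= (autX_fix l (g_om _ (polyOverP Fp _))).
  rewrite -mulr_sumr; congr (_ * _); rewrite /lam -exprM.
  have prim_zk : (f * 2 ^ k).-primitive_root z by rewrite Df -mulnA -expnD.
  have := sum_tower_aut dv4 prim_zk gz (f' * i) (leqnn k); rewrite subnn expn0.
  by under eq_bigr do rewrite -autXM muln1.
rewrite mulr_sumr mulr_suml rpred_sum // => i _; rewrite mulrA.
case: ifP => _; last by rewrite mulr0 mul0r Aint0.
by rewrite [(2 ^ k)%:R * _]mulrC mulrA mulfK //; apply: rpredM => //; apply: rpredX.
Qed.

(** Multiplication by z^(N - j) moves c_j to the exponent N, where z^N = 1. It is the only surviving
    term of the trace, which [rational_trace_integral] controls; [d] lists the shifted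
    coefficients. *)
Lemma rational_coef_integral f k z (c : nat -> algC) : (4 %| f)%N ->
    (f * 2 ^ k).-primitive_root z -> (forall j, c j \in adj Crat (z ^+ (2 ^ k))) ->
    \sum_(j < 2 ^ k) c j * z ^+ j \in Aint ->
  forall j, (j < 2 ^ k)%N -> exists2 S : nat, odd S & S%:R * c j \in Aint.
Proof.
move=> dv4 prim_z Fc ZY j lt_j; set Y := \sum_(j < _) _ in ZY.
have [g Dg] : exists g : aut, g z = z ^+ f.+1.
  have co : coprime f.+1 (f * 2 ^ k).
    rewrite coprimeMr coprimeSn coprimeXr // coprime_sym coprime2n /=.
    by have /dvdnP[d ->] := dv4; rewrite oddM andbF.
  by have [nu Dnu] := Qn_aut_exists co; exists nu; rewrite Dnu // prim_expr_order.
have zN := prim_expr_order prim_z; set N := (f * 2 ^ k)%N in zN.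
have le_jN : (j <= N)%N.
  apply: (leq_trans (ltnW lt_j)); rewrite leq_pmull //.
  by have := prim_order_gt0 prim_z; rewrite muln_gt0 => /andP[].
have Zz := Aint_prim_root prim_z.
pose d i := if (i < N - j)%N then 0 else if (i < N - j + 2 ^ k)%N then c (i - (N - j))%N else 0.
have Fd i : d i \in adj Crat (z ^+ (2 ^ k)).
  by rewrite /d; case: ifP => _; [apply: rpred0 | case: ifP => _ //; apply: rpred0].
have gd i : g (d i) = d i.
  apply: (@aut_adj_id Crat (z ^+ (2 ^ k)) g) => [y /aut_Crat//||//].
  rewrite rmorphXn /= Dg -exprM mulSn exprD -/N.
  by rewrite zN mulr1.
have EY : z ^+ (N - j) * Y = \sum_(i < N - j + 2 ^ k) d i * z ^+ i.
  rewrite big_split_ord /= big1 ?add0r => [|i _]; last by rewrite /d ltn_ord mul0r.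
  rewrite mulr_sumr; apply: eq_bigr => i _.
  by rewrite /d ltnNge leq_addr /= ltn_add2l ltn_ord addKn exprD mulrCA.
have QY : z ^+ (N - j) * Y \in adj Crat z.
  rewrite EY; apply: rpred_sum => i _; apply: rpredM; last by apply: rpredX; apply: adj_gen.
  exact: adj_expr (Fd i).
have [|S odd_S ZS] := rational_trace_integral dv4 prim_z Dg QY; first by rewrite rpredM ?rpredX.
exists S => //; suff <- : (\sum_(l < 2 ^ k) autX g l (z ^+ (N - j) * Y)) / (2 ^ k)%:R = c j.
  by rewrite mulrA.
have nz2k : (2 ^ k)%:R != 0 :> algC by rewrite pnatr_eq0 -lt0n expn_gt0.
have := sum_tower_expand dv4 prim_z Dg (N - j + 2 ^ k) (leqnn k) gd.
rewrite subnn expn0 -EY; under eq_bigr do rewrite -autXM muln1.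
move=> ->; rewrite mulrC mulKf //.
have T_gt0 : (0 < 2 ^ k)%N by rewrite expn_gt0.
have lt_N : (N < N - j + 2 ^ k)%N by rewrite -ltn_subLR ?leq_subr // subKn.
have dvN : (2 ^ k %| N)%N by rewrite dvdn_mull.
rewrite (bigD1 (Ordinal lt_N)) //= zN mulr1 big1 ?addr0; last first.
  move=> i /andP[dv_i ni]; suff -> : d i = 0 by rewrite mul0r.
  rewrite /d; case: ltnP => // le_i; case: ltnP => // lt_i; case/eqP: ni.
  apply: val_inj => /=.
  have /dvdnP[u Eu] := dv_i; have /dvdnP[v Ev] := dvN.
  have lt1 : (i < N + 2 ^ k)%N by rewrite (leq_trans lt_i) // leq_add2r leq_subr.
  have lt2 : (N < i + 2 ^ k)%N by rewrite (leq_trans lt_N) // leq_add2r.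
  rewrite Eu Ev -mulSnr ltn_pmul2r // ltnS in lt1.
  rewrite Eu Ev -mulSnr ltn_pmul2r // ltnS in lt2.
  by rewrite Eu Ev (anti_leq (introT andP (conj lt1 lt2))).
by rewrite /d ltnNge leq_subr /= lt_N subKn.
Qed.

(** * Tate's bound over K *)

Section TateBound.
Variables (K : divringClosed algC) (t : algC) (D f : nat) (R : subringClosed algC).
Hypotheses (Kt : t \in K) (Zt : t \in Aint) (sKt : {subset K <= adj Crat t})
  (discD : disc_multiple t D) (ind : cyclo_indep K f) (dv4 : (4 %| f)%N)
  (R2 : 2^-1 \notin R) (Rtot : forall x, (x \in R) || (x^-1 \in R)).

(* Tate's bound: the normalized traces down the cyclotomic Z_2-tower are
   bounded at the primes above 2, uniformly in the level. *)
Lemma tower_coef_bound k z (c : nat -> algC) : (f * 2 ^ k).-primitive_root z ->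
    (forall j, c j \in adj K (z ^+ (2 ^ k))) -> \sum_(j < 2 ^ k) c j * z ^+ j \in Aint ->
  forall j, (j < 2 ^ k)%N -> D%:R * c j \in R.
Proof.
move=> prim_z Fc; set x := \sum_(j < _) _ => Zx j lt_j.
have f_gt0 : (0 < f)%N by have := prim_order_gt0 prim_z; rewrite muln_gt0 => /andP[].
pose zf := z ^+ (2 ^ k).
have zf_f : zf ^+ f = 1 by rewrite -exprM mulnC prim_expr_order.
have DNf : (f * 2 ^ k %/ f = 2 ^ k)%N by rewrite mulKn.
have [l Fl sFl] := adj_simple zf Kt sKt.
have [n [E [injE surE]]] := embeddings_exist l.
have agree i (mu : aut) : E i l = mu l -> {in adj K zf, E i =1 mu}.
  move=> Eil y /sFl; apply: aut_adj => // w Qw.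
  by rewrite !aut_Crat.
have [i0 Di0] := surE idfun.
have E0 y : y \in adj K zf -> E i0 y = y by apply: (agree i0 idfun Di0).
have Fz := adj_gen K zf; have Ft := adj_base zf Kt.
pose P := [pred i | E i zf == zf].
(* An embedding of K(zf) that fixes zf is adjusted by an automorphism over K so as to fix z as well;
   it then acts on x through the coefficients alone. *)
have ex_nu i : exists nu : aut, P i -> {in adj K zf, nu =1 E i} /\ nu z = z.
  case Pi : (P i); last by exists idfun.
  have fix_zf : (algC_invaut (E i) : aut) zf = zf.
    by apply: (fmorph_inj (E i)); rewrite algC_invautK (eqP Pi).
  have [||tau tauK tauz] := ind prim_z (nu := algC_invaut (E i)); first exact: dvdn_mulr.
    by rewrite DNf.
  exists (E i \o tau : aut) => _; split; last by rewrite /= tauz algC_invautK.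
  apply: aut_adj => [y /tauK /= -> //|/=].
  by rewrite /zf rmorphXn /= tauz -rmorphXn /= fix_zf.
have [nu Dnu] := fin_all_exists ex_nu.
(* Traces over Q(zf) reduce to the case of Q: the cc_i are the coefficients of the trace of t^m x
   and lie in Q(zf). Cramer's argument recovers c_j from them at the cost of D. *)
pose cc m i := \sum_(e | P e) E e (t ^+ m * c i).
have Ecc m : \sum_(e | P e) nu e (t ^+ m * x) = \sum_(i < 2 ^ k) cc m i * z ^+ i.
  rewrite (eq_bigr (fun e => \sum_(i < 2 ^ k) E e (t ^+ m * c i) * z ^+ i)); last first.
    move=> e Pe; have [nuE nuz] := Dnu e Pe.
    rewrite mulr_sumr rmorph_sum /=; apply: eq_bigr => i _.
    rewrite mulrA rmorphM rmorphXn /= nuz nuE //.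
    by apply: rpredM; [apply: rpredX | apply: Fc].
  rewrite exchange_big /=; apply: eq_bigr => i _.
  by rewrite mulr_suml.
have Zcc m : \sum_(i < 2 ^ k) cc m i * z ^+ i \in Aint.
  by rewrite -Ecc rpred_sum // => e _; rewrite Aint_aut rpredM ?rpredX.
have Qcc m i : cc m i \in adj Crat zf.
  have nzf : f%:R != 0 :> algC by rewrite pnatr_eq0 -lt0n.
  rewrite -[cc m i](mulKf nzf); apply: rpredM; first by rewrite rpredV rpred_nat.
  rewrite (trace_fixing _ f_gt0 zf_f); apply: rpred_sum => e _.
  apply: rpredM; last by apply: rpredX; apply: adj_gen.
  apply: adj_base; apply: (trace_Crat injE surE); apply: sFl.
  apply: rpredM; last by apply: rpredX; rewrite rpredV; apply: adj_gen.
  by apply: rpredM; [apply: rpredX | apply: Fc].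
have Rcc m : cc m j \in R.
  have [S odd_S ZS] := rational_coef_integral dv4 prim_z (Qcc m) (Zcc m) lt_j.
  have /and3P[nzS RS RS'] := odd_unit R2 Rtot odd_S.
  by rewrite -(mulKf nzS (cc m j)); apply: rpredM => //; apply: (R_Aint Rtot).
have Pi0 : P i0 by rewrite inE E0.
have [||Z ZZ ->] := discD (P := P) (s := fun i => E i t) Pi0.
- move=> i i'; rewrite !inE => /eqP Ei /eqP Ei' Eii; apply: injE => /=.
  apply: (@aut_adj K zf) => //; last by rewrite Ei.
  move=> y /sKt; apply: aut_adj => // w Qw.
  by rewrite !aut_Crat.
- by move=> i _; exists (E i).
rewrite -mulrA; apply: rpredM; first exact: (R_Aint Rtot).
have := @cramer_power_sums (fun y => y \in R) _ P (fun i => E i t) (fun i => E i (c j))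
  _ _ _ _ _ i0 Pi0.
rewrite (E0 (c j)) //; apply.
- exact: rpred0.
- by move=> u v Ru Rv; rewrite rpredD.
- by move=> u v Zu Rv; apply: rpredM => //; apply: (R_Aint Rtot).
- by move=> i _; rewrite Aint_aut.
- by move=> m; under eq_bigr do rewrite -rmorphXn -rmorphM /=; apply: Rcc.
Qed.

End TateBound.

(** * Congruences modulo the maximal ideal of R *)

Section ResidueField.
Variable R : subringClosed algC.
Hypotheses (R2 : 2^-1 \notin R) (Rtot : forall x, (x \in R) || (x^-1 \in R)).
Local Notation v2 := (v2 R).
Local Notation vge := (vge R).
Local Notation vgt := (vgt R).

Lemma vgt1 : ~~ vgt 1 0.
Proof. by rewrite /vgt oner_eq0 v2_1 // ltxx. Qed.

Lemma vgtR x : vgt x 0 -> x \in R.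
Proof. by move/vgtW; rewrite vgeR. Qed.

Lemma vgt0M x y : vgt x 0 -> y \in R -> vgt (x * y) 0.
Proof. by move=> mx Ry; rewrite -(addr0 0); apply: vgtM => //; rewrite vgeR. Qed.

Lemma vgt0_prime x y : x \in R -> y \in R -> vgt (x * y) 0 -> vgt x 0 \/ vgt y 0.
Proof.
rewrite /vgt mulf_eq0; have [_ _ _ _|nzx] := eqVneq x 0; first by left.
have [_ _ _ _|nzy] := eqVneq y 0; first by right.
rewrite /= -!(v2_ge0 R2 Rtot) // v2M // => vx vy v_gt0.
by case: (ltP 0 (v2 x)) => [|vx0]; [left | right; lra].
Qed.

Lemma vgt0B x y : vgt x 0 -> vgt y 0 -> vgt (x - y) 0.
Proof. by move=> mx my; apply: vgtD => //; rewrite vgtN. Qed.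

Lemma vgt0_trans x y z : vgt (x - y) 0 -> vgt (y - z) 0 -> vgt (x - z) 0.
Proof. by move=> m1 m2; rewrite (_ : x - z = (x - y) + (y - z)); [apply: vgtD | ring]. Qed.

Lemma vgt0_sym x y : vgt (x - y) 0 = vgt (y - x) 0.
Proof. by rewrite -vgtN // opprB. Qed.

Lemma unit_val0 x : x \in R -> ~~ vgt x 0 -> x != 0 /\ v2 x = 0.
Proof.
rewrite /vgt; have [//|nzx] := eqVneq x 0; rewrite -(v2_ge0 R2 Rtot) //= -leNgt => ge0 le0.
by split=> //; apply/eqP; rewrite eq_le le0.
Qed.

Lemma unit_inv x : x \in R -> ~~ vgt x 0 -> x^-1 \in R.
Proof.
move=> Rx nmx; have [nzx v0] := unit_val0 Rx nmx.
by rewrite -(v2_ge0 R2 Rtot) ?invr_eq0 // v2V // v0 oppr0.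
Qed.

(** Dedekind's independence of characters with values in the residue field: the relation at y x
    minus h_n(y) times the relation at x eliminates the last term. *)
Lemma dedekind_mod (O : {pred algC}) n (h : nat -> aut) (c : nat -> algC) :
    1 \in O -> {in O &, forall x y, x * y \in O} ->
    (forall i x, x \in O -> h i x \in R) ->
    (forall i j, (i < j < n)%N -> exists2 x, x \in O & ~~ vgt (h i x - h j x) 0) ->
    (forall i, (i < n)%N -> c i \in R) ->
    (forall x, x \in O -> vgt (\sum_(i < n) c i * h i x) 0) ->
  forall i, (i < n)%N -> vgt (c i) 0.
Proof.
move=> O1 OM Rh; elim: n c => // n IHn c dist Rc rel.
have small i : (i < n)%N -> vgt (c i) 0.
  move=> lt_i; have [|y Oy ny] := dist i n; first by rewrite lt_i ltnSn.
  have vc : vgt (c i * (h i y - h n y)) 0.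
    apply: (IHn (fun j => c j * (h j y - h n y))) lt_i.
    - by move=> a b /andP[lt_ab lt_b]; apply: dist; rewrite lt_ab leqW.
    - by move=> j lt_j; apply: rpredM; [apply: Rc; rewrite leqW | apply: rpredB; apply: Rh].
    - move=> x Ox.
      have -> : \sum_(j < n) c j * (h j y - h n y) * h j x
          = \sum_(j < n.+1) c j * h j (y * x) - h n y * \sum_(j < n.+1) c j * h j x.
        rewrite mulr_sumr -sumrB big_ord_recr /= rmorphM /=.
        rewrite (_ : _ - h n y * _ = 0) ?addr0; last by ring.
        by apply: eq_bigr => j _; rewrite rmorphM /=; ring.
      apply: vgt0B; first by apply: rel; apply: OM.
      by rewrite mulrC; apply: vgt0M; [apply: rel | apply: Rh].
  have Rci : c i \in R by apply: Rc; rewrite leqW.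
  have Rhi : h i y - h n y \in R by apply: rpredB; apply: Rh.
  by have [//|mh] := vgt0_prime Rci Rhi vc; rewrite mh in ny.
move=> i; rewrite ltnS leq_eqVlt => /orP[/eqP->|/small//].
have := rel 1 O1; rewrite big_ord_recr /= rmorph1 mulr1 => m1.
have -> : c n = (\sum_(j < n) c j * h j 1 + c n) - \sum_(j < n) c j * h j 1.
  by rewrite addrC addKr.
apply: vgt0B => //; apply: (big_ind (fun x => vgt x 0)).
- by rewrite /vgt eqxx.
- by move=> x y; apply: vgtD.
- by move=> j _; apply: vgt0M; [apply: small | apply: Rh].
Qed.

(** In a relation d0 + d1 x = 1 with coprime denominators, d0 and d1 cannot both be in the maximal
    ideal; either unit can serve as denominator. *)
Lemma local_fraction x : x \in R -> exists o d,
  [/\ o \in adj Crat x, d \in adj Crat x, o \in Aint, d \in Aint & ~~ vgt d 0 /\ x = o / d].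
Proof.
move=> Rx; have [d0 [d1 [Q0 Q1 [Z0 Z0x Z1 Z1x] E]]] := denominators_coprime x.
have Qx := adj_gen Crat x.
have [m0|nm0] := boolP (vgt d0 0); last first.
  have [nz _] := unit_val0 (R_Aint Rtot Z0) nm0.
  exists (d0 * x), d0; split=> //; first exact: rpredM.
  by split=> //; rewrite mulrC mulKf.
have [m1|nm1] := boolP (vgt d1 0).
  by have := vgt1; rewrite -E vgtD // vgt0M.
have [nz _] := unit_val0 (R_Aint Rtot Z1) nm1.
exists (d1 * x), d1; split=> //; first exact: rpredM.
by split=> //; rewrite mulrC mulKf.
Qed.

Lemma inertia_local (F : divringClosed algC) (h : aut) :
    (forall x, x \in F -> x \in Aint -> vgt (h x - x) 0) ->
  forall x, x \in F -> x \in R -> vgt (h x - x) 0.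
Proof.
move=> hZ x Fx Rx; have [o [d [Qo Qd Zo Zd [nmd Dx]]]] := local_fraction Rx.
have sF : {subset adj Crat x <= F} by apply: sub_adj => // y; apply: rpred_Crat.
have mo := hZ o (sF _ Qo) Zo; have md := hZ d (sF _ Qd) Zd.
have Rd := R_Aint Rtot Zd; have Ro := R_Aint Rtot Zo.
have Rhd : h d \in R by apply: (vgt_mod R2 Rtot md).
have nmhd : ~~ vgt (h d) 0.
  apply: contra nmd => mhd; rewrite (_ : d = h d - (h d - d)); first exact: vgt0B.
  by rewrite opprB addrCA subrr addr0.
have [nzd _] := unit_val0 Rd nmd; have [nzhd _] := unit_val0 Rhd nmhd.
have -> : h x - x = ((h o - o) * d - (h d - d) * o) * (d^-1 * (h d)^-1).
  by rewrite Dx fmorph_div /=; field; rewrite nzd nzhd.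
apply: vgt0M; first by apply: vgt0B; apply: vgt0M.
by apply: rpredM; apply: unit_inv.
Qed.

End ResidueField.

Lemma addn_sub_swap i j T : (i <= j)%N -> (i <= T)%N -> (j + (T - i) = j - i + T)%N.
Proof. by lia. Qed.

Lemma prod_autX_shift (h : aut) n x : autX h n x = x ->
  h (\prod_(l < n) autX h l x) = \prod_(l < n) autX h l x.
Proof.
case: n => [|n] hx; first by rewrite !big_ord0 rmorph1.
rewrite rmorph_prod /= big_ord_recr [RHS]big_ord_recl /= mulrC; congr (_ * _).
exact: hx.
Qed.

(** * The inertia group of the tower above 2 *)

Section TowerInertia.
Variables (K : divringClosed algC) (t : algC) (D f C : nat) (R : subringClosed algC).
Hypotheses (Kt : t \in K) (Zt : t \in Aint) (sKt : {subset K <= adj Crat t})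
  (discD : disc_multiple t D) (D_gt0 : (0 < D)%N) (ind : cyclo_indep K f)
  (dv4 : (4 %| f)%N)
  (R2 : 2^-1 \notin R) (Rtot : forall x, (x \in R) || (x^-1 \in R))
  (DC : v2 R D%:R <= C%:R).
Local Notation v2 := (v2 R).
Local Notation vge := (vge R).
Local Notation vgt := (vgt R).

Section Level.
Variables (k : nat) (z : algC) (g : aut).
Hypotheses (prim_z : (f * 2 ^ k).-primitive_root z) (gK : {in K, g =1 id})
           (gz : g z = z ^+ f.+1).

Lemma tower_base_fix : {in adj K (z ^+ (2 ^ k)), g =1 id}.
Proof.
apply: aut_adj_id => //.
rewrite rmorphXn /= gz -exprM mulSn exprD.
by rewrite (prim_expr_order prim_z) mulr1.
Qed.

Lemma tower_stable m x : x \in adj K z -> autX g m x \in adj K z.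
Proof.
apply: aut_adj_stable => [y Ky|]; first by apply: autX_fix; apply: gK.
by rewrite (autX_expr _ gz); apply: rpredX; apply: adj_gen.
Qed.

Lemma tower_order x : x \in adj K z -> autX g (2 ^ k) x = x.
Proof.
apply: aut_adj_id => [y Ky|]; first by apply: autX_fix; apply: gK.
by have := @tower_aut_fix f k z g dv4 prim_z gz k 1; rewrite subnn expn0 dvd1n expr1; apply.
Qed.

Lemma tower_level_fix r x : x \in adj K (z ^+ (2 ^ (k - r))) -> autX g (2 ^ r) x = x.
Proof.
apply: aut_adj_id => [y Ky|]; first by apply: autX_fix; apply: gK.
by apply: (@tower_aut_fix f k z g dv4 prim_z gz r).
Qed.

Lemma tower_fixed s x : (s <= k)%N -> x \in adj K z -> autX g (2 ^ s) x = x ->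
  x \in adj K (z ^+ (2 ^ (k - s))).
Proof.
move=> le_sk Fx gx; have [c Fc Dx] := adj_expand (expn_gt0 2 k) Fx.
have gc j : g (c j) = c j by apply: tower_base_fix.
have := sum_tower_expand dv4 prim_z gz (2 ^ k) (leq_subr s k) gc.
rewrite -Dx subKn //; under eq_bigr => l _ do rewrite (autX_fix l gx).
rewrite sumr_const card_ord -[x *+ _]mulr_natl => /mulfI -> //; last first.
  by rewrite pnatr_eq0 -lt0n expn_gt0.
apply: rpred_sum => j dv_j; apply: rpredM; last first.
  by have /dvdnP[i ->] := dv_j; rewrite mulnC exprM; apply: rpredX; apply: adj_gen.
have -> : (k - s = k - (k - (k - s)))%N by rewrite subKn // leq_subr.
have Ez : z ^+ (2 ^ k) = (z ^+ (2 ^ (k - s))) ^+ (2 ^ s).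
  by rewrite -exprM -expnD subnK.
by rewrite subKn ?leq_subr //; apply: (@adj_expr _ _ (2 ^ s)); rewrite -Ez.
Qed.

(** The trace multiplies the surviving coefficients by 2^s, of valuation s, and by
    [tower_coef_bound] their valuations are at least - v(D). *)
Lemma tower_trace_bound s x : (s <= k)%N -> x \in adj K z -> x \in Aint ->
  vge (\sum_(l < 2 ^ s) autX (autX g (2 ^ (k - s))) l x) (s%:R - C%:R).
Proof.
move=> le_sk Fx Zx; have [c Fc Dx] := adj_expand (expn_gt0 2 k) Fx.
have gc j : g (c j) = c j by apply: tower_base_fix.
rewrite Dx (sum_tower_expand dv4 prim_z gz) //.
apply: (vgeM R2 Rtot).
  rewrite /vge natrX expf_eq0 pnatr_eq0 andbF v2X ?pnatr_eq0 // v2_2 // mulr1.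
  by rewrite lexx.
apply: vge_sum => // j _; rewrite -[- _]addr0; apply: (vgeM R2 Rtot); last first.
  by rewrite vgeR // (R_Aint Rtot) // rpredX // (Aint_prim_root prim_z).
have nzD : D%:R != 0 :> algC by rewrite pnatr_eq0 -lt0n.
have := tower_coef_bound Kt Zt sKt discD ind dv4 R2 Rtot prim_z Fc _ (ltn_ord j).
rewrite -Dx => /(_ Zx); rewrite -(vgeR R2 Rtot) /vge mulf_eq0 (negPf nzD) /=.
have [//|nzc] := eqVneq (c j) 0; rewrite /= v2M // => ge0.
apply: (@le_trans _ _ (- v2 D%:R)); first by rewrite lerN2.
by rewrite -subr_ge0 opprK addrC.
Qed.

(** Over s = C + 1 layers every trace of an integer is in the maximal ideal, so the 2^s powers of h
    are linearly dependent modulo it. By Dedekind two of them coincide modulo it, and a nontrivial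
    power of h is in the inertia group. The involution [autX g (2 ^ k.-1)] is a power of that
    element, the group being cyclic of 2-power order. *)
Lemma inertia_top : (C < k)%N -> forall x, x \in adj K z -> x \in Aint ->
  vgt (autX g (2 ^ k.-1) x - x) 0.
Proof.
move=> lt_Ck; pose s := C.+1; pose h := autX g (2 ^ (k - s)).
pose O := [pred x | (x \in adj K z) && (x \in Aint)].
have hO l x : x \in O -> autX h l x \in O.
  case/andP=> Fx Zx; rewrite inE Aint_aut Zx andbT.
  by rewrite -autXM; apply: tower_stable.
have h_order x : x \in O -> autX h (2 ^ s) x = x.
  by case/andP=> Fx _; rewrite -autXM -expnD subnKC // tower_order.
have [i [j [lt_ij coinc]]] : exists i j, (i < j < 2 ^ s)%N /\
    forall x, x \in O -> vgt (autX h i x - autX h j x) 0.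
  apply: contrapT => no_ij.
  pose c1 (i : nat) : algC := 1.
  suff m1 : forall i, (i < 2 ^ s)%N -> vgt (c1 i) 0.
    by have := m1 0%N (expn_gt0 _ _); apply/negP: (vgt1 R2 Rtot).
  apply: (@dedekind_mod R R2 Rtot O (2 ^ s) (autX h)).
  - by rewrite inE rpred1 Aint1.
  - by move=> x y /andP[Fx Zx] /andP[Fy Zy]; rewrite inE; apply/andP; split; apply: rpredM.
  - by move=> l x /(hO l)/andP[_ /(R_Aint Rtot)].
  - move=> i j lt_ij; apply: contrapT => no_x; apply: no_ij; exists i, j; split=> // x Ox.
    by apply: contrapT => /negP nm; apply: no_x; exists x.
  - by move=> i _; apply: rpred1.
  - move=> x /andP[Fx Zx]; under eq_bigr do rewrite mul1r.
    apply: (vgt_ge _ (tower_trace_bound lt_Ck Fx Zx)).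
    by rewrite subr_gt0 ltr_nat.
case/andP: lt_ij => lt_ij lt_j.
pose m := (j - i)%N.
have m_gt0 : (0 < m)%N by rewrite subn_gt0.
have lt_m : (m < 2 ^ s)%N by apply: leq_ltn_trans lt_j; rewrite leq_subr.
have hm x : x \in O -> vgt (autX h m x - x) 0.
  move=> Ox; have Oy := hO (2 ^ s - i)%N x Ox.
  have := coinc _ Oy; rewrite -!autXD.
  have -> : (i + (2 ^ s - i) = 2 ^ s)%N by rewrite subnKC // ltnW // (ltn_trans lt_ij).
  have -> : (j + (2 ^ s - i) = m + 2 ^ s)%N.
    by apply: addn_sub_swap; [apply: ltnW | apply: ltnW; apply: ltn_trans lt_j].
  by rewrite autXD !h_order // vgt0_sym.
have hmX a x : x \in O -> vgt (autX h (a * m) x - x) 0.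
  move=> Ox; elim: a => [|a IHa]; first by rewrite mul0n subrr /vgt eqxx.
  rewrite mulSn autXD; apply: (vgt0_trans R2 Rtot _ IHa).
  exact/hm/hO.
have [u co_u Dm] := pfactor_coprime (isT : prime 2) m_gt0.
set r := logn 2 m in Dm.
have lt_rs : (r < s)%N.
  rewrite -(ltn_exp2l _ _ (isT : 1 < 2)%N); apply: leq_ltn_trans lt_m.
  rewrite Dm leq_pmull // lt0n; apply: contraTneq m_gt0 => u0.
  by rewrite Dm u0 mul0n.
move=> x Fx Zx; have Ox : x \in O by rewrite inE Fx.
(* With m = 2^r u and u odd, this power of h^m is the u-th power of the involution, hence the
   involution. *)
have := hmX (2 ^ (s.-1 - r))%N x Ox.
have -> : (2 ^ (s.-1 - r) * m = u * 2 ^ s.-1)%N.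
  by rewrite Dm mulnCA -expnD subnK.
rewrite autXM.
have tau_x y : autX h (2 ^ s.-1) y = autX g (2 ^ k.-1) y.
  by rewrite -autXM -expnD /s /= -{2}(subnK lt_Ck) addnS /= addnC.
have tau2 y : y \in O -> autX h (2 ^ s.-1) (autX h (2 ^ s.-1) y) = y.
  by move=> Oy; rewrite -autXD addnn -mul2n -expnS h_order.
have odd_u : odd u by rewrite -coprime2n.
have tau_u n y : y \in O -> autX (autX h (2 ^ s.-1)) n y = if odd n then autX h (2 ^ s.-1) y else y.
  move=> Oy; elim: n => // n IHn; rewrite autXS IHn /=.
  by case: (odd n) => //=; apply: tau2.
by rewrite tau_u // odd_u tau_x.
Qed.

End Level.
Lemma tower_level_prim k (z : algC) j : (f * 2 ^ k).-primitive_root z -> (j <= k)%N ->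
  (f * 2 ^ j).-primitive_root (z ^+ (2 ^ (k - j))).
Proof.
move=> prim_z le_jk; have f_gt0 : (0 < f)%N.
  by have := prim_order_gt0 prim_z; rewrite muln_gt0 => /andP[].
have DN : (f * 2 ^ k = 2 ^ (k - j) * (f * 2 ^ j))%N.
  by rewrite mulnCA -expnD subnK.
have := dvdn_prim_root prim_z (_ : f * 2 ^ j %| f * 2 ^ k)%N.
rewrite {2}DN mulnK; last by rewrite muln_gt0 f_gt0 expn_gt0.
by apply; rewrite DN dvdn_mull.
Qed.

(** Induction on the level. The top involution tau is inertial, so modulo the maximal ideal x is a
    double root of the polynomial with roots x and tau x. Its coefficients come from the level below
    and are preserved modulo that ideal, whence (X - x)^2 = 0 there for X the image of x. *)
Lemma tower_inertia_Aint k (z : algC) (g : aut) : (f * 2 ^ k).-primitive_root z ->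
    {in K, g =1 id} -> g z = z ^+ f.+1 ->
  forall j, (C <= j <= k)%N -> forall x, x \in adj K (z ^+ (2 ^ (k - j))) -> x \in Aint ->
    vgt (autX g (2 ^ C) x - x) 0.
Proof.
move=> prim_z gK gz; elim=> [|j IHj] /andP[le_C le_k] x Fx Zx.
  move: le_C; rewrite leqn0 => /eqP C0.
  by rewrite (tower_level_fix prim_z gK gz) ?subrr ?C0 // /vgt eqxx.
have [lt_jC|le_Cj] := ltnP j C.
  have DC' : C = j.+1 by apply/eqP; rewrite eqn_leq le_C lt_jC.
  by rewrite (tower_level_fix prim_z gK gz) ?subrr ?DC' // /vgt eqxx.
set y := z ^+ (2 ^ (k - j.+1)) in Fx.
have prim_y : (f * 2 ^ j.+1).-primitive_root y by apply: tower_level_prim.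
have gy : g y = y ^+ f.+1 by rewrite /y rmorphXn /= gz exprAC.
have Ey : y ^+ (2 ^ (j.+1 - j)) = z ^+ (2 ^ (k - j)).
  rewrite /y -exprM -expnD; congr (z ^+ (2 ^ _)).
  by rewrite subSn // subnn addn1 subnSK.
have mtau := @inertia_top j.+1 y g prim_y gK gy le_Cj x Fx Zx; rewrite /= in mtau.
set tau := autX g (2 ^ j) in mtau.
have Ftx : tau x \in adj K y by apply: (tower_stable gK gy).
have Ztx : tau x \in Aint by rewrite Aint_aut.
have tau2 : tau (tau x) = x.
  by rewrite /tau -autXD addnn -mul2n -expnS (tower_order prim_y gK gy).
have descend w : w \in adj K y -> w \in Aint -> tau w = w -> vgt (autX g (2 ^ C) w - w) 0.
  move=> Fw Zw tw; apply: IHj => //; first by rewrite le_Cj ltnW.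
  by rewrite -Ey; apply: (tower_fixed prim_y gK gy).
have m1 : vgt (autX g (2 ^ C) (x + tau x) - (x + tau x)) 0.
  by apply: descend; [apply: rpredD | apply: rpredD | rewrite rmorphD /= tau2 addrC].
have m2 : vgt (autX g (2 ^ C) (x * tau x) - (x * tau x)) 0.
  by apply: descend; [apply: rpredM | apply: rpredM | rewrite rmorphM /= tau2 mulrC].
rewrite rmorphD /= in m1; rewrite rmorphM /= in m2.
move: m1 m2; set X := autX g (2 ^ C) x; set Y := autX g (2 ^ C) (tau x) => m1 m2.
have Rx := R_Aint Rtot Zx; have Rtx := R_Aint Rtot Ztx.
have RX : X \in R by apply: (R_Aint Rtot); rewrite Aint_aut.
have msq : vgt ((X - x) * (X - x)) 0.
  have -> : (X - x) * (X - x) = (X + Y - (x + tau x)) * X - (X * Y - x * tau x) + (X - x) * (tau x - x).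
    by ring.
  apply: vgtD => //; last by rewrite mulrC; apply: vgt0M => //; apply: rpredB.
  by apply: vgt0B => //; apply: vgt0M.
have RXx : X - x \in R by apply: rpredB.
by have [] := vgt0_prime R2 Rtot RXx RXx msq.
Qed.

Section LevelLocal.
Variables (k : nat) (z : algC) (g : aut).
Hypotheses (prim_z : (f * 2 ^ k).-primitive_root z) (gK : {in K, g =1 id})
           (gz : g z = z ^+ f.+1).

Lemma tower_inertia m x : x \in adj K z -> x \in R -> vgt (autX g (m * 2 ^ C) x - x) 0.
Proof.
move=> Fx Rx.
have step y : y \in adj K z -> y \in R -> vgt (autX g (2 ^ C) y - y) 0.
  apply: (inertia_local R2 Rtot) => {y} y Fy Zy; have [le_Ck|/ltnW le_kC] := leqP C k.
    by apply: (tower_inertia_Aint prim_z gK gz (j := k)); rewrite ?le_Ck ?leqnn // subnn expn0 expr1.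
  rewrite -(subnK le_kC) expnD autXM (autX_fix _ (tower_order prim_z gK gz Fy)).
  by rewrite subrr /vgt eqxx.
suff [//] : vgt (autX g (m * 2 ^ C) x - x) 0 /\ autX g (m * 2 ^ C) x \in R.
elim: m => [|m [mm Rm]]; first by rewrite mul0n /= subrr /vgt eqxx.
have mS : vgt (autX g (m.+1 * 2 ^ C) x - autX g (m * 2 ^ C) x) 0.
  by rewrite mulSn autXD; apply: step => //; apply: (tower_stable gK gz).
split; first exact: (vgt0_trans R2 Rtot mS mm).
exact: (vgt_mod R2 Rtot mS Rm).
Qed.

Lemma tower_R m x : x \in adj K z -> x \in R -> autX g (m * 2 ^ C) x \in R.
Proof. by move=> Fx Rx; apply: (vgt_mod R2 Rtot (tower_inertia m Fx Rx)). Qed.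

Lemma tower_v2 m x : x \in adj K z -> x != 0 -> v2 (autX g (m * 2 ^ C) x) = v2 x.
Proof. by apply: (v2_aut R2 Rtot) => y Fy Ry; apply: tower_R. Qed.

(** A power of 2 brings y to a valuation in [0, 1), and the loss of 1 is this rounding. The result
    is a quotient o / d of integers with d a unit of R; its denominator is replaced by the norm E of
    d, which h fixes and which has valuation 0. *)
Lemma tower_trace_bound_local s y : (C + s <= k)%N -> y \in adj K z -> y != 0 ->
  vge (\sum_(l < 2 ^ s) autX (autX g (2 ^ (k - s))) l y) (v2 y + s%:R - C%:R - 1).
Proof.
move=> le_k Fy nzy; set h := autX g _.
have le_sk : (s <= k)%N by apply: leq_trans le_k; rewrite leq_addl.
have Dh l x : autX h l x = autX g (l * 2 ^ (k - s - C) * 2 ^ C) x.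
  rewrite /h -autXM -mulnA -expnD subnK //.
  by rewrite -(leq_add2r s) subnK.
have h_order x : x \in adj K z -> autX h (2 ^ s) x = x.
  by move=> Fx; rewrite -autXM -expnD subnKC // (tower_order prim_z gK gz).
(* Only natural exponents are at hand: a makes the valuation nonnegative and b is then its integral
   part. *)
pose a := Num.bound `|v2 y|; pose b := Num.truncn (v2 y + a%:R).
have va : 0 <= v2 y + a%:R.
  have : `|v2 y| < a%:R by apply: archi_boundP.
  by rewrite ltr_norml => /andP[lt1 _]; lra.
have /andP[leb ltb] : b%:R <= v2 y + a%:R < b.+1%:R by apply: truncn_itv.
have nz2 : (2 : algC) != 0 by rewrite pnatr_eq0.
pose y1 := y * 2 ^+ a / 2 ^+ b.
have nzy1 : y1 != 0 by rewrite !mulf_neq0 ?invr_eq0 ?expf_neq0.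
have vy1 : v2 y1 = v2 y + a%:R - b%:R.
  by rewrite v2M ?v2V ?mulf_neq0 ?invr_eq0 ?expf_neq0 // v2M ?expf_neq0 // !v2X // v2_2 // !mulr1.
have Fy1 : y1 \in adj K z.
  by apply: rpred_div; [apply: rpredM => //|]; apply: rpredX; apply: rpred_nat.
have Ry1 : y1 \in R by rewrite -(v2_ge0 R2 Rtot) // vy1 subr_ge0.
have [o [d [Qo Qd Zo Zd [nmd Dy]]]] := local_fraction R2 Rtot Ry1.
have sF : {subset adj Crat y1 <= adj K z} by apply: sub_adj => // x; apply: rpred_Crat.
have Fo := sF _ Qo; have Fd := sF _ Qd; have Rd := R_Aint Rtot Zd.
have [nzd vd] := unit_val0 R2 Rtot Rd nmd.
have [T DT] : exists T, (2 ^ s = T.+1)%N.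
  by exists (2 ^ s).-1; rewrite prednK // expn_gt0.
pose E := \prod_(l < 2 ^ s) autX h l d.
pose e := \prod_(l < T) autX h l.+1 d.
have DE : E = d * e by rewrite /E DT big_ord_recl.
have nzE : E != 0 by apply/prodf_neq0 => l _; rewrite fmorph_eq0.
have vE : v2 E = 0.
  rewrite v2_prod // => [|l _]; last by rewrite fmorph_eq0.
  by rewrite big1 // => l _; rewrite Dh tower_v2.
have hE : h E = E by apply: prod_autX_shift; apply: h_order.
have Ze : e \in Aint by rewrite rpred_prod // => l _; rewrite Aint_aut.
have Fe : e \in adj K z.
  by apply: rpred_prod => l _; rewrite Dh; apply: (tower_stable gK gz).
have nze : e != 0 by move: nzE; rewrite DE mulf_eq0 negb_or => /andP[].
have Dy1 : y = (o * e) * (2 ^+ b / (2 ^+ a * E)).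
  have -> : y = y1 * 2 ^+ b / 2 ^+ a.
    by rewrite /y1 -!mulrA mulKf ?expf_neq0 // divff ?mulr1 ?expf_neq0.
  rewrite Dy DE; have := expf_neq0 a nz2; have := expf_neq0 b nz2.
  by move: (2 ^+ a) (2 ^+ b) => A B nzA nzB; field; rewrite ?nzA ?nzB ?nzd ?nze.
have -> : \sum_(l < 2 ^ s) autX h l y
    = (\sum_(l < 2 ^ s) autX h l (o * e)) * (2 ^+ b / (2 ^+ a * E)).
  rewrite mulr_suml; apply: eq_bigr => l _; rewrite {1}Dy1 rmorphM; congr (_ * _).
  by rewrite fmorph_div rmorphM /= !rmorphXn /= rmorph_nat (autX_fix l hE).
have -> : v2 y + s%:R - C%:R - 1 = (s%:R - C%:R) + (v2 y - 1) by ring.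
apply: (vgeM R2 Rtot).
  by apply: (tower_trace_bound prim_z gK gz) => //; [apply: rpredM | apply: rpredM].
rewrite /vge; apply/orP; right.
rewrite v2M ?v2V ?mulf_neq0 ?invr_eq0 ?mulf_neq0 ?expf_neq0 // v2M ?expf_neq0 //.
rewrite !v2X // v2_2 // vE !mulr1 addr0; rewrite -natr1 in ltb; lra.
Qed.

End LevelLocal.
End TowerInertia.

(** * Dynamics above 2 *)

(** This is the leading coefficient in Lagrange's interpolation of X^n at the r_l. *)
Lemma euler_trace n (r : 'I_n.+1 -> algC) : injective r ->
  \sum_l r l ^+ n / \prod_(m | m != l) (r l - r m) = 1.
Proof.
move=> inj_r; pose G l : {poly algC} := \prod_(m | m != l) ('X - (r m)%:P).
have valG l x : (G l).[x] = \prod_(m | m != l) (x - r m).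
  by rewrite horner_prod; apply: eq_bigr => m _; rewrite hornerXsubC.
have nzd l : \prod_(m | m != l) (r l - r m) != 0.
  by apply/prodf_neq0 => m nm; rewrite subr_eq0; apply: contraNneq nm => /inj_r ->.
have monG l : G l \is monic by apply: monic_prod => m _; apply: monicXsubC.
have szG l : size (G l) = n.+1.
  rewrite /G -big_filter size_prod_XsubC size_filter /=; congr (_.+1).
  have cl := cardC1 l; rewrite card_ord /= in cl.
  by rewrite -sum1_count -[RHS]cl -sum1_card; apply: eq_bigl.
pose c l := r l ^+ n / \prod_(m | m != l) (r l - r m).
pose Q := 'X^n - \sum_l c l *: G l.
have szQ : (size Q <= n.+1)%N.
  rewrite /Q (leq_trans (size_polyD _ _)) // geq_max size_polyXn leqnn size_polyN.
  apply: (leq_trans (size_sum _ _ _)); apply/bigmax_leqP => l _.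
  by rewrite (leq_trans (size_scale_leq _ _)) // szG.
have Q0 : Q = 0.
  apply/eqP; apply: contraT => nzQ.
  have : (size [seq r l | l <- enum 'I_n.+1] < size Q)%N.
    apply: max_poly_roots => //; last by rewrite map_inj_uniq ?enum_uniq.
    apply/allP=> _ /mapP[l _ ->]; rewrite rootE /Q hornerD hornerN hornerXn horner_sum.
    rewrite (bigD1 l) //= hornerZ valG divfK ?nzd // big1 ?addr0 ?subrr // => m nm.
    rewrite hornerZ valG (bigD1 l) /=; last by rewrite eq_sym.
    by rewrite subrr mul0r mulr0.
  by rewrite size_map size_enum_ord ltnNge szQ.
have /(congr1 (fun p : {poly algC} => p`_n)) := Q0.
rewrite /Q coefB coefXn eqxx coef0 coef_sum => /eqP; rewrite subr_eq0 => /eqP E.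
rewrite -[RHS]/(true%:R) E; apply: eq_bigr => l _; rewrite coefZ.
by have := monicP (monG l); rewrite lead_coefE szG /= => ->; rewrite mulr1.
Qed.

Lemma first_moved (sigma : aut) (p : nat -> algC) n :
    sigma (p 0%N) = p 0%N -> sigma (p n) != p n ->
  exists i, [/\ (i < n)%N, forall l, (l <= i)%N -> sigma (p l) = p l
              & sigma (p i.+1) != p i.+1].
Proof.
move=> fix0; elim/ltn_ind: n => -[|n] IHn; first by rewrite fix0 eqxx.
move=> mv; have [fixn|mvn] := eqVneq (sigma (p n)) (p n); last first.
  by have [i [lt_i fix_l mv_i]] := IHn n (ltnSn n) mvn; exists i; split=> //; apply: ltnW.
have [all_fix|[l [le_l mv_l]]] : (forall l, (l <= n)%N -> sigma (p l) = p l) \/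
    exists l, (l <= n)%N /\ sigma (p l) != p l.
  have [ex|nex] := pselect (exists l, (l <= n)%N /\ sigma (p l) != p l); first by right.
  by left=> l le_l; apply: contrapT => /eqP mv_l; apply: nex; exists l.
  by exists n.
have [i [lt_i fix_i mv_i]] := IHn l le_l mv_l; exists i; split=> //.
exact: leq_trans lt_i (leqW le_l).
Qed.

Section DynamicsAtTwo.
Variables (K : divringClosed algC) (f C : nat) (R : subringClosed algC) (a c : algC).
Hypotheses (R2 : 2^-1 \notin R) (Rtot : forall x, (x \in R) || (x^-1 \in R)).
Local Notation v2 := (v2 R).
Local Notation vge := (vge R).
Local Notation vgt := (vgt R).
Hypotheses (dv4 : (4 %| f)%N) (Ka : a \in K) (Kc : c \in K) (nza : a != 0)
  (va : v2 a = 0).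
Hypothesis inertia : forall k z (g : aut), (f * 2 ^ k).-primitive_root z ->
  {in K, g =1 id} -> g z = z ^+ f.+1 -> forall m x, x \in adj K z -> x \in R ->
  vgt (autX g (m * 2 ^ C) x - x) 0.
Hypothesis trace_bound : forall k z (g : aut), (f * 2 ^ k).-primitive_root z ->
  {in K, g =1 id} -> g z = z ^+ f.+1 -> forall s y, (C + s <= k)%N -> y \in adj K z ->
  y != 0 ->
  vge (\sum_(l < 2 ^ s) autX (autX g (2 ^ (k - s))) l y) (v2 y + s%:R - C%:R - 1).

Let two_m : vgt 2 0.
Proof. by rewrite /vgt v2_2 // ltr01 orbT. Qed.

Let Ra : a \in R. Proof. by rewrite -(v2_ge0 R2 Rtot) // va. Qed.
Let RVa : a^-1 \in R. Proof. by rewrite -(v2_ge0 R2 Rtot) ?invr_eq0 // v2V // va oppr0. Qed.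

Lemma congr1_unit x : vgt (x - 1) 0 -> [/\ x \in R, x^-1 \in R, x != 0 & v2 x = 0].
Proof.
move=> m1; have Rx : x \in R by apply: (vgt_mod R2 Rtot m1); apply: rpred1.
have nmx : ~~ vgt x 0.
  apply: contra (vgt1 R2 Rtot) => mx; rewrite (_ : 1 = x - (x - 1)).
    exact: (vgt0B R2 Rtot).
  by rewrite opprB addrC subrK.
by have [nzx vx] := unit_val0 R2 Rtot Rx nmx; split=> //; apply: (unit_inv R2 Rtot).
Qed.

Lemma sq_congr1 x : x \in R -> vgt (x ^+ 2 - 1) 0 -> vgt (x - 1) 0.
Proof.
move=> Rx m2; have Rx1 : x - 1 \in R by apply: rpredB => //; apply: rpred1.
have m4 : vgt ((x - 1) * (x - 1)) 0.
  have -> : (x - 1) * (x - 1) = (x ^+ 2 - 1) - 2 * (x - 1) by ring.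
  by apply: (vgt0B R2 Rtot) => //; apply: (vgt0M R2 Rtot).
by have [] := vgt0_prime R2 Rtot Rx1 Rx1 m4.
Qed.

(* A step of the path ramified above 2 passes through the critical residue
   class, that of 1. *)
Lemma inverted_congr1 (sigma : aut) x : x != 0 -> sigma x = x^-1 ->
    (forall y, y = x \/ y = x^-1 -> y \in R -> vgt (sigma y - y) 0) ->
  vgt (x - 1) 0.
Proof.
move=> nzx sx iner.
have Rx : x \in R.
  have /orP[//|RVx] := Rtot x.
  have := iner x^-1 (or_intror erefl) RVx; rewrite fmorphV sx invrK => m1.
  exact: (vgt_mod R2 Rtot m1).
have := iner x (or_introl erefl) Rx; rewrite sx => m1.
apply: sq_congr1 => //; rewrite -(vgtN R2 Rtot).
have -> : - (x ^+ 2 - 1) = (x^-1 - x) * x by field.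
exact: (vgt0M R2 Rtot).
Qed.

Section Path.
Variables (k : nat) (z : algC) (g : aut) (p : nat -> algC) (n : nat).
Hypotheses (prim_z : (f * 2 ^ k).-primitive_root z) (gK : {in K, g =1 id})
  (gz : g z = z ^+ f.+1) (path_p : bpath a c p n) (Kp0 : p 0%N \in K)
  (Fp : forall i, (i <= n)%N -> p i \in adj K z).

Let autK m : {in K, autX g m =1 id}.
Proof. by move=> x Kx; apply: autX_fix; apply: gK. Qed.

Lemma moved_step s i : (C <= s)%N -> (i < n)%N -> autX g (2 ^ s) (p i) = p i ->
    autX g (2 ^ s) (p i.+1) != p i.+1 ->
  autX g (2 ^ s) (p i.+1) = (p i.+1)^-1 /\ vgt (p i.+1 - 1) 0.
Proof.
move=> le_Cs lt_i fix_i mv; have [nz _] := path_p lt_i.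
have [/eqP|sx] := bpath_aut_step Ka Kc nza (@autK (2 ^ s)) path_p lt_i fix_i.
  by rewrite (negPf mv).
split=> //; apply: (inverted_congr1 nz sx) => y Dy Ry.
have Fy : y \in adj K z by case: Dy => ->; rewrite ?rpredV; apply: Fp.
by rewrite -(subnK le_Cs) expnD; apply: (inertia prim_z gK gz).
Qed.

Lemma moved_exists s : (C <= s)%N -> autX g (2 ^ s) (p n) != p n ->
  exists i, [/\ (i < n)%N, forall l, (l <= i)%N -> autX g (2 ^ s) (p l) = p l,
      autX g (2 ^ s) (p i.+1) != p i.+1, autX g (2 ^ s) (p i.+1) = (p i.+1)^-1
    & vgt (p i.+1 - 1) 0].
Proof.
move=> le_Cs mv; have [i [lt_i fix_l mv_i]] := first_moved (@autK (2 ^ s) _ Kp0) mv.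
by have [sx m1] := moved_step le_Cs lt_i (fix_l i (leqnn i)) mv_i; exists i; split.
Qed.

(** Here phi(x) - c = a (2 + (x - 1)^2 / x), and 2 is in the maximal ideal. *)
Lemma phi_congr1 x : vgt (x - 1) 0 -> vgt (phi a c x - c) 0.
Proof.
move=> m1; have [Rx RVx nzx _] := congr1_unit m1.
have -> : phi a c x - c = (2 + (x - 1) * (x - 1) * x^-1) * a by rewrite /phi; field.
apply: (vgt0M R2 Rtot) => //; apply: vgtD => //; apply: (vgt0M R2 Rtot) => //.
by apply: (vgt0M R2 Rtot) => //; apply: (vgtR R2 Rtot).
Qed.

Lemma path_phi0 i : vgt c 0 -> (i < n)%N -> vgt (p i.+1) 0 -> p i \notin R.
Proof.
move=> mc lt_i mx; have [nzx <-] := path_p lt_i; set x := p i.+1 in mx nzx *.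
apply/negP => Ry.
have Rx := vgtR R2 Rtot mx.
have : a / x \in R.
  have -> : a / x = phi a c x - a * x - c by rewrite /phi; ring.
  by apply: rpredB; [apply: rpredB => //; apply: rpredM | apply: (vgtR R2 Rtot)].
rewrite -(v2_ge0 R2 Rtot) ?mulf_neq0 ?invr_eq0 // v2M ?invr_eq0 // v2V // va.
by case/orP: mx => [|lt0]; [rewrite (negPf nzx) | rewrite sub0r oppr_ge0 leNgt lt0].
Qed.

Lemma path_notR i : vgt c 0 -> (i < n)%N -> p i.+1 \notin R -> p i \notin R.
Proof.
move=> mc lt_i nRx; have [nzx <-] := path_p lt_i; set x := p i.+1 in nRx nzx *.
apply: contra nRx => Ry; have /orP[//|RVx] := Rtot x.
have -> : x = a^-1 * (phi a c x - a * x^-1 - c) by rewrite /phi; field; rewrite nzx nza.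
apply: rpredM => //; apply: rpredB; last exact: (vgtR R2 Rtot).
by apply: rpredB => //; apply: rpredM.
Qed.

(** In the residue field phi acts by 1 -> 0 -> oo -> oo, so at most one point of a path is congruent
    to 1. If g^(2^(C+1)) moved the end, it would invert a first point congruent to 1, and its square
    root g^(2^C) would have inverted another such point earlier on the path. *)
Lemma path_case1 : vgt c 0 -> (C.+1 <= k)%N -> p n \in adj K (z ^+ (2 ^ (k - C.+1))).
Proof.
move=> mc le_Ck; apply: (tower_fixed dv4 prim_z gK gz le_Ck); first exact: Fp.
apply: contrapT => /eqP mv.
have [j [lt_j fix_j mv_j sj mj]] := moved_exists (leqnSn C) mv.
have sq x : autX g (2 ^ C.+1) x = autX g (2 ^ C) (autX g (2 ^ C) x).
  by rewrite expnS mul2n -addnn autXD.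
have mvj : autX g (2 ^ C) (p j.+1) != p j.+1.
  by apply: contra mv_j => /eqP fixj; rewrite sq !fixj.
have [i [lt_i fix_i mv_i]] := first_moved (@autK (2 ^ C) _ Kp0) mvj.
have lt_in : (i < n)%N by apply: leq_trans lt_i lt_j.
have [si mi] := moved_step (leqnn C) lt_in (fix_i i (leqnn i)) mv_i.
have lt_ij : (i < j)%N.
  move: lt_i; rewrite ltnS leq_eqVlt => /orP[/eqP Dij|//].
  by case/negP: mv_j; rewrite -Dij sq si fmorphV si invrK.
have m0 : vgt (p j) 0.
  have [_ <-] := path_p lt_j; rewrite -[phi _ _ _](subrK c).
  by apply: vgtD => //; apply: phi_congr1.
have [Ri _ _ _] := congr1_unit mi.
case: j => // j in lt_j fix_j mv_j sj mj mvj lt_i lt_ij m0 *.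
have notR l : (l <= j)%N -> p l \notin R.
  move=> le_l; rewrite -(subKn le_l); elim: (j - l)%N => [|d IHd].
    by rewrite subn0; apply: path_phi0 => //; apply: ltnW.
  have [lt_d|le_d] := ltnP d j; last first.
    by have -> : (j - d.+1 = j - d)%N by apply/eqP; rewrite eqn_leq !leq_subLR; move: le_d; clear; lia.
  apply: path_notR => //; last by rewrite subnSK.
  by apply: leq_ltn_trans (leq_subr _ _) _; apply: ltn_trans lt_j.
move: lt_ij; rewrite ltnS leq_eqVlt => /orP[/eqP Dij|lt_ij]; last first.
  by have := notR i.+1 lt_ij; rewrite Ri.
rewrite -Dij in m0; have := vgt1 R2 Rtot.
rewrite (_ : 1 = p i.+1 - (p i.+1 - 1)); first by rewrite (vgt0B R2 Rtot).
by rewrite opprB addrC subrK.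
Qed.

Lemma path_congr1_back i : vgt (c - 1) 0 -> (i <= n)%N -> vgt (p i - 1) 0 -> vgt (p 0%N - 1) 0.
Proof.
move=> mc; elim: i => // i IHi lt_i mi; apply: IHi; first exact: ltnW.
have [_ <-] := path_p lt_i.
by apply: (vgt0_trans R2 Rtot _ mc); apply: phi_congr1.
Qed.

Lemma path_case2_noncritical : vgt (c - 1) 0 -> ~~ vgt (p 0%N - 1) 0 -> (C <= k)%N ->
  p n \in adj K (z ^+ (2 ^ (k - C))).
Proof.
move=> mc nm0 le_Ck; apply: (tower_fixed dv4 prim_z gK gz le_Ck); first exact: Fp.
apply: contrapT => /eqP mv.
have [j [lt_j fix_j mv_j sj mj]] := moved_exists (leqnn C) mv.
by rewrite (path_congr1_back mc lt_j mj) in nm0.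
Qed.

(** If p_i and c are both congruent to 1, then x = p_(i+1) satisfies x + 1/x = 0 in the residue
    field, so x^2 = -1 = 1 and x = 1 in characteristic 2. *)
Lemma path_congr1 : vgt (c - 1) 0 -> vgt (p 0%N - 1) 0 ->
  forall i, (i <= n)%N -> vgt (p i - 1) 0.
Proof.
move=> mc m0; elim=> // i IHi lt_i; have mi := IHi (ltnW lt_i).
have [nzx Ex] := path_p lt_i; set x := p i.+1 in nzx Ex *.
have mxx : vgt (x + x^-1) 0.
  have -> : x + x^-1 = ((p i - 1) - (c - 1)) * a^-1.
    by rewrite -Ex /phi; field; rewrite nzx nza.
  by apply: (vgt0M R2 Rtot) => //; apply: (vgt0B R2 Rtot).
have Rx : x \in R.
  have /orP[//|RVx] := Rtot x; rewrite -(addrK x^-1 x).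
  by apply: rpredB => //; apply: (vgtR R2 Rtot).
apply: sq_congr1 => //.
have -> : x ^+ 2 - 1 = (x + x^-1) * x - 2 by field.
by apply: (vgt0B R2 Rtot) => //; apply: (vgt0M R2 Rtot).
Qed.

(** The number c - 1 + 2 a is phi(1) - 1. As 1 is a critical point of phi, phi(x) - phi(1) is
    quadratic in x - 1. *)
Lemma path_sub1 i : (i < n)%N ->
  (p i - 1 - (c - 1 + 2 * a)) * p i.+1 = a * (p i.+1 - 1) ^+ 2.
Proof. by move=> lt_i; have [nzx <-] := path_p lt_i; rewrite /phi; field. Qed.

(** * The critical case alpha = c = 1 in the residue field *)

Section Critical.
Hypotheses (mc : vgt (c - 1) 0) (m0 : vgt (p 0%N - 1) 0).
Variable mu : rat.
Hypotheses (mu_gt0 : 0 < mu) (mu_small : mu <= 4^-1) (b_mu : vge (c - 1 + 2 * a) mu).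

Let unit_p i : (i <= n)%N -> [/\ p i \in R, (p i)^-1 \in R, p i != 0 & v2 (p i) = 0].
Proof. by move=> le_i; apply: congr1_unit; apply: path_congr1. Qed.

(** Despite the name, p_i lies outside the disc v(x - 1) >= mu around 1. *)
Definition near i := (p i - 1 != 0) && (v2 (p i - 1) < mu).

(** Outside the disc the term phi(1) - 1 in [path_sub1] is negligible, so v(p_(i+1) - 1) is half of
    v(p_i - 1). *)
Lemma near_next i : (i < n)%N -> near i -> near i.+1.
Proof.
move=> lt_i /andP[nzi lti]; have [_ _ nzx vx] := unit_p lt_i.
have mb : vgt (- (c - 1 + 2 * a)) (v2 (p i - 1)).
  by rewrite vgtN //; apply: vgt_ge b_mu.
have [nzd vd] := v2_add_lt R2 Rtot nzi mb.
have E := path_sub1 lt_i; have nzu : p i.+1 - 1 != 0.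
  by apply: contraTneq nzd => u0; move/eqP: E; rewrite u0 expr0n mulr0 mulf_eq0 (negPf nzx) orbF negbK.
rewrite /near nzu /=; have := congr1 v2 E.
rewrite v2M // vd vx v2M ?expf_neq0 // va v2X // => E2.
move: mu_gt0 lti E2; rewrite addr0 add0r mulr_natl mulr2n => mu0 lti E2.
rewrite -(@ltr_pMn2r _ 2) // [X in X < _]mulr2n -E2; apply: (lt_trans lti).
by rewrite mulr2n ltrDl.
Qed.

Lemma near_later i j : (i <= j <= n)%N -> near i -> near j.
Proof.
case/andP=> le_ij; rewrite -(subnKC le_ij); elim: (j - i)%N => [|d IHd] le_n ni.
  by rewrite addn0.
by rewrite addnS in le_n *; apply: near_next => //; apply: IHd => //; apply: ltnW.
Qed.

(** For y = phi(x), phi(y) - y is phi(x) - x times a (x y - 1) / (x y), and x y - 1 = (x - 1) y + (y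
    - 1). Each step inside the disc thus contributes a further mu to v(phi(alpha) - alpha). *)
Lemma path_contraction m : (m <= n)%N -> (forall i, (i <= m)%N -> ~~ near i) ->
  vge (phi a c (p 0%N) - p 0%N) (m%:R * mu).
Proof.
move=> le_mn far.
have farP i : (i <= m)%N -> vge (p i - 1) mu.
  by move=> le_i; have := far i le_i; rewrite /near /vge; case: eqP => //= _; rewrite -leNgt.
have Rphi i : (i <= n)%N -> phi a c (p i) \in R.
  move=> le_i; have [Rp RVp _ _] := unit_p le_i; rewrite /phi.
  have Rc : c \in R by apply: (vgt_mod R2 Rtot mc); apply: rpred1.
  by apply: rpredD => //; apply: rpredD; apply: rpredM.
suff H d : (d <= m)%N -> vge (phi a c (p (m - d)%N) - p (m - d)%N) (d%:R * mu).
  by have := H m (leqnn m); rewrite subnn.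
elim: d => [|d IHd] lt_d.
  rewrite subn0 mul0r vgeR //; have [Rp _ _ _] := unit_p le_mn.
  by apply: rpredB => //; apply: Rphi.
set i := (m - d.+1)%N.
have Di : (m - d = i.+1)%N by rewrite /i subnSK.
have le_im : (i.+1 <= m)%N by rewrite -Di leq_subr.
have lt_in : (i < n)%N by apply: leq_trans le_im le_mn.
have := IHd (ltnW lt_d); rewrite Di; set x := p i.+1; set y := p i => vx.
have [nzx Ex] : x != 0 /\ phi a c x = y := path_p lt_in.
have [Ry RVy nzy _] := unit_p (ltnW lt_in); have [Rx RVx _ _] := unit_p lt_in.
rewrite -/x -/y in Ry RVy nzy Rx RVx.
have -> : phi a c y - y = (phi a c x - x) * (((x - 1) * y + (y - 1)) * (a * x^-1 * y^-1)).
  by rewrite -{2}Ex Ex /phi in vx *; rewrite -[X in _ - X]Ex /phi; field; rewrite nzx nzy.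
have -> : d.+1%:R * mu = d%:R * mu + mu by rewrite -natr1 mulrDl mul1r.
apply: (vgeM R2 Rtot) => //.
rewrite -[mu]addr0; apply: (vgeM R2 Rtot); last first.
  by rewrite vgeR //; apply: rpredM => //; apply: rpredM.
apply: vgeD => //; last by apply: farP; apply: ltnW.
by rewrite -[mu]addr0; apply: (vgeM R2 Rtot); [apply: farP | rewrite vgeR].
Qed.

(** Each step is at worst an inversion, which one more squaring of the automorphism undoes. *)
Lemma path_level m : (m <= n)%N -> autX g (2 ^ m) (p m) = p m.
Proof.
elim: m => [|m IHm] lt_m; first exact: (@autK _ _ Kp0).
have sq x : autX g (2 ^ m.+1) x = autX g (2 ^ m) (autX g (2 ^ m) x).
  by rewrite expnS mul2n -addnn autXD.
have [E|E] := bpath_aut_step Ka Kc nza (@autK (2 ^ m)) path_p lt_m (IHm (ltnW lt_m)).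
  by rewrite sq !E.
by rewrite sq E fmorphV E invrK.
Qed.

Section Orbit.
Variables (m1 s0 : nat).
Hypotheses (near1 : forall i, (m1 <= i <= n)%N -> near i) (le_m1n : (m1 <= n)%N)
  (le_m1s : (m1 <= s0)%N) (le_Cs : (C <= s0)%N).
Let sigma := autX g (2 ^ s0).

Let sigE l x : autX sigma l x = autX g (l * 2 ^ (s0 - C) * 2 ^ C) x.
Proof. by rewrite /sigma -autXM -mulnA -expnD subnK. Qed.

Let sigR l i : (i <= n)%N -> autX sigma l (p i) \in R /\ (autX sigma l (p i))^-1 \in R.
Proof.
move=> le_i; have [Rp RVp _ _] := unit_p le_i; rewrite -fmorphV !sigE.
split; [apply: (vgt_mod R2 Rtot (inertia prim_z gK gz _ (Fp le_i) Rp)) => //|].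
by apply: (vgt_mod R2 Rtot (inertia prim_z gK gz _ _ RVp)) => //; rewrite rpredV; apply: Fp.
Qed.

(** For X the conjugate of x, phi(x) - phi(X) = (a / x) (x - X) (x - 1/X), where a and x are
    units. *)
Lemma orbit_difference l i : (i < n)%N -> autX sigma l (p i) != p i ->
  [/\ p i.+1 - autX sigma l (p i.+1) != 0, p i.+1 - (autX sigma l (p i.+1))^-1 != 0
    & v2 (p i - autX sigma l (p i)) = v2 (p i.+1 - autX sigma l (p i.+1))
        + v2 (p i.+1 - (autX sigma l (p i.+1))^-1)].
Proof.
move=> lt_i mv; have [nzx Ex] := path_p lt_i; set x := p i.+1 in nzx Ex *.
have sK : {in K, autX sigma l =1 id}.
  by move=> y Ky; apply: autX_fix; apply: autX_fix; apply: gK.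
have E : p i - autX sigma l (p i)
    = (a / x) * ((x - autX sigma l x) * (x - (autX sigma l x)^-1)).
  rewrite -Ex (phi_aut Ka Kc) // /phi; set X := autX sigma l x.
  by have nzX : X != 0; [rewrite fmorph_eq0 | field; rewrite nzx nzX].
have nz : p i - autX sigma l (p i) != 0 by rewrite subr_eq0 eq_sym.
have := nz; rewrite {1}E !mulf_eq0 !negb_or => /and3P[_ nz1 nz2].
have [_ _ _ vx] := unit_p lt_i; rewrite -/x in vx.
split=> //; rewrite E v2M ?mulf_neq0 ?invr_eq0 // v2M ?invr_eq0 // v2V // va vx subr0 add0r.
by rewrite v2M.
Qed.

(** The orbit of p_m under sigma has exactly 2^j points, and the sum is the valuation of F'(p_m),
    where F is the monic polynomial whose roots they are. *)
Definition orbit_inv m j :=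
  [/\ autX sigma (2 ^ j) (p m) = p m,
      forall l, (0 < l < 2 ^ j)%N -> autX sigma l (p m) != p m
    & \sum_(1 <= l < 2 ^ j) v2 (p m - autX sigma l (p m)) <= j%:R / 2].

(** In x - 1/x = (x - 1) (x - 1 + 2) / x the 2 is negligible, so the valuation is 2 v(x - 1) < 2 mu.
    This is the reason for mu <= 1/4. *)
Lemma critical_difference i : (m1 <= i <= n)%N -> p i != (p i)^-1 -> v2 (p i - (p i)^-1) <= 2^-1.
Proof.
move=> /andP[le1 le2] nE; have [_ _ nzx vx] := unit_p le2.
have /andP[nzu ltu] := near1 (introT andP (conj le1 le2)).
have ltu1 : v2 (p i - 1) < 1 by apply: (lt_le_trans ltu); apply: (le_trans mu_small).
have [|nz2 v2'] := v2_add_lt R2 Rtot nzu (y := 2); first by rewrite /vgt v2_2 // ltu1 orbT.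
have -> : p i - (p i)^-1 = (p i - 1) * (p i - 1 + 2) * (p i)^-1 by field.
rewrite v2M ?mulf_neq0 ?invr_eq0 // v2V // vx subr0 v2M // v2'.
by move: ltu mu_small; move: (v2 _) => A h1 h2; lra.
Qed.

(** If the orbit does not grow, each difference at m + 1 has at most the valuation of the one at m.
    If it doubles, the new conjugates are the old choices and their inverses; by [orbit_difference]
    their differences pair up to the old sum, and only v(x - 1/x) is added. *)
Lemma orbit_inv_step m j : (m1 <= m < n)%N -> orbit_inv m j ->
  exists j', orbit_inv m.+1 j'.
Proof.
move=> /andP[le_m lt_m] [fix_m mv_m sum_m].
have tauK : {in K, autX sigma (2 ^ j) =1 id}.
  by move=> y Ky; apply: autX_fix; apply: autX_fix; apply: gK.
have mvS l : autX sigma l (p m) != p m -> autX sigma l (p m.+1) != p m.+1.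
  apply: contra => /eqP E; have [_ <-] := path_p lt_m.
  rewrite (phi_aut Ka Kc) ?E // => y Ky.
  by apply: autX_fix; apply: autX_fix; apply: gK.
have [E|E] := bpath_aut_step Ka Kc nza tauK path_p lt_m fix_m.
  exists j; split=> // [l lt_l|]; first exact/mvS/mv_m.
  apply: le_trans sum_m; apply: ler_sum_nat => l lt_l.
  have [nz1 nz2 ->] := orbit_difference lt_m (mv_m l lt_l).
  rewrite lerDl (v2_ge0 R2 Rtot) //; have [Rx _ _ _] := unit_p lt_m.
  by apply: rpredB => //; have [] := sigR l lt_m.
have [fixS|nfixS] := eqVneq (p m.+1) (p m.+1)^-1.
  exists j; split=> // [|l lt_l|]; [by rewrite E -fixS | exact/mvS/mv_m |].
  apply: le_trans sum_m; apply: ler_sum_nat => l lt_l.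
  have [nz1 nz2 ->] := orbit_difference lt_m (mv_m l lt_l).
  rewrite lerDl (v2_ge0 R2 Rtot) //; have [Rx _ _ _] := unit_p lt_m.
  by apply: rpredB => //; have [] := sigR l lt_m.
have Etau l : autX sigma (l + 2 ^ j) (p m.+1) = (autX sigma l (p m.+1))^-1.
  by rewrite autXD E fmorphV.
have D2 : (2 ^ j.+1 = 2 ^ j + 2 ^ j)%N by rewrite expnS mul2n addnn.
have pow_gt0 : (0 < 2 ^ j)%N by rewrite expn_gt0.
exists j.+1; split.
- by rewrite D2 Etau E invrK.
- move=> l /andP[l_gt0 lt_l].
  have [lt_l2|le_l2] := ltnP l (2 ^ j); first by apply: mvS; apply: mv_m; rewrite l_gt0.
  have [l0|l'_gt0] := posnP (l - 2 ^ j)%N.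
    have -> : l = (2 ^ j)%N by apply/eqP; rewrite eqn_leq le_l2 andbT -subn_eq0 l0.
    by rewrite E eq_sym.
  apply: mvS; rewrite -(subnK le_l2) autXD fix_m; apply: mv_m.
  by rewrite l'_gt0 ltn_subLR // -D2.
have -> : \sum_(1 <= l < 2 ^ j.+1) v2 (p m.+1 - autX sigma l (p m.+1))
   = \sum_(1 <= l < 2 ^ j) v2 (p m - autX sigma l (p m)) + v2 (p m.+1 - (p m.+1)^-1).
  rewrite (big_cat_nat pow_gt0) /=; last by rewrite D2 leq_addr.
  (* The second half of the orbit consists of the inverses of the first half; its term l = 0 is the
     extra v(x - 1/x). *)
  rewrite [X in _ + X](_ : _ = \sum_(0 <= l < 2 ^ j) v2 (p m.+1 - (autX sigma l (p m.+1))^-1)).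
    rewrite [X in _ + X]big_ltn //= addrCA addrC; congr (_ + _).
    rewrite -big_split /=; apply: eq_big_nat => l lt_l.
    by have [_ _ ->] := orbit_difference lt_m (mv_m l lt_l).
  rewrite D2 -{1}[(2 ^ j)%N]add0n big_addn addnK; apply: eq_bigr => l _.
  by rewrite Etau.
have lt_t : v2 (p m.+1 - (p m.+1)^-1) <= 2^-1.
  by apply: critical_difference => //; rewrite (leqW le_m).
have -> : j.+1%:R / 2 = j%:R / 2 + 2^-1 :> rat by rewrite -natr1 mulrDl mul1r.
exact: lerD.
Qed.

Lemma orbit_inv_end : exists j, orbit_inv n j.
Proof.
have start : orbit_inv m1 0.
  split=> [|l|]; last by rewrite expn0 big_geq // mul0r.
    rewrite expn0 /= /sigma -(subnKC le_m1s) expnD mulnC autXM; apply: autX_fix.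
    exact: path_level.
  by rewrite expn0; case: l.
suff H d : (m1 + d <= n)%N -> exists j, orbit_inv (m1 + d) j.
  by have := H (n - m1)%N; rewrite subnKC //; apply.
elim: d => [|d IHd] le_d; first by exists 0%N; rewrite addn0.
rewrite addnS in le_d *; have [j inv_j] := IHd (ltnW le_d).
by apply: orbit_inv_step inv_j; rewrite leq_addr.
Qed.

Lemma orbit_level j : (s0 <= k)%N -> orbit_inv n j -> (s0 + j <= k)%N.
Proof.
move=> le_sk [_ mv _]; rewrite leqNgt; apply/negP => lt_kj.
have lt_j : (k - s0 < j)%N by rewrite ltn_subLR.
have := mv (2 ^ (k - s0))%N; rewrite expn_gt0 ltn_exp2l // lt_j => /(_ isT)/negP; apply.
by rewrite /sigma -autXM -expnD subnK // (tower_order dv4 prim_z gK gz) ?Fp.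
Qed.

(* Euler's formula exhibits 1 as the trace of [x ^ (2 ^ j - 1) / F'(x)], F the
   minimal polynomial; as F'(x) has small valuation, the trace bound limits j. *)
Lemma orbit_bound j : (s0 + j <= k)%N -> orbit_inv n j -> (j <= 2 * C.+1)%N.
Proof.
move=> le_k [fix_x mv sum_x]; set x := p n in fix_x mv sum_x.
have [Rx RVx nzx vx] := unit_p (leqnn n); rewrite -/x in Rx RVx nzx vx.
(* At level k' the automorphism sigma generates exactly the top j layers, the form in which
   [trace_bound] applies. *)
set k' := (s0 + j)%N in le_k; set z' := z ^+ (2 ^ (k - k')).
have prim_z' : (f * 2 ^ k').-primitive_root z' by apply: tower_level_prim.
have gz' : g z' = z' ^+ f.+1 by rewrite /z' rmorphXn /= gz exprAC.
have Fx : x \in adj K z'.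
  apply: (tower_fixed dv4 prim_z gK gz) => //; first exact: Fp.
  by rewrite /k' addnC expnD autXM.
have [T DT] : exists T, (2 ^ j = T.+1)%N by exists (2 ^ j).-1; rewrite prednK ?expn_gt0.
rewrite DT in fix_x mv sum_x.
pose r (l : 'I_T.+1) := autX sigma l x.
have r0 : r ord0 = x by [].
have inj_lt (l m : 'I_T.+1) : (l < m)%N -> r l != r m.
  move=> lt_lm; rewrite /r -(subnKC (ltnW lt_lm)) autXD.
  apply/negP => /eqP/fmorph_inj/eqP; rewrite eq_sym; apply/negP/mv.
  by rewrite subn_gt0 lt_lm (leq_ltn_trans (leq_subr _ _)).
have inj_r : injective r.
  move=> l m E; apply: val_inj; apply: contrapT => /eqP; rewrite neq_ltn.
  by case/orP=> /inj_lt; rewrite E eqxx.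
have period m : autX sigma (m %% T.+1) x = autX sigma m x.
  rewrite {2}(divn_eq m T.+1) addnC autXD autXM; congr (autX _ _ _).
  by rewrite autX_fix.
have Er (l m : 'I_T.+1) : autX sigma l (r m) = r (l + m).
  by rewrite /r /= period autXD.
pose y := x ^+ T / \prod_(m | m != ord0) (r ord0 - r m).
have Ey (l : 'I_T.+1) : autX sigma l y = r l ^+ T / \prod_(m | m != l) (r l - r m).
  rewrite /y fmorph_div rmorphXn /= rmorph_prod /=; congr (_ / _).
  rewrite [RHS](reindex_inj (addrI l)) /=; apply: eq_big => m; last first.
    by rewrite rmorphB /= !Er addr0.
  by rewrite -[X in _ = (_ != X)]addr0 (inj_eq (addrI l)).
have nzr m : m != ord0 -> r ord0 - r m != 0.
  by move=> nm; rewrite subr_eq0 (inj_eq inj_r) eq_sym.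
have nzy : y != 0.
  by rewrite mulf_neq0 ?expf_neq0 // invr_eq0; apply/prodf_neq0.
have Fy : y \in adj K z'.
  apply: rpred_div; first exact: rpredX.
  apply: rpred_prod => m _; apply: rpredB => //.
  by rewrite /r /sigma -autXM; apply: (tower_stable gK gz').
have vy : v2 y = - \sum_(1 <= l < T.+1) v2 (x - autX sigma l x).
  rewrite /y v2M ?expf_neq0 ?invr_eq0 //; last by apply/prodf_neq0.
  rewrite v2X // vx mulr0 add0r v2V //; last by apply/prodf_neq0.
  rewrite (v2_prod R2 Rtot) //; congr (- _).
  apply: (@addrI _ (v2 (x - autX sigma 0 x))).
  by rewrite -[RHS](big_ltn (F := fun l => v2 (x - autX sigma l x))) // big_mkord [RHS](bigD1 ord0).
have le_C : (C + j <= k')%N by rewrite leq_add2r.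
have := trace_bound prim_z' gK gz' le_C Fy nzy.
rewrite addnK -/sigma DT (_ : \sum_(l < _) _ = 1); last first.
  by rewrite -[RHS](euler_trace inj_r); apply: eq_bigr => l _; rewrite Ey.
(* The trace bound now reads 0 >= - v(F'(x)) + j - C - 1, and v(F'(x)) <= j / 2. *)
rewrite /vge oner_eq0 v2_1 // vy /=.
rewrite -(ler_nat rat) natrM -[C.+1%:R]natr1.
move: sum_x; move: (\sum_(1 <= l < _) _) j%:R C%:R => A B D h1 h2; lra.
Qed.

Lemma path_orbit_bound : (s0 + 2 * C.+1 <= k)%N ->
  p n \in adj K (z ^+ (2 ^ (k - (s0 + 2 * C.+1)))).
Proof.
move=> le_k; have [j inv_j] := orbit_inv_end.
have le_jk : (s0 + j <= k)%N.
  by apply: orbit_level inv_j; apply: leq_trans le_k; rewrite leq_addr.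
have le_j := orbit_bound le_jk inv_j; have [fix_x _ _] := inv_j.
apply: (tower_fixed dv4 prim_z gK gz) => //; first exact: Fp.
rewrite addnC expnD autXM -(subnK le_j) expnD autXM; exact: autX_fix.
Qed.

End Orbit.
End Critical.
End Path.

Definition level_bound (alpha : algC) (kb : nat) :=
  forall k z (g : aut) p n, (f * 2 ^ k).-primitive_root z -> {in K, g =1 id} ->
    g z = z ^+ f.+1 -> bpath a c p n -> p 0%N = alpha ->
    (forall i, (i <= n)%N -> p i \in adj K z) -> (kb <= k)%N ->
  p n \in adj K (z ^+ (2 ^ (k - kb))).

Lemma level_bound_critical alpha : alpha \in K -> vgt (c - 1) 0 -> vgt (alpha - 1) 0 ->
  phi a c alpha != alpha -> exists kb, level_bound alpha kb.
Proof.
move=> Kal mc mal nfix.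
have mb : vgt (c - 1 + 2 * a) 0 by apply: vgtD => //; apply: (vgt0M R2 Rtot).
have [mu [mu_gt0 mu_small b_mu]] :
    exists mu : rat, [/\ 0 < mu, mu <= 4^-1 & vge (c - 1 + 2 * a) mu].
  case/orP: mb => [b0|b_gt0]; first by exists 4^-1; rewrite /vge b0.
  exists (Num.min 4^-1 (v2 (c - 1 + 2 * a))).
  by rewrite /vge lt_min b_gt0 !ge_min !lexx !orbT.
(* After m1 steps inside the disc, [path_contraction] would give v(phi(alpha) - alpha) >= m1 mu >
   rho. *)
pose rho := v2 (phi a c alpha - alpha); pose m1 := Num.bound `|rho / mu|.
have lt_rho : rho < m1%:R * mu.
  by rewrite -ltr_pdivrMr //; apply: le_lt_trans (ler_norm _) _; apply: archi_boundP.
pose s0 := maxn C m1; exists (s0 + 2 * C.+1)%N => k z g p n prim_z gK gz path_p Dp0 Fp le_k.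
have Kp0 : p 0%N \in K by rewrite Dp0.
have mp0 : vgt (p 0%N - 1) 0 by rewrite Dp0.
have le_m1s : (m1 <= s0)%N by rewrite leq_maxr.
(* A path too short to have left the disc is settled by its length alone. *)
have [lt_n|le_n] := ltnP n m1.
  apply: (tower_fixed dv4 prim_z gK gz le_k); first exact: Fp.
  have le_nk : (n <= s0 + 2 * C.+1)%N.
    by apply: leq_trans (ltnW lt_n) _; apply: leq_trans le_m1s _; apply: leq_addr.
  rewrite -(subnK le_nk) expnD autXM; apply: autX_fix.
  exact: (path_level gK path_p Kp0 (leqnn n)).
apply: (path_orbit_bound prim_z gK gz path_p Kp0 Fp mc mp0 mu_small (m1 := m1)) => //.
  have [i le_i near_i] : exists2 i, (i <= m1)%N & near p mu i.
    apply: contrapT => no_near.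
    have := @path_contraction p n path_p mc mp0 mu m1 le_n.
    rewrite Dp0 /vge subr_eq0 (negPf nfix) /= leNgt lt_rho /= => far; suff: false by []; apply: far.
    by move=> i le_i; apply/negP => near_i; apply: no_near; exists i.
  move=> l /andP[le_l le_ln].
  apply: (near_later path_p mc mp0 mu_gt0 b_mu (i := i)) => //.
  by rewrite le_ln (leq_trans le_i le_l).
exact: leq_maxl.
Qed.

Lemma level_bound_exists alpha : alpha \in K -> vgt c 0 \/ vgt (c - 1) 0 ->
  exists kb, level_bound alpha kb.
Proof.
move=> Kal [mc|mc].
  exists C.+1 => k z g p n prim_z gK gz path_p Dp0 Fp le_k.
  by apply: (path_case1 prim_z gK gz path_p) => //; rewrite Dp0.
have [mal|nmal] := boolP (vgt (alpha - 1) 0); last first.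
  exists C => k z g p n prim_z gK gz path_p Dp0 Fp le_k.
  by apply: (path_case2_noncritical prim_z gK gz path_p) => //; rewrite Dp0.
(* The preimages of a fixed point alpha are alpha and 1 / alpha. A path stays at alpha until it
   reaches 1 / alpha, and from there on it is a path above 1 / alpha, which is not fixed. *)
have [fix_al|nfix] := eqVneq (phi a c alpha) alpha; last exact: level_bound_critical.
have [Ral RVal nzal _] := congr1_unit mal.
have phiV : phi a c alpha^-1 = alpha by rewrite -[RHS]fix_al /phi invrK addrAC [a * _ + _]addrC addrAC.
have fiber p n : bpath a c p n -> p 0%N = alpha -> forall i, (i <= n)%N ->
    p i = alpha \/ exists2 l, (l <= i)%N & p l = alpha^-1 /\ alpha^-1 != alpha.
  move=> path_p Dp0; elim=> [|i IHi] lt_i; first by left.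
  have [E|[l le_l E]] := IHi (ltnW lt_i); last by right; exists l => //; apply: leqW.
  have [nz Ei] := path_p i lt_i; rewrite E -fix_al in Ei.
  have [Ex|Ex] := phi_fiber nza nz nzal Ei; first by left.
  have [self|nself] := eqVneq alpha^-1 alpha; first by left; rewrite Ex self.
  by right; exists i.+1.
have [self|nself] := eqVneq alpha^-1 alpha.
  exists 0%N => k z g p n prim_z gK gz path_p Dp0 Fp le_k.
  have [->|[l _ []]] := fiber p n path_p Dp0 n (leqnn n); first exact: adj_base.
  by rewrite self eqxx.
have [|||kb bd] := @level_bound_critical alpha^-1 _ mc.
  by rewrite rpredV.
  have -> : alpha^-1 - 1 = - (alpha - 1) * alpha^-1 by field.
  by apply: (vgt0M R2 Rtot) => //; rewrite vgtN.
  by rewrite phiV eq_sym.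
exists kb => k z g p n prim_z gK gz path_p Dp0 Fp le_k.
have [->|[l le_l [E _]]] := fiber p n path_p Dp0 n (leqnn n); first exact: adj_base.
have -> : p n = p (l + (n - l))%N by rewrite subnKC.
apply: (bd k z g (fun i => p (l + i)%N) (n - l)%N) => //; last first.
- by move=> i le_i; apply: Fp; rewrite -(subnKC le_l) leq_add2l.
- by rewrite addn0.
by move=> i lt_i; rewrite addnS; apply: path_p; rewrite -(subnKC le_l) ltn_add2l.
Qed.
End DynamicsAtTwo.

(** * Primes above 2 *)

Section PrimeAboveTwo.
Variables (K P : algC -> Prop).
Hypotheses (fieldK : is_subfield K) (P_above2 : prime_above_2 K P).
Local Notation OK := (ring_of_integers K).

Lemma integers_subring : subring OK.
Proof.
have [_ K1 KB KM _] := fieldK; split=> [|x y [Kx Zx] [Ky Zy]|x y [Kx Zx] [Ky Zy]].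
- by split=> //; apply: rpred1.
- by split; [apply: (KB) | apply: rpredB].
- by split; [apply: KM | apply: rpredM].
Qed.

Definition local_ring : set algC := fun x => exists s, [/\ OK s, ~ P s & OK (s * x)].

Lemma local_ring_subring : subring local_ring.
Proof.
have [O1 OB OM] := integers_subring; have [[PO [P0 PD PM P1 Pprime]] P2] := P_above2.
have prM s s' : OK s -> OK s' -> ~ P s -> ~ P s' -> ~ P (s * s').
  by move=> Os Os' nPs nPs' /(Pprime _ _ Os Os')[].
split=> [|x y [s [Os nPs Osx]] [s' [Os' nPs' Osy]]|x y [s [Os nPs Osx]] [s' [Os' nPs' Osy]]].
- by exists 1; rewrite mul1r; split.
- exists (s * s'); split; [exact: OM | exact: prM |].
  have -> : s * s' * (x - y) = s' * (s * x) - s * (s' * y) by ring.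
  by apply: (OB); apply: (OM).
- exists (s * s'); split; [exact: OM | exact: prM |].
  by rewrite mulrACA; apply: (OM).
Qed.

Lemma local_ring_half : ~ local_ring 2^-1.
Proof.
have [[PO [P0 PD PM P1 Pprime]] P2] := P_above2.
move=> [s [Os nPs Osh]]; apply: nPs.
by rewrite -(divfK (_ : 2 != 0) s) ?pnatr_eq0 //; apply: (PM).
Qed.

Lemma integers_int m : OK (m%:~R).
Proof.
have [_ K1 KB _ _] := fieldK; split; last by apply: Aint_Cint; apply: intr_int.
have [K0 _ _ _ _] := fieldK.
have KN x : K x -> K (- x) by move=> Kx; rewrite -sub0r; apply: (KB).
have Kn n : K n%:R.
  elim: n => // n IHn; have -> : n.+1%:R = n%:R - -1 :> algC by rewrite opprK natr1.
  by apply: (KB) => //; apply: (KN).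
by case: m => n; rewrite ?NegzE ?mulrNz; [|apply: (KN)]; rewrite -pmulrn; apply: Kn.
Qed.

Lemma integers_horner (q : {poly int}) x : OK x -> OK (pZtoC q).[x].
Proof.
have [O1 OB OM] := integers_subring; move=> Ox; elim/poly_ind: q => [|q m IHq].
  by rewrite rmorph0 horner0; apply: (integers_int 0).
rewrite rmorphD rmorphM /= map_polyX map_polyC /= hornerD hornerMX hornerC.
rewrite -[_%:~R]opprK -mulrNz; apply: (OB); [exact: OM | exact: integers_int].
Qed.

Section Dominating.
Variable R : subringClosed algC.
Hypotheses (R2 : 2^-1 \notin R) (Rtot : forall x, (x \in R) || (x^-1 \in R))
  (sAR : forall x, local_ring x -> x \in R).

Lemma outside_prime_inv s : OK s -> ~ P s -> s != 0 /\ s^-1 \in R.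
Proof.
have [O1 _ _] := integers_subring; have [[_ [P0 _ _ _ _]] _] := P_above2.
move=> Os nPs; have nzs : s != 0 by apply: contra_not_neq nPs => ->.
by split=> //; apply: sAR; exists s; rewrite divff.
Qed.

(** R is only known to contain the local ring at P and not 1/2, so P must still be shown to avoid
    the units of R. If x in P were such a unit, an even constant coefficient could be subtracted and
    x divided out, until an odd one makes the value congruent to 1 modulo P, hence a unit of R. For
    a monic equation of x the value 0 contradicts this. *)
Lemma odd_coef_horner (q : {poly int}) x i : P x -> x != 0 -> x^-1 \in R ->
  ~~ (2%:Z %| q`_i)%Z -> (pZtoC q).[x] / 2 \notin R.
Proof.
have [[PO [P0 PD PM P1 Pprime]] P2] := P_above2.
have [O1 OB OM] := integers_subring.
move=> Px nzx RVx; elim/poly_ind: q i => [|q m IHq] i; first by rewrite coef0.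
rewrite rmorphD rmorphM /= map_polyX map_polyC /= hornerD hornerMX hornerC.
have Oq := integers_horner q (PO _ Px); have nz2 : (2 : algC) != 0 by rewrite pnatr_eq0.
have [/dvdzP[m' ->]|odd_m] := boolP (2%:Z %| m)%Z; last first.
  move=> _; set s := _ + _; apply: contra R2 => Rs.
  have Os : OK s.
    rewrite /s -[_%:~R]opprK -mulrNz; apply: (OB); last exact: integers_int.
    by apply: (OM) => //; apply: PO.
  have [|nzs RVs] := outside_prime_inv Os; last by rewrite -[2^-1](mulKf nzs); apply: rpredM.
  move=> Ps; apply: P1.
  have m2 : (m %% 2)%Z = 1.
    have := modz_ge0 m (isT : 2%:Z != 0); have := ltz_mod m (isT : 2%:Z != 0).
    have /negP nz : (m %% 2)%Z != 0 by apply: contra odd_m => /eqP/dvdz_mod0P.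
    by move: nz; case: (m %% 2)%Z => [[|[|]]|].
  have -> : 1 = s + (- (pZtoC q).[x]) * x + (- (m %/ 2)%Z%:~R) * 2 :> algC.
    rewrite /s {1}(divz_eq m 2) m2 rmorphD rmorphM /=; ring.
  apply: (PD); last by apply: (PM) => //; rewrite -mulrNz; apply: integers_int.
  by apply: (PD) => //; apply: (PM) => //; rewrite -sub0r; apply: (OB) => //; apply: (integers_int 0).
case: i => [|i]; rewrite coefD coefMX coefC /=.
  by rewrite add0r dvdz_mull.
rewrite addr0 => /IHq; apply: contra => Rs.
have -> : (pZtoC q).[x] / 2 = (((pZtoC q).[x] * x + (m' * 2)%:~R) / 2 - m'%:~R) * x^-1.
  by rewrite rmorphM /=; field.
by apply: rpredM => //; apply: rpredB => //; apply: rpred_int.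
Qed.

Lemma prime_vgt x : P x -> vgt R x 0.
Proof.
have [[PO _] _] := P_above2.
move=> Px; have [Kx Zx] := PO _ Px; apply: contraT => nvx.
have Rx := R_Aint Rtot Zx.
have [nzx _] := unit_val0 R2 Rtot Rx nvx; have RVx := unit_inv R2 Rtot Rx nvx.
have [q mon_q rt_q] := (Aint_integralOver x).1 Zx.
have := @odd_coef_horner q x (size q).-1 Px nzx RVx.
by rewrite -lead_coefE (monicP mon_q) (rootP rt_q) mul0r rpred0 => /(_ isT).
Qed.

Lemma val_gt0_vgt x : val_gt0 K P x -> vgt R x 0.
Proof.
have [[PO [P0 PD PM _ _]] _] := P_above2.
move=> [s [Os nPs [r [Pr Dsx]]]]; have [nzs RVs] := outside_prime_inv Os nPs.
rewrite -(mulKf nzs x) mulrC; apply: (vgt0M R2 Rtot) => //; apply: prime_vgt.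
rewrite Dsx big_seq; apply: big_ind => // pq /Pr[Ppq Opq].
by rewrite mulrC; apply: (PM).
Qed.

Lemma val_eq0_v2 x : x != 0 -> val_eq0 K P x -> v2 R x = 0.
Proof.
have [O1 _ _] := integers_subring.
move=> nzx [[s [Os nPs Osx]] not1]; rewrite /= in Osx.
have nPsx : ~ P (s * x).
  move=> Psx; apply: not1; exists s; split=> //; exists [:: (s * x, 1)]; split.
    by move=> pq; rewrite inE => /eqP ->.
  by rewrite big_seq1 mulr1.
have [_ RVsx] := outside_prime_inv Osx nPsx; have [nzs RVs] := outside_prime_inv Os nPs.
have Rs := R_Aint Rtot (proj2 Os); have Rsx := R_Aint Rtot (proj2 Osx).
apply/eqP; rewrite eq_le; apply/andP; split; last first.
  by rewrite (v2_ge0 R2 Rtot) // -(mulKf nzs x); apply: rpredM.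
rewrite -oppr_ge0 -(v2V R2 Rtot nzx) (v2_ge0 R2 Rtot) ?invr_eq0 //.
have -> : x^-1 = s * (s * x)^-1 by rewrite invfM mulVKf.
exact: rpredM.
Qed.

End Dominating.

Lemma valuation_ring_above_prime : exists2 R : subringClosed algC,
    2^-1 \notin R /\ (forall x, (x \in R) || (x^-1 \in R))
  & (forall x, val_gt0 K P x -> vgt R x 0)
    /\ (forall x, x != 0 -> val_eq0 K P x -> v2 R x = 0).
Proof.
have [R sAR [R2 Rtot]] := valuation_ring_above local_ring_subring local_ring_half.
exists R => //; split=> x; first exact: val_gt0_vgt.
exact: val_eq0_v2.
Qed.

End PrimeAboveTwo.

Lemma coprime_succ_2exp f k : (4 %| f)%N -> coprime f.+1 (f * 2 ^ k).
Proof.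
move=> dv4; rewrite coprimeMr coprimeSn /= coprimeXr // coprimen2 /=.
by rewrite -dvdn2; apply: dvdn_trans dv4.
Qed.

(** A single root of unity Z, independent of the path, absorbs all cyclotomic preimages. *)
Lemma cyclotomic_preimages_adj (K : divringClosed algC) (R : subringClosed algC)
    (t a c alpha : algC) :
    t \in K -> t \in Aint -> {subset K <= adj Crat t} ->
    a \in K -> c \in K -> a != 0 -> alpha \in K ->
    2^-1 \notin R -> (forall x, (x \in R) || (x^-1 \in R)) ->
    v2 R a = 0 -> vgt R c 0 \/ vgt R (c - 1) 0 ->
  exists M Z, [/\ (0 < M)%N, Z ^+ M = 1 & forall n p N z, p 0%N = alpha ->
    bpath a c p n -> (0 < N)%N -> z ^+ N = 1 -> p n \in adj K z -> p n \in adj K Z].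
Proof.
move=> Kt Zt sKt Ka Kc nza Kal R2 Rtot va vc.
have [D D_gt0 discD] := disc_multiple_exists Zt.
have [f [f_gt0 dv4 ind] red] := odd_reduction Kt Zt sKt Ka Kc nza Kal.
pose C := Num.bound `|v2 R D%:R|.
have DC : v2 R D%:R <= C%:R.
  by apply: (le_trans (ler_norm _)); apply: ltW; apply: archi_boundP.
have [kb bd] := level_bound_exists R2 Rtot dv4 Ka Kc nza va
  (@tower_inertia _ _ _ _ _ _ Kt Zt sKt discD D_gt0 ind dv4 R2 Rtot DC)
  (@tower_trace_bound_local _ _ _ _ _ _ Kt Zt sKt discD D_gt0 ind dv4 R2 Rtot DC)
  Kal vc.
have M_gt0 : (0 < f * 2 ^ kb)%N by rewrite muln_gt0 f_gt0 expn_gt0.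
have [Z prim_Z] := C_prim_root_exists M_gt0.
exists (f * 2 ^ kb)%N, Z; split=> //; first exact: prim_expr_order.
move=> n p N z Dp0 path_p N_gt0 zN Fpn.
have [k [z' [prim_z' Fpn']]] := red n p N z Dp0 path_p N_gt0 zN Fpn.
have root_adj w : w ^+ (f * 2 ^ kb) = 1 -> {subset adj K w <= adj K Z}.
  move=> w1; have [i ->] := prim_rootP prim_Z w1.
  apply: sub_adj => [x|]; first exact: adj_base.
  by apply: rpredX; apply: adj_gen.
have [le_k|lt_k] := leqP kb k; last first.
  apply: (root_adj z') => //; rewrite -(subnKC (ltnW lt_k)) expnD mulnA exprM.
  by rewrite (prim_expr_order prim_z') expr1n.
have mod1 : f.+1 = 1 %[mod f] by rewrite -addn1 modnDl.
(* The map z -> z^(f + 1) is trivial on the f-th roots of unity, hence is realised over K. *)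
have [g gK gz] := cyclo_aut ind prim_z' (dvdn_mulr _ (dvdnn f)) (coprime_succ_2exp k dv4) mod1.
apply: (root_adj (z' ^+ (2 ^ (k - kb)))).
  by rewrite (prim_expr_order (tower_level_prim prim_z' le_k)).
apply: (bd k z' g p n) => // i le_i.
by apply: (bpath_in Ka Kc _ path_p Fpn') => // x; apply: adj_base.
Qed.

Lemma adj_is_subfield (K : divringClosed algC) z : is_subfield (fun x => x \in adj K z).
Proof.
split=> [||x y Fx Fy|x y Fx Fy|x Fx]; [exact: rpred0 | exact: rpred1 | exact: rpredB
  | exact: rpredM | by rewrite rpredV].
Qed.

Lemma backward_orbit_bpath a c alpha gamma : backward_orbit a c alpha gamma ->
  exists n p, [/\ p 0%N = alpha, bpath a c p n & p n = gamma].
Proof.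
move=> [n [nz Dal]]; exists n, (fun i => iter (n - i) (phi a c) gamma).
rewrite subn0 subnn; split=> // i lt_i; rewrite -[(n - i)%N]subnSK //=; split=> //.
by apply: nz; rewrite -subn_gt0 subKn // ltnW.
Qed.

Theorem theorem3p10 (K : algC -> Prop) (a c alpha : algC) :
  number_field K -> K a -> K c -> a != 0 -> K alpha ->
  (exists P : algC -> Prop, prime_above_2 K P /\
     ((val_eq0 K P a /\ val_gt0 K P c) \/
      (val_eq0 K P a /\ 4 < exp_weil_height a /\ congr_mod K P c 1))) ->
  fin_dim_over K (Kc_infty K a c alpha).
Proof.
move=> [fieldK finK] Ka Kc nza Kal [P [P_above2 hyp]].
have [R [R2 Rtot] [Rgt Req]] := valuation_ring_above_prime fieldK P_above2.
have va : v2 R a = 0 by apply: Req => //; case: hyp => -[].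
have vc : vgt R c 0 \/ vgt R (c - 1) 0.
  by case: hyp => [[_ /Rgt]|[_ [_ /Rgt]]]; [left | right].
pose K0 : {pred algC} := fun x => `[< K x >].
have K0_divring : divring_closed K0.
  have [_ K1 KB KM KV] := fieldK; split; first exact/asboolP.
    by move=> x y /asboolP Kx /asboolP Ky; apply/asboolP/KB.
  by move=> x y /asboolP Kx /asboolP Ky; apply/asboolP/KM => //; apply: KV.
pose K0m := GRing.isDivringClosed.Build _ K0 K0_divring.
pose K' : divringClosed algC := HB.pack K0 K0m.
have KP x : reflect (K x) (x \in K') by apply: asboolP.
have finK' : fin_dim_over (fun x => x \in Crat) (fun x => x \in K').
  by have [B spanB] := finK; exists B => x /KP; apply: spanB.
have [t [Kt Zt sKt]] := number_field_generator finK'.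
have [M [Z [M_gt0 Z1 adjZ]]] := cyclotomic_preimages_adj Kt Zt sKt (introT (KP _) Ka)
  (introT (KP _) Kc) nza (introT (KP _) Kal) R2 Rtot va vc.
(* Since Z^M = 1, these powers span K(Z), a field containing all the generators. *)
exists [seq Z ^+ i | i <- iota 0 M] => x Fx; rewrite size_map size_iota.
have {Fx} : x \in adj K' Z.
  apply: (Fx (fun x => x \in adj K' Z)); first exact: adj_is_subfield.
    by move=> y /KP; apply: adj_base.
  move=> y [/backward_orbit_bpath[n [p [Dp0 path_p <-]]] [N [z [N_gt0 [zN Fy]]]]].
  apply: (adjZ n p N z) => //; apply: (Fy (fun x => x \in adj K' z)).
  - exact: adj_is_subfield.
  - by move=> u /KP; apply: adj_base.
  - by move=> _ ->; apply: adj_gen.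
case/(adj_expand1 M_gt0 Z1) => k Kk ->; exists [seq k i | i <- iota 0 M].
rewrite size_map size_iota; split=> // [_ /mapP[i _ ->]|]; first exact/KP.
apply: eq_bigr => i _; rewrite !(nth_map 0%N) ?size_iota //.
by rewrite nth_iota.
Qed.
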